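(* Let $1<p<q<\infty$. Then there is a family of closed ideals of $\mathcal{L}(\ell_p,\ell_q)$ which has the cardinality of the continuum, is a chain (i.e. is totally ordered by inclusion), and each of whose members $\mathcal{J}$ satisfies \[ \mathcal{J}^{I_{p,q}}\subset \mathcal{J}\subset \mathcal{FS}(\ell_p,\ell_q). \]
   Context: $\mathcal{L}(X,Y)$ denotes the space of bounded linear operators from the Banach space $X$ to the Banach space $Y$, with the operator norm, and $\mathcal{L}(X)=\mathcal{L}(X,X)$. An ideal of $\mathcal{L}(X,Y)$ is a linear subspace $\mathcal{J}\subset\mathcal{L}(X,Y)$ such that $ATB\in\mathcal{J}$ whenever $A\in\mathcal{L}(Y)$, $T\in\mathcal{J}$ and $B\in\mathcal{L}(X)$; a closed ideal is one closed in the operator norm. $I_{p,q}\colon\ell_p\to\ell_q$ is the formal inclusion map, sending the $i$-th unit vector of $\ell_p$ to the $i$-th unit vector of $\ell_q$. For an operator $T\colon U\to V$ between Banach spaces, $\mathcal{J}^T=\mathcal{J}^T(\ell_p,\ell_q)$ is the closure in $\mathcal{L}(\ell_p,\ell_q)$ of the set of finite sums of operators of the form $ATB$ with $A\in\mathcal{L}(V,\ell_q)$, $B\in\mathcal{L}(\ell_p,U)$. An operator $T\in\mathcal{L}(X,Y)$ is finitely strictly singular if for every $\varepsilon>0$ there is $n\in\mathbb{N}$ such that every subspace $E\subset X$ with $\dim E\ge n$ contains some $x$ with $\|Tx\|<\varepsilon\|x\|$. $\mathcal{FS}(X,Y)$ denotes the (closed) ideal of finitely strictly singular operators. *)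

(* Defs.v *)
From HB Require Import structures.
From mathcomp Require Import all_boot all_order all_algebra.
From mathcomp Require Import all_classical all_reals all_analysis.
From mathcomp Require Import complex.

Set Implicit Arguments.
Unset Strict Implicit.
Unset Printing Implicit Defensive.
Import Order.TTheory GRing.Theory Num.Theory.
Import numFieldNormedType.Exports.
Local Open Scope classical_set_scope.
Local Open Scope ring_scope.

(* The norm of a normed module over [K] is [K]-valued in the library.  A scalar
   field over [R] records how [R] sits inside [K] and the [R]-valued modulus, so
   that real and complex spaces can be handled at once. *)
Record scalarField (R : realType) := ScalarField {
  scalar :> numFieldType;
  ofreal : {rmorphism R -> scalar};
  modulus : scalar -> R;
  ler_ofreal : {mono ofreal : r s / r <= s};
  ofreal_modulus : forall z, ofreal (modulus z) = `|z| }.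

Arguments ofreal {R s}.
Arguments modulus {R s}.

Section Instances.
Variable R : realType.

Definition real_scalars : scalarField R :=
  @ScalarField R R idfun Num.norm (fun _ _ => erefl) (fun _ => erefl).

Lemma ler_real_complex : {mono (real_complex R) : r s / r <= s}.
Proof. by move=> r s; rewrite lecR. Qed.

Lemma real_complex_normc (z : R[i]) : real_complex R (Normc.normc z) = `|z|.
Proof. by []. Qed.

Definition complex_scalars : scalarField R :=
  @ScalarField R R[i] (real_complex R) (@Normc.normc R)
    ler_real_complex real_complex_normc.

End Instances.

Section ScalarTheory.
Variables (R : realType) (K : scalarField R).
Implicit Types (z w : K) (r s : R).

Lemma ofreal_inj : injective (@ofreal R K).
Proof. by move=> r s rs; apply/eqP; rewrite eq_le -!(ler_ofreal K) rs !lexx. Qed.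

Lemma modulus_ge0 z : 0 <= modulus z.
Proof. by rewrite -(ler_ofreal K) rmorph0 ofreal_modulus. Qed.

Lemma modulus0 : modulus (0 : K) = 0.
Proof. by apply: ofreal_inj; rewrite ofreal_modulus normr0 rmorph0. Qed.

Lemma modulus_eq0 z : modulus z = 0 -> z = 0.
Proof.
by move=> z0; apply/eqP; rewrite -normr_eq0 -ofreal_modulus z0 rmorph0.
Qed.

Lemma modulusM z w : modulus (z * w) = modulus z * modulus w.
Proof. by apply: ofreal_inj; rewrite rmorphM/= !ofreal_modulus normrM. Qed.

Lemma modulusVr z : z != 0 -> modulus z * modulus z^-1 = 1.
Proof.
move=> z0; apply: (@ofreal_inj); rewrite -modulusM mulfV//.
by rewrite ofreal_modulus normr1 rmorph1.
Qed.

Lemma modulusD z w : modulus (z + w) <= modulus z + modulus w.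
Proof. by rewrite -(ler_ofreal K) rmorphD/= !ofreal_modulus ler_normD. Qed.

Lemma ler_modulus z r : (modulus z <= r) = (`|z| <= ofreal r).
Proof. by rewrite -(ler_ofreal K) ofreal_modulus. Qed.

Lemma ofreal_ge0 r : (0 <= (ofreal r : K)) = (0 <= r).
Proof. by rewrite -(rmorph0 (@ofreal R K)) ler_ofreal. Qed.

End ScalarTheory.

Section SequenceSpace.
Variables (R : realType) (K : scalarField R).
Implicit Types (p : R) (x y : nat -> (scalar K)^o).
Local Open Scope ereal_scope.

Lemma ge0_lee_poweR r (s t : \bar R) : (0 <= r)%R -> 0 <= s -> s <= t ->
  s `^ r <= t `^ r.
Proof.
move=> r0 s0 st; apply: gt0_ler_poweR => //.
  by rewrite in_itv/= leey andbT.
by rewrite in_itv/= leey andbT (le_trans s0).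
Qed.

Definition ell_enorm p x : \bar R :=
  'N[@counting nat R]_p%:E [EFin \o (fun i => modulus (x i))].

Lemma ell_enormE p x : (0 < p)%R ->
  ell_enorm p x = (\sum_(k <oo) (modulus (x k) `^ p)%:E) `^ p^-1.
Proof.
move=> p0; rewrite /ell_enorm Lnorm_counting//; congr (_ `^ _).
apply: eq_eseriesr => k _ /=.
by rewrite ger0_norm ?modulus_ge0// poweR_EFin.
Qed.

Lemma ell_enorm_ge0 p x : 0 <= ell_enorm p x.
Proof. exact: Lnorm_ge0. Qed.

Lemma le_ell_enorm p x y : (0 < p)%R ->
  (forall k, modulus (x k) <= modulus (y k))%R ->
  ell_enorm p x <= ell_enorm p y.
Proof.
move=> p0 xy; rewrite !ell_enormE//; apply: ge0_lee_poweR.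
- by rewrite invr_ge0 ltW.
- by rewrite nneseries_ge0// => *; rewrite lee_fin powR_ge0.
apply: lee_nneseries => [k _ _|k _]; first by rewrite lee_fin powR_ge0.
by rewrite lee_fin ge0_ler_powR ?nnegrE ?modulus_ge0 ?(ltW p0).
Qed.

Lemma modulus_le_ell_enorm p x k : (0 < p)%R -> (modulus (x k))%:E <= ell_enorm p x.
Proof.
move=> p0; rewrite ell_enormE//.
have -> : (modulus (x k))%:E = (modulus (x k) `^ p)%:E `^ p^-1.
  by rewrite poweR_EFin -powRrM mulfV ?gt_eqF// powRr1 ?modulus_ge0.
have h j : 0 <= (modulus (x j) `^ p)%:E by rewrite lee_fin powR_ge0.
apply: ge0_lee_poweR.
- by rewrite invr_ge0 ltW.
- by [].
apply: (@le_trans _ _ (\sum_(0 <= i < k.+1) (modulus (x i) `^ p)%:E)).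
  by rewrite big_nat_recr//= leeDr// sume_ge0.
by apply: nneseries_lim_ge => *; exact: h.
Qed.

Lemma ell_enorm0 p : (0 < p)%R -> ell_enorm p 0%R = 0.
Proof.
move=> p0; rewrite ell_enormE// eseries0 ?poweR0r ?invr_neq0 ?gt_eqF//.
by move=> k _ _; rewrite modulus0 powR0 ?gt_eqF.
Qed.

Lemma ell_enormD p x y : (1 <= p)%R ->
  ell_enorm p (x + y)%R <= ell_enorm p x + ell_enorm p y.
Proof.
move=> p1; have p0 : (0 < p)%R by exact: lt_le_trans p1.
pose a i := modulus (x i); pose b i := modulus (y i).
apply: (@le_trans _ _ ('N[@counting nat R]_p%:E [EFin \o (a \+ b)%R])); last first.
  by apply: minkowski_EFin.
rewrite ell_enormE// Lnorm_counting//; apply: ge0_lee_poweR.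
- by rewrite invr_ge0 ltW.
- by rewrite nneseries_ge0// => *; rewrite lee_fin powR_ge0.
apply: lee_nneseries => [k _ _|k _]; first by rewrite lee_fin powR_ge0.
have ab : (0 <= a k + b k)%R by rewrite addr_ge0 ?modulus_ge0.
rewrite /= ger0_norm// lee_fin.
by rewrite ge0_ler_powR ?nnegrE ?modulus_ge0 ?(ltW p0)//; exact: modulusD.
Qed.

Lemma ell_enormZ_le p (a : K) x : (1 <= p)%R ->
  ell_enorm p (a *: x)%R <= (modulus a)%:E * ell_enorm p x.
Proof.
move=> p1; have p0 : (0 < p)%R by exact: lt_le_trans p1.
have h j : 0 <= (modulus (x j) `^ p)%:E by rewrite lee_fin powR_ge0.
have a0 := modulus_ge0 a.
rewrite !ell_enormE//.
under eq_eseriesr do rewrite modulusM powRM ?modulus_ge0// EFinM.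
rewrite nneseriesZl// poweRM ?nneseries_ge0 ?lee_fin ?powR_ge0//.
by rewrite poweR_EFin -powRrM mulfV ?gt_eqF// powRr1.
Qed.

Definition ell_pred p : {pred nat -> (scalar K)^o} := fun x => ell_enorm p x < +oo.

(* The proof [p1] is carried by the type: it is what makes [ell_enorm p] a norm. *)
Record ell p (p1 : (1 <= p)%R) := Ell {
  ell_fun :> nat -> (scalar K)^o;
  ell_funP : ell_fun \in ell_pred p }.

End SequenceSpace.

Section EllModule.
Variables (R : realType) (K : scalarField R) (p : R) (p1 : 1 <= p).
Local Notation E := (@ell R K p p1).

Let p0 : 0 < p. Proof. exact: lt_le_trans p1. Qed.

HB.instance Definition _ := [isSub for @ell_fun R K p p1].
HB.instance Definition _ := gen_eqMixin E.
HB.instance Definition _ := gen_choiceMixin E.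

Lemma ell_submod_closed : submod_closed (@ell_pred R K p).
Proof.
split; first by rewrite unfold_in ell_enorm0.
move=> a x y; rewrite !unfold_in => xf yf.
apply: le_lt_trans (ell_enormD _ _ p1) _; rewrite lte_add_pinfty//.
apply: le_lt_trans (ell_enormZ_le _ _ p1) _.
by rewrite lte_mul_pinfty ?lee_fin ?modulus_ge0.
Qed.

HB.instance Definition _ :=
  GRing.isSubmodClosed.Build _ _ (@ell_pred R K p) ell_submod_closed.
HB.instance Definition _ := [SubChoice_isSubLmodule of E by <:].

Definition ell_norm (x : E) : R := fine (ell_enorm p x).

Lemma ell_normE (x : E) : (ell_norm x)%:E = ell_enorm p x.
Proof.
rewrite /ell_norm fineK// ge0_fin_numE ?ell_enorm_ge0//; exact: (ell_funP x).
Qed.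

Lemma ell_normD (x y : E) : ell_norm (x + y) <= ell_norm x + ell_norm y.
Proof. by rewrite -lee_fin EFinD !ell_normE; exact: ell_enormD. Qed.

Lemma ell_normZ_le (a : K) (x : E) : ell_norm (a *: x) <= modulus a * ell_norm x.
Proof. by rewrite -lee_fin EFinM !ell_normE; exact: ell_enormZ_le. Qed.

Lemma modulus_le_ell_norm (x : E) k : modulus (x k) <= ell_norm x.
Proof. by rewrite -lee_fin ell_normE; exact: modulus_le_ell_enorm. Qed.

Lemma ell_norm_ge0 (x : E) : 0 <= ell_norm x.
Proof. by rewrite -lee_fin ell_normE; exact: ell_enorm_ge0. Qed.

Lemma ell_norm0_eq0 (x : E) : ell_norm x = 0 -> x = 0.
Proof.
move=> x0; apply/val_inj/funext => k /=; apply: modulus_eq0; apply/eqP.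
by rewrite eq_le modulus_ge0 andbT -x0; exact: modulus_le_ell_norm.
Qed.

Lemma ell_normZ (a : K) (x : E) : ell_norm (a *: x) = modulus a * ell_norm x.
Proof.
apply/eqP; rewrite eq_le ell_normZ_le/=; have [->|a0] := eqVneq a 0.
  by rewrite modulus0 mul0r ell_norm_ge0.
have ma := modulusVr a0.
have := ell_normZ_le a^-1 (a *: x); rewrite scalerA mulVf// scale1r.
move=> /(ler_wpM2l (modulus_ge0 a)); by rewrite mulrA ma mul1r.
Qed.

Let nrm (x : E) : K := ofreal (ell_norm x).

Let nrmD x y : nrm (x + y) <= nrm x + nrm y.
Proof. by rewrite /nrm -rmorphD ler_ofreal ell_normD. Qed.

Let nrmZ (a : K) x : nrm (a *: x) = `|a| * nrm x.
Proof. by rewrite /nrm ell_normZ rmorphM/= ofreal_modulus. Qed.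

Let nrm0 x : nrm x = 0 -> x = 0.
Proof.
by rewrite /nrm -(rmorph0 (@ofreal R K)) => /ofreal_inj; exact: ell_norm0_eq0.
Qed.

HB.instance Definition _ := @Lmodule_isNormed.Build K E nrm nrmD nrmZ nrm0.

Lemma norm_ellE (x : E) : `|x| = ofreal (ell_norm x).
Proof. by []. Qed.

End EllModule.

Section BoundedOperators.
Variables (R : realType) (K : scalarField R) (X Y : normedModType K).

Definition bounded_linear (f : X -> Y) :=
  linear f /\ exists M : K, forall x, `|f x| <= M * `|x|.

Definition bop_pred : {pred X -> Y} := fun f => `[< bounded_linear f >].

Record bop := Bop { bop_fun :> X -> Y; bop_funP : bop_fun \in bop_pred }.

HB.instance Definition _ := [isSub for bop_fun].
HB.instance Definition _ := gen_eqMixin bop.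
HB.instance Definition _ := gen_choiceMixin bop.

Lemma bop_submod_closed : submod_closed bop_pred.
Proof.
split.
  apply/asboolP; split; first by move=> a x y /=; rewrite scaler0 addr0.
  by exists 0 => x; rewrite mul0r normr0.
move=> a f g /asboolP[lf [M fM]] /asboolP[lg [N gN]]; apply/asboolP; split.
  have afgE z : (a *: f + g) z = a *: f z + g z by [].
  move=> b x y; rewrite !afgE lf lg !scalerDr !scalerA (mulrC b a).
  by rewrite addrACA.
exists (`|a| * M + N) => x /=; rewrite mulrDl -mulrA.
apply: le_trans (ler_normD _ _) _; apply: lerD => //.
by rewrite normrZ ler_wpM2l.
Qed.

HB.instance Definition _ :=
  GRing.isSubmodClosed.Build _ _ bop_pred bop_submod_closed.
HB.instance Definition _ := [SubChoice_isSubLmodule of bop by <:].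

Lemma bop_linear (f : bop) : linear f.
Proof. by have /asboolP[] := bop_funP f. Qed.

HB.instance Definition _ (f : bop) := GRing.isLinear.Build K X Y _ f (bop_linear f).

Definition opnorm (f : bop) : R := sup [set modulus `|f x| | x in [set x | `|x| <= 1]].

Lemma opnorm_has_sup (f : bop) : has_sup [set modulus `|f x| | x in [set x | `|x| <= 1]].
Proof.
split; first by exists (modulus `|f 0|); exists 0 => //=; rewrite normr0 ler01.
have /asboolP[_ [M fM]] := bop_funP f.
exists (modulus M) => _ [x /= x1 <-]; rewrite ler_modulus ofreal_modulus normr_id.
have [->|x0] := eqVneq x 0; first by rewrite raddf0 normr0.
have M0 : 0 <= M.
  rewrite -(@pmulr_lge0 _ `|x|) ?normr_gt0//; exact: le_trans (fM x).
by apply: le_trans (fM x) _; rewrite ger0_norm// ler_piMr.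
Qed.

Lemma opnorm_le (f : bop) M : (forall x, `|x| <= 1 -> `|f x| <= ofreal M) -> opnorm f <= M.
Proof.
move=> h; apply: ge_sup; first exact: (opnorm_has_sup f).1.
by move=> _ [x /= x1 <-]; rewrite ler_modulus normr_id; exact: h.
Qed.

Lemma opnorm_ge0 (f : bop) : 0 <= opnorm f.
Proof.
apply: (@le_trans _ _ (modulus `|f 0|)); first exact: modulus_ge0.
apply: ub_le_sup; first exact: (opnorm_has_sup f).2.
by exists 0 => //=; rewrite normr0 ler01.
Qed.

Lemma norm_le_opnorm (f : bop) x : `|f x| <= ofreal (opnorm f) * `|x|.
Proof.
have [->|x0] := eqVneq x 0; first by rewrite raddf0 !normr0 mulr0.
have nx : 0 < `|x| by rewrite normr_gt0.
rewrite -ler_pdivrMr// mulrC.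
have -> : `|x|^-1 * `|f x| = `|f (`|x|^-1 *: x)|.
  by rewrite linearZ normrZ normfV normr_id.
rewrite -[leLHS]normr_id -ler_modulus; apply: ub_le_sup; first exact: (opnorm_has_sup f).2.
by exists (`|x|^-1 *: x) => //=; rewrite normrZ normfV normr_id mulVf ?gt_eqF.
Qed.

Lemma opnormD (f g : bop) : opnorm (f + g) <= opnorm f + opnorm g.
Proof.
apply: opnorm_le => x x1; apply: le_trans (ler_normD _ _) _; rewrite rmorphD/=.
by apply: lerD; apply: le_trans (norm_le_opnorm _ _) _;
  rewrite ler_piMr// ofreal_ge0 opnorm_ge0.
Qed.

Lemma opnormZ_le (a : K) (f : bop) : opnorm (a *: f) <= modulus a * opnorm f.
Proof.
apply: opnorm_le => x x1; rewrite rmorphM/= ofreal_modulus.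
rewrite [leLHS](normrZ a (f x)) ler_wpM2l//.
by apply: le_trans (norm_le_opnorm _ _) _; rewrite ler_piMr// ofreal_ge0 opnorm_ge0.
Qed.

Lemma opnormZ (a : K) (f : bop) : opnorm (a *: f) = modulus a * opnorm f.
Proof.
apply/eqP; rewrite eq_le opnormZ_le/=; have [->|a0] := eqVneq a 0.
  by rewrite modulus0 mul0r opnorm_ge0.
have ma := modulusVr a0.
have := opnormZ_le a^-1 (a *: f); rewrite scalerA mulVf// scale1r.
by move=> /(ler_wpM2l (modulus_ge0 a)); rewrite mulrA ma mul1r.
Qed.

Lemma opnorm0_eq0 (f : bop) : opnorm f = 0 -> f = 0.
Proof.
move=> f0; apply/val_inj/funext => x /=; apply/eqP; rewrite -normr_le0.
by apply: le_trans (norm_le_opnorm f x) _; rewrite f0 rmorph0 mul0r.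
Qed.

Let nrm (f : bop) : K := ofreal (opnorm f).

Let nrmD f g : nrm (f + g) <= nrm f + nrm g.
Proof. by rewrite /nrm -rmorphD ler_ofreal opnormD. Qed.

Let nrmZ (a : K) f : nrm (a *: f) = `|a| * nrm f.
Proof. by rewrite /nrm opnormZ rmorphM/= ofreal_modulus. Qed.

Let nrm0 f : nrm f = 0 -> f = 0.
Proof.
by rewrite /nrm -(rmorph0 (@ofreal R K)) => /ofreal_inj; exact: opnorm0_eq0.
Qed.

HB.instance Definition _ := @Lmodule_isNormed.Build K bop nrm nrmD nrmZ nrm0.

Lemma norm_bopE (f : bop) : `|f| = ofreal (opnorm f).
Proof. by []. Qed.

End BoundedOperators.

Arguments bop_pred {R K} X Y.

Section Composition.
Variables (R : realType) (K : scalarField R) (X Y Z : normedModType K).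

Lemma bcomp_subproof (g : bop Y Z) (f : bop X Y) : (g \o f) \in @bop_pred R K X Z.
Proof.
apply/asboolP; split; first by move=> a x y /=; rewrite !linearP.
exists (ofreal (opnorm g) * ofreal (opnorm f)) => x /=.
apply: le_trans (norm_le_opnorm _ _) _; rewrite -mulrA ler_wpM2l//.
  by rewrite ofreal_ge0 opnorm_ge0.
exact: norm_le_opnorm.
Qed.

Definition bcomp (g : bop Y Z) (f : bop X Y) : bop X Z := Bop (bcomp_subproof g f).

End Composition.

Section Ideals.
Variables (R : realType) (K : scalarField R) (X Y : normedModType K).

Definition op_ideal (J : set (bop X Y)) :=
  [/\ J 0,
      forall (a : K) S T, J S -> J T -> J (a *: S + T) &
      forall (A : bop Y Y) T (B : bop X X), J T -> J (bcomp A (bcomp T B))].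

Definition closed_ideal (J : set (bop X Y)) := op_ideal J /\ closed J.

Definition closed_ideal_gen (U V : normedModType K) (T : bop U V) : set (bop X Y) :=
  closure [set S | exists (n : nat) (A : 'I_n -> bop V Y) (B : 'I_n -> bop X U),
                     S = \sum_(i < n) bcomp (A i) (bcomp T (B i))].

Definition subspace (E : set X) :=
  E 0 /\ forall (a : K) x y, E x -> E y -> E (a *: x + y).

Definition lin_indep (n : nat) (v : 'I_n -> X) :=
  forall a : 'I_n -> K, \sum_(i < n) a i *: v i = 0 -> forall i, a i = 0.

(* [E] may be infinite dimensional. *)
Definition dim_ge (n : nat) (E : set X) :=
  exists v : 'I_n -> X, lin_indep v /\ forall i, E (v i).

(* In [K], [0 < eps] entails that [eps] is real. *)
Definition finitely_strictly_singular (T : bop X Y) :=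
  forall eps : K, 0 < eps -> exists n : nat,
    forall E : set X, subspace E -> dim_ge n E ->
      exists2 x, E x & `|T x| < eps * `|x|.

Definition FS : set (bop X Y) := [set T | finitely_strictly_singular T].

End Ideals.

Arguments closed_ideal_gen {R K} X Y {U V} T.
Arguments FS {R K} X Y.

Section FormalInclusion.
Variables (R : realType) (K : scalarField R) (p q : R).
Hypotheses (p1 : 1 <= p) (q1 : 1 <= q) (pq : p <= q).

Lemma ell_enorm_incl (x : ell K p1) :
  (ell_enorm q x <= (ell_norm x)%:E)%E.
Proof.
have p0 : 0 < p by exact: lt_le_trans p1.
have q0 : 0 < q by exact: lt_le_trans q1.
have N0 := ell_norm_ge0 x.
set N := ell_norm x in N0 *.
have NE : (\sum_(k <oo) (modulus (x k) `^ p)%:E = (N `^ p)%:E)%E.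
  rewrite -poweR_EFin ell_normE ell_enormE// -poweRrM mulVf ?gt_eqF// poweRe1//.
  by apply: nneseries_ge0 => *; rewrite lee_fin powR_ge0.
have -> : N%:E = ((N `^ q)%:E `^ q^-1)%E.
  by rewrite poweR_EFin -powRrM mulfV ?gt_eqF// powRr1.
rewrite ell_enormE//; apply: ge0_lee_poweR.
- by rewrite invr_ge0 ltW.
- by rewrite nneseries_ge0// => *; rewrite lee_fin powR_ge0.
have split_q (t : R) : t `^ q = t `^ (q - p) * t `^ p.
  by rewrite -powRD subrK// gt_eqF.
rewrite (split_q N) EFinM -NE -nneseriesZl; last first.
  by move=> *; rewrite lee_fin powR_ge0.
apply: lee_nneseries => [k _ _|k _]; first by rewrite lee_fin powR_ge0.
rewrite split_q lee_fin ler_wpM2r ?powR_ge0//.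
by rewrite ge0_ler_powR ?nnegrE ?modulus_ge0 ?subr_ge0// modulus_le_ell_norm.
Qed.

Lemma incl_subproof (x : ell K p1) : (x : nat -> (scalar K)^o) \in @ell_pred R K q.
Proof. by rewrite unfold_in; apply: le_lt_trans (ell_enorm_incl x) (ltry _). Qed.

Definition incl_fun (x : ell K p1) : ell K q1 := Ell q1 (incl_subproof x).

Lemma incl_fun_bounded : incl_fun \in bop_pred (ell K p1) (ell K q1).
Proof.
apply/asboolP; split; first by move=> a x y; exact/val_inj.
exists 1 => x; rewrite mul1r !norm_ellE ler_ofreal -lee_fin ell_normE.
exact: ell_enorm_incl.
Qed.

Definition formal_inclusion : bop (ell K p1) (ell K q1) := Bop incl_fun_bounded.

Lemma formal_inclusionE (x : ell K p1) i : formal_inclusion x i = x i.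
Proof. by []. Qed.

End FormalInclusion.

Arguments formal_inclusion {R} K {p q} p1 q1 pq.

(* Main.v *)
(* On a sequence of levels n put vectors r_{n,i} (i < N_n) in l_p and functionals g_{n,i} on l_q.  One
   family and its biorthogonal system are built from independent symmetric {-1,0,1}-valued variables
   which vanish outside an event of small probability delta_n, the other from independent signs.  By
   Rosenthal's inequality the former span, in L_r with r > 2, the norm of l_r plus w_n times that of
   l_2, where w_n = delta_n^(1/2-1/r); signs span l_2.  A set D of levels gives an operator T^D, the
   direct sum over n in D of the maps r_{n,i} |-> v_{n,i} with v_{n,i} biorthogonal to g_{n,i}.

   Let tau_n(S) be the average of g_{n,i}(S r_{n,i}) over i < N_n.  Then tau_n(T^D) = 1 for n in D.  If
   delta_n and N_n are well chosen, then for all operators A and B, tau_n(A S B) tends to 0 both for the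
   formal inclusion S and for S = T^D along the n outside D: the levels below n are too few, and at the
   scale N_n those above look like l_r, allowing a gain N_n^(-gamma).

   Let psi be a real sequence visiting every interval infinitely often.  J_rho consists of the
   operators S with tau_n(A S B) -> 0 along {n : rho <= psi n} for all A and B which are controlled by a
   family of functionals with values in c_0, and hence finitely strictly singular.  J_rho increases with
   rho, and T^D with D = {n : rho <= psi n < rho'} lies in J_rho' but not in J_rho. *)
Require Import Defs.
From mathcomp Require Import all_boot all_order all_algebra.
From mathcomp Require Import all_classical all_reals all_analysis.
From mathcomp Require Import ring lra complex.
Import Order.TTheory GRing.Theory Num.Theory.
Local Open Scope classical_set_scope.
Local Open Scope ring_scope.

Set Implicit Arguments.
Unset Strict Implicit.
Unset Printing Implicit Defensive.

(** The obstacle is that [tau_n (A S B)] must be small for arbitrary [A] and [B], of which only the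
    norms are known. Every operator is therefore reduced to a finite diagonal operator between
    spaces normed by two gauges, and the coefficients [u (B r_i)] and [g_i (A v)] are constrained
    only through dual norms, which are exploited by inserting extremal vectors. Small entries are
    harmless: a dual vector of the Rosenthal side lies in an l_(r') sum of l_2 spaces, and r' is
    below the exponent e of the sign side. Large entries are so few that the l_2 part of the
    Rosenthal norm is not felt on them, and random signs then save a power of [N_n]. Here r = p' if
    p < 2 and r = q otherwise, and r' < e is what p < q provides. The price is that combinations of
    the system biorthogonal to the Rosenthal blocks cost a factor [W_n], a negative power of
    [delta_n]. Hence the order of choice: [delta_n] small in terms of the earlier [N_m], and only
    then [N_n] large in terms of [delta_n]. *)

Section PowerInequalities.
Variable R : realType.
Implicit Types (x y a b s r p q M : R).

Lemma eq_ler x y : x = y -> x <= y.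
Proof. by move=> ->. Qed.

Lemma ler_pow x y r : 0 <= r -> 0 <= x -> x <= y -> x `^ r <= y `^ r.
Proof.
move=> r0 x0 xy; apply: ge0_ler_powR => //; rewrite nnegrE//.
exact: le_trans xy.
Qed.

Lemma powRK x r : r != 0 -> 0 <= x -> (x `^ r) `^ r^-1 = x.
Proof. by move=> r0 x0; rewrite -powRrM mulfV// powRr1. Qed.

Lemma powRVK x r : r != 0 -> 0 <= x -> (x `^ r^-1) `^ r = x.
Proof. by move=> r0 x0; rewrite -powRrM mulVf// powRr1. Qed.

Lemma powR_half x r : 0 <= x -> (x ^+ 2) `^ (r / 2) = x `^ r.
Proof.
move=> x0; rewrite -(powR_mulrn _ x0) -powRrM; congr (_ `^ _).
by rewrite mulrC divfK.
Qed.

Lemma powR_div x y r : 0 <= x -> 0 < y -> (x / y) `^ r = x `^ r / y `^ r.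
Proof.
move=> x0 y0; rewrite powRM ?invr_ge0 ?(ltW y0)//; congr (_ * _).
apply: (@mulIf _ (y `^ r)); first by rewrite gt_eqF ?powR_gt0.
by rewrite -powRM ?invr_ge0 ?(ltW y0)// !mulVf ?powR1 ?gt_eqF ?powR_gt0.
Qed.

Lemma mulr_powR x r : 0 < r -> 0 <= x -> x * x `^ (r - 1) = x `^ r.
Proof. by move=> r0 x0; rewrite mulr_powRB1. Qed.

(** Concavity of the power, read off Young's inequality for [x ^ s] and 1 with the conjugate
    exponents [1 / s] and [1 / (1 - s)]. *)
Lemma powR_le_tangent x s : 0 <= x -> 0 < s <= 1 -> x `^ s <= 1 + s * (x - 1).
Proof.
move=> x0 /andP[s0]; rewrite le_eqVlt => /predU1P[->|s1].
  by rewrite powRr1//; lra.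
have := @conjugate_powR R (x `^ s) 1 s^-1 (1 - s)^-1 (powR_ge0 _ _) ler01.
rewrite !invr_gt0 subr_gt0 s0 s1 !invrK powRK ?gt_eqF// powR1 mulr1 => h.
by apply: le_trans (h _ _ _) _ => //; lra.
Qed.

Lemma powR_add_ge a b r : 1 <= r -> 0 <= a -> 0 <= b ->
  a `^ r + b `^ r <= (a + b) `^ r.
Proof.
move=> r1 a0 b0; have r0 : 0 < r by lra.
have r10 : 0 <= r - 1 by lra.
rewrite -(mulr_powR r0 a0) -(mulr_powR r0 b0) -(mulr_powR r0 (addr_ge0 a0 b0)) mulrDl.
by apply: lerD; apply: ler_wpM2l => //; apply: ler_pow; rewrite ?lerDl ?lerDr.
Qed.

Lemma powR_sum_ge (I : Type) (t : seq I) (P : pred I) (f : I -> R) r :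
  1 <= r -> (forall i, 0 <= f i) ->
  \sum_(i <- t | P i) f i `^ r <= (\sum_(i <- t | P i) f i) `^ r.
Proof.
move=> r1 f0; elim: t => [|i t IH]; first by rewrite !big_nil powR_ge0.
rewrite !big_cons; case: ifP => // _; apply: le_trans (powR_add_ge _ _ _) => //.
  by rewrite lerD2l.
exact: sumr_ge0.
Qed.

Lemma powR_sum_le (I : Type) (t : seq I) (P : pred I) (f : I -> R) s :
  0 < s <= 1 -> (forall i, 0 <= f i) ->
  (\sum_(i <- t | P i) f i) `^ s <= \sum_(i <- t | P i) f i `^ s.
Proof.
move=> /andP[s0 s1] f0.
have V1 : 1 <= s^-1 by rewrite invf_ge1.
have := powR_sum_ge t P V1 (fun i => powR_ge0 (f i) s).
under eq_bigr do rewrite powRK ?gt_eqF//.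
have S0 : 0 <= \sum_(i <- t | P i) f i by apply: sumr_ge0.
move=> /(ler_pow (ltW s0) S0); rewrite powRVK ?gt_eqF//.
by apply: sumr_ge0 => i _; exact: powR_ge0.
Qed.

Lemma powRD_le a b r : 0 <= r -> 0 <= a -> 0 <= b ->
  (a + b) `^ r <= 2 `^ r * (a `^ r + b `^ r).
Proof.
move=> r0 a0 b0.
have h c : 0 <= c -> a <= c -> b <= c ->
    c `^ r <= a `^ r + b `^ r -> (a + b) `^ r <= 2 `^ r * (a `^ r + b `^ r).
  move=> c0 ac bc h; apply: (@le_trans _ _ (2 `^ r * c `^ r)).
    by rewrite -powRM// ler_pow ?addr_ge0//; lra.
  by rewrite ler_wpM2l ?powR_ge0.
have [ab|ba] := leP a b.
  by apply: (h b) => //; rewrite lerDr ?powR_ge0.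
by apply: (h a) => //; first exact: ltW; rewrite lerDl powR_ge0.
Qed.

Lemma hoelder_sum (I : Type) (t : seq I) (f g : I -> R) p q :
  0 < p -> 0 < q -> p^-1 + q^-1 = 1 ->
  (forall i, 0 <= f i) -> (forall i, 0 <= g i) ->
  \sum_(i <- t) f i * g i <=
  (\sum_(i <- t) f i `^ p) `^ p^-1 * (\sum_(i <- t) g i `^ q) `^ q^-1.
Proof.
move=> p0 q0 pq f0 g0.
set F := \sum_(i <- t) f i `^ p; set G := \sum_(i <- t) g i `^ q.
have F0 : 0 <= F by apply: sumr_ge0 => *; exact: powR_ge0.
have G0 : 0 <= G by apply: sumr_ge0 => *; exact: powR_ge0.
have zero (h : I -> R) (x : R) : 0 < x -> (forall i, 0 <= h i) ->
    \sum_(i <- t) h i `^ x = 0 -> forall k : I -> R, \sum_(i <- t) h i * k i = 0.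
  move=> x0 h0; elim: t {F G F0 G0} => [|i t IH]; first by rewrite !big_nil => _ k; rewrite big_nil.
  rewrite big_cons => /eqP; rewrite paddr_eq0 ?powR_ge0 ?sumr_ge0//; last first.
    by move=> *; exact: powR_ge0.
  case/andP => /eqP/powR_eq0_eq0 hi /eqP/IH {}IH k.
  by rewrite big_cons hi mul0r add0r IH.
have [F00|Fn0] := eqVneq F 0.
  by rewrite (zero f p)// mulr_ge0 ?powR_ge0.
have [G00|Gn0] := eqVneq G 0.
  under eq_bigr do rewrite mulrC.
  by rewrite (zero g q)// mulr_ge0 ?powR_ge0.
have Fp : 0 < F by rewrite lt_neqAle eq_sym Fn0.
have Gp : 0 < G by rewrite lt_neqAle eq_sym Gn0.
set a := F `^ p^-1; set b := G `^ q^-1.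
have a0 : 0 < a by exact: powR_gt0.
have b0 : 0 < b by exact: powR_gt0.
have aF : a `^ p = F by rewrite powRVK ?gt_eqF.
have bG : b `^ q = G by rewrite powRVK ?gt_eqF.
clearbody a b; have a0' := ltW a0; have b0' := ltW b0.
rewrite -[leRHS]mul1r -(ler_pdivrMr _ _ (mulr_gt0 a0 b0)) mulr_suml.
apply: (@le_trans _ _ (\sum_(i <- t) (f i `^ p / F / p + g i `^ q / G / q))).
  apply: ler_sum => i _.
  have -> : f i * g i / (a * b) = (f i / a) * (g i / b).
    by rewrite mulf_div.
  have fa : 0 <= f i / a by rewrite divr_ge0.
  have gb : 0 <= g i / b by rewrite divr_ge0.
  apply: le_trans (conjugate_powR fa gb p0 q0 pq) _.
  by rewrite !powR_div// aF bG.
rewrite big_split/= -!mulr_suml -/F -/G.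
by rewrite !mulfV ?mul1r ?pq.
Qed.

(* Applied to a power sum [Q] tested against its own extremal vector. *)
Lemma self_bound Q M r r' : 0 < r -> 0 < r' -> r^-1 + r'^-1 = 1 -> 0 <= Q -> 0 <= M ->
  Q <= M * Q `^ r^-1 -> Q <= M `^ r'.
Proof.
move=> r0 r'0 rr Q0 M0 h; have [->|Qn0] := eqVneq Q 0; first exact: powR_ge0.
have Qp : 0 < Q by rewrite lt_neqAle eq_sym Qn0.
have h1 : Q `^ r'^-1 <= M.
  rewrite -(ler_pM2r (powR_gt0 r^-1 Qp)) -powRD; last by rewrite Qn0 implybT.
  by rewrite addrC rr powRr1.
by have := ler_pow (ltW r'0) (powR_ge0 _ _) h1; rewrite powRVK ?gt_eqF.
Qed.

(** From [1 - y <= exp (- y)] follows [exp y <= 1 / (1 - y)], and the quadratic exceeds this because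
    its product with [1 - y] is [1 + y^2 (1 - 2 y)]. *)
Lemma expR_le_quad y : `|y| <= 1/2 -> expR y <= 1 + y + 2 * y ^+ 2.
Proof.
rewrite ler_norml => /andP[y1 y2].
have := expR_ge1Dx (- y); rewrite expRN => h.
have e0 := expR_gt0 y.
have h2 : expR y * (1 - y) <= 1.
  by rewrite -[leRHS](@mulfV _ (expR y)) ?gt_eqF// ler_wpM2l// ltW.
have y20 := sqr_ge0 y.
have y10 : 0 < 1 - y by lra.
rewrite -(ler_pM2r y10); apply: le_trans h2 _.
rewrite -subr_ge0; have -> : (1 + y + 2 * y ^+ 2) * (1 - y) - 1 = y ^+ 2 * (1 - 2 * y) by ring.
by rewrite mulr_ge0//; lra.
Qed.

Lemma powR_le_quad t r : 1 <= r -> `|t| <= (2 * r)^-1 ->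
  (1 + t) `^ r <= 1 + r * t + 2 * r ^+ 2 * t ^+ 2.
Proof.
move=> r1 tr; have r0 : 0 < r by lra.
have rt : `|r * t| <= 1/2.
  rewrite normrM gtr0_norm//; apply: le_trans (ler_wpM2l (ltW r0) tr) _.
  by rewrite invfM mulrCA mulfV ?gt_eqF//; lra.
have t1 : 0 <= 1 + t.
  have : `|t| <= 1/2.
    apply: le_trans tr _; rewrite mul1r lef_pV2 ?posrE//; lra.
  by rewrite ler_norml => /andP[]; lra.
apply: le_trans (ler_pow (ltW r0) t1 (expR_ge1Dx t)) _.
rewrite -expRM mulrC; apply: le_trans (expR_le_quad rt) _.
by rewrite exprMn mulrA.
Qed.

(** Averaging over the sign of [a] cancels the first order term, so a second order term is all that
    is added when [a] is small against [x]. This is the induction step of Rosenthal's inequality. *)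
Lemma powR_symm_le r : 2 <= r -> exists2 C, 1 <= C & forall x a,
  (`|x + a| `^ r + `|x - a| `^ r) / 2 <=
  `|x| `^ r + C * (a ^+ 2 * `|x| `^ (r - 2) + `|a| `^ r).
Proof.
move=> r2; have r0 : 0 < r by lra.
pose C := (2 * r + 1) `^ r + 2 * r ^+ 2.
have rr : 0 <= r ^+ 2 by exact: sqr_ge0.
have rr2 : 4 <= r ^+ 2 by rewrite expr2; nra.
have P0 := powR_ge0 (2 * r + 1) r.
exists C => [|x a]; first by rewrite /C; lra.
have A0 : 0 <= a ^+ 2 * `|x| `^ (r - 2) by rewrite mulr_ge0 ?sqr_ge0 ?powR_ge0.
(* Up to this threshold the left side is of order [|a| ^ r]; beyond it [a / x] is small enough for
   the second order expansion. *)
have [xa|ax] := leP `|x| (2 * r * `|a|).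
  have h y : `|y| <= (2 * r + 1) * `|a| -> `|y| `^ r <= C * `|a| `^ r.
    move=> ya; apply: le_trans (ler_pow (ltW r0) _ ya) _ => //.
    rewrite powRM//; last by lra.
    by rewrite ler_wpM2r ?powR_ge0// /C lerDl; lra.
  have h1 : `|x + a| <= (2 * r + 1) * `|a|.
    by apply: le_trans (ler_normD _ _) _; rewrite mulrDl mul1r lerD2r.
  have h2 : `|x - a| <= (2 * r + 1) * `|a|.
    by apply: le_trans (ler_normB _ _) _; rewrite mulrDl mul1r lerD2r.
  move/h: h1; move/h: h2.
  have : 0 <= `|x| `^ r by exact: powR_ge0.
  have : 0 <= C * (a ^+ 2 * `|x| `^ (r - 2)).
    by rewrite mulr_ge0// /C; lra.
  by rewrite mulrDr; lra.
have x0 : 0 < `|x|.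
  by apply: le_lt_trans ax; rewrite mulr_ge0//; lra.
have xn0 : x != 0 by rewrite -normr_gt0.
pose t := a / x.
have at_ : a = x * t by rewrite /t mulrCA mulfV// mulr1.
have tr : `|t| <= (2 * r)^-1.
  rewrite /t normrM normfV ler_pdivrMr// mulrC ler_pdivlMr; last by lra.
  by rewrite mulrC ltW.
have ntr : `|- t| <= (2 * r)^-1 by rewrite normrN.
have t1 : `|t| <= 1/2.
  by apply: le_trans tr _; rewrite mul1r lef_pV2 ?posrE//; lra.
have [t1a t1b] : - (1/2) <= t /\ t <= 1/2 by move: t1; rewrite ler_norml => /andP[].
have -> : x + a = x * (1 + t) by rewrite mulrDr mulr1 -at_.
have -> : x - a = x * (1 - t) by rewrite mulrBr mulr1 -at_.
rewrite !normrM (ger0_norm (_ : 0 <= 1 + t)); last by lra.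
rewrite (ger0_norm (_ : 0 <= 1 - t)); last by lra.
rewrite !powRM//; [|lra|lra].
have h1 := powR_le_quad (_ : 1 <= r) tr.
have h2 := powR_le_quad (_ : 1 <= r) ntr.
have {h1 h2} h : ((1 + t) `^ r + (1 - t) `^ r) / 2 <= 1 + 2 * r ^+ 2 * t ^+ 2.
  have := h1 ltac:(lra); have := h2 ltac:(lra); rewrite sqrrN; lra.
have xr : `|x| `^ r = x ^+ 2 * `|x| `^ (r - 2).
  rewrite -[x ^+ 2]real_normK ?num_real// -powR_mulrn// -powRD; last first.
    by rewrite (gt_eqF x0) implybT.
  by congr (_ `^ _); lra.
rewrite -mulrDr -mulrA.
apply: le_trans (ler_wpM2l (powR_ge0 _ _) h) _.
rewrite mulrDr mulr1 lerD2l.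
have -> : a ^+ 2 * `|x| `^ (r - 2) = `|x| `^ r * t ^+ 2.
  by rewrite xr {1}at_; ring.
rewrite mulrDr.
have e0 : 0 <= `|x| `^ r * t ^+ 2 by rewrite mulr_ge0 ?powR_ge0 ?sqr_ge0.
have : 0 <= C * `|a| `^ r.
  by rewrite mulr_ge0 ?powR_ge0// /C; lra.
have : 0 <= (2 * r + 1) `^ r * (`|x| `^ r * t ^+ 2) by rewrite mulr_ge0.
have -> : C * (`|x| `^ r * t ^+ 2) =
    (2 * r + 1) `^ r * (`|x| `^ r * t ^+ 2) + 2 * r ^+ 2 * (`|x| `^ r * t ^+ 2).
  by rewrite -mulrDl.
move: (C * `|a| `^ r) ((2 * r + 1) `^ r * _) => X Y Y0 X0.
rewrite mulrCA; lra.
Qed.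

End PowerInequalities.

(** * Averages, independent variables and Rosenthal's inequality *)

Section Average.
Variable R : realType.
Implicit Types T U : finType.

Definition avg T (f : T -> R) : R := (\sum_t f t) / #|T|%:R.

Lemma avg_le T (f g : T -> R) : (forall t, f t <= g t) -> avg f <= avg g.
Proof. by move=> fg; rewrite ler_wpM2r ?invr_ge0// ler_sum. Qed.

Lemma avg_ge0 T (f : T -> R) : (forall t, 0 <= f t) -> 0 <= avg f.
Proof. by move=> f0; rewrite divr_ge0 ?sumr_ge0. Qed.

Lemma eq_avg T (f g : T -> R) : f =1 g -> avg f = avg g.
Proof. by move=> fg; rewrite /avg (eq_bigr _ (fun t _ => fg t)). Qed.

Lemma avgD T (f g : T -> R) : avg (fun t => f t + g t) = avg f + avg g.
Proof. by rewrite /avg big_split mulrDl. Qed.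

Lemma avgZ T (f : T -> R) c : avg (fun t => c * f t) = c * avg f.
Proof. by rewrite /avg -mulr_sumr mulrA. Qed.

Lemma avg_sum T (I : Type) (s : seq I) (P : pred I) (f : I -> T -> R) :
  avg (fun t => \sum_(i <- s | P i) f i t) = \sum_(i <- s | P i) avg (f i).
Proof. by rewrite /avg exchange_big/= mulr_suml. Qed.

Lemma avg_const T c : (0 < #|T|)%N -> avg (fun _ : T => c) = c.
Proof.
move=> T0; rewrite /avg sumr_const -[c *+ _]mulr_natr mulfK//.
by rewrite pnatr_eq0 -lt0n.
Qed.

Lemma avg_pair T U (f : T * U -> R) :
  avg f = avg (fun u => avg (fun t => f (t, u))).
Proof.
rewrite /avg -mulr_suml -mulrA -invfM -natrM card_prod; congr (_ / _).
by rewrite exchange_big pair_big; apply: eq_bigr => -[].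
Qed.

(** Jensen's inequality: the graph lies below its tangent at the mean [m], and the average of the
    tangent is [m ^ s]. A vanishing mean forces all values to vanish and is treated apart. *)
Lemma avg_powR T (f : T -> R) s : (0 < #|T|)%N -> 0 < s <= 1 ->
  (forall t, 0 <= f t) -> avg (fun t => f t `^ s) <= (avg f) `^ s.
Proof.
move=> T0 s01 f0; have [s0 _] := andP s01.
have m0 := avg_ge0 f0; have [m00|mn0] := eqVneq (avg f) 0.
  have /eqP := m00; rewrite mulf_eq0 invr_eq0 pnatr_eq0 (gtn_eqF T0) orbF.
  rewrite psumr_eq0// => /allP ft.
  apply: (@le_trans _ _ (avg (fun _ : T => 0))); last by rewrite avg_const ?powR_ge0.
  apply: avg_le => t.
  by have /eqP-> := ft t (mem_index_enum _); rewrite powR0 ?gt_eqF.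
have mp : 0 < avg f by rewrite lt_neqAle eq_sym mn0.
have [m mE] : exists m, avg f = m by exists (avg f).
rewrite mE in m0 mn0 mp *.
apply: (@le_trans _ _ (avg (fun t => m `^ s * (1 - s) + m `^ s * s / m * f t))).
  apply: avg_le => t; have fm : 0 <= f t / m by rewrite divr_ge0.
  rewrite -[in leLHS](divfK mn0 (f t)) mulrC powRM//.
  apply: le_trans (ler_wpM2l (powR_ge0 _ _) (powR_le_tangent fm s01)) _.
  by apply: eq_ler; field.
rewrite avgD avg_const// avgZ mE divfK//.
by apply: eq_ler; ring.
Qed.

End Average.

Section Product.
Variables (R : realType) (V : finType).

(** Nested pairs rather than functions on an index set: the moment inequalities go by induction on
    [N], splitting off one variable. *)
Fixpoint Om (N : nat) : finType :=
  if N is n.+1 then ((V * Om n)%type : finType) else (unit : finType).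

(** The outermost factor carries the largest index, so enlarging [N] leaves the earlier coordinates
    alone. Indices out of range give 0, so sums may be lengthened or cut freely. *)
Fixpoint co (xi : V -> R) N : Om N -> nat -> R :=
  match N return Om N -> nat -> R with
  | 0 => fun _ _ => 0
  | n.+1 => fun w j => if j == n then xi w.1 else co xi w.2 j
  end.

(* [xi] takes the values 1 and -1 with probability [delta / 2] each, and 0 otherwise. *)
Definition signlike (xi : V -> R) (delta : R) :=
  forall f : R -> R, avg (fun v => f (xi v)) = (1 - delta) * f 0 + delta / 2 * (f 1 + f (- 1)).

Lemma co_out xi N (w : Om N) j : (N <= j)%N -> co xi w j = 0.
Proof. by elim: N w => //= n IH [v w] nj; rewrite gtn_eqF//= IH// ltnW. Qed.

Lemma card_Om N : (0 < #|V|)%N -> (0 < #|Om N|)%N.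
Proof. by move=> V0; elim: N => [|n IH]/=; rewrite ?card_unit// card_prod muln_gt0 V0. Qed.

Lemma sum_coS xi N v (w : Om N) (a : nat -> R) :
  \sum_(0 <= j < N.+1) a j * co xi ((v, w) : Om N.+1) j =
  \sum_(0 <= j < N) a j * co xi w j + a N * xi v.
Proof.
rewrite big_nat_recr//= eqxx; congr (_ + _).
by apply: eq_big_nat => j /andP[_ jN]; rewrite ltn_eqF.
Qed.

Lemma sum_co_trunc xi N J (w : Om N) (a : nat -> R) :
  \sum_(0 <= j < J) a j * co xi w j =
  \sum_(0 <= j < N) (if (j < J)%N then a j else 0) * co xi w j.
Proof.
rewrite (@big_nat_widen _ _ _ 0 J (maxn J N)) ?leq_maxl//.
rewrite (@big_nat_widen _ _ _ 0 N (maxn J N)) ?leq_maxr//.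
rewrite big_mkcond [RHS]big_mkcond; apply: eq_bigr => j _ /=.
case: ltnP => jJ; case: ltnP => jN //; last by rewrite mul0r.
by rewrite co_out// mulr0.
Qed.

Section Moments.
Variables (xi : V -> R) (delta : R).
Hypotheses (xid : signlike xi delta) (d0 : 0 <= delta) (V0 : (0 < #|V|)%N).

Lemma avg_coS N (f : R -> R) (a : nat -> R) :
  avg (fun w : Om N.+1 => f (\sum_(0 <= j < N.+1) a j * co xi w j)) =
  avg (fun w : Om N => (1 - delta) * f (\sum_(0 <= j < N) a j * co xi w j) +
    delta / 2 * (f (\sum_(0 <= j < N) a j * co xi w j + a N) +
                 f (\sum_(0 <= j < N) a j * co xi w j - a N))).
Proof.
rewrite [LHS]avg_pair; apply: eq_avg => w.
set x := \sum_(_ <= _ < _) _.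
have -> : avg (fun v => f (\sum_(0 <= j < N.+1) a j * co xi ((v, w) : Om N.+1) j)) =
    avg (fun v => f (x + a N * xi v)) by apply: eq_avg => v; rewrite sum_coS.
by rewrite (xid (fun y => f (x + a N * y))) mulr0 addr0 mulr1 mulrN1.
Qed.

Lemma avg_sqr_sum N (a : nat -> R) :
  avg (fun w : Om N => (\sum_(0 <= j < N) a j * co xi w j) ^+ 2) =
  delta * \sum_(0 <= j < N) a j ^+ 2.
Proof.
elim: N => [|N IH].
  rewrite big_nil mulr0 (eq_avg (g := fun _ => 0)) ?avg_const ?card_Om// => w.
  by rewrite big_nil expr0n.
rewrite (avg_coS N (fun x => x ^+ 2)) big_nat_recr// mulrDr -IH.
rewrite -[delta * a N ^+ 2](@avg_const _ (Om N)) ?card_Om// -avgD.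
by apply: eq_avg => w; field.
Qed.

Lemma avg_coM N i j : (i < N)%N -> (j < N)%N ->
  avg (fun w : Om N => co xi w i * co xi w j) = delta * (i == j)%:R.
Proof.
elim: N => // N IH iN jN; rewrite [LHS]avg_pair /=.
have xi1 : avg xi = 0 by rewrite (xid id); lra.
have xi2 : avg (fun v => xi v * xi v) = delta by rewrite (xid (fun x => x * x)); lra.
case: (altP (i =P N)) => [iE|iN']; case: (altP (j =P N)) => [jE|jN'].
- by rewrite iE jE eqxx mulr1 xi2 avg_const ?card_Om.
- rewrite iE eq_sym (negbTE jN') mulr0 -[RHS](@avg_const _ (Om N) 0) ?card_Om//.
  apply: eq_avg => w; rewrite -[RHS](mulr0 (co xi w j)) -xi1 -avgZ.
  by apply: eq_avg => v; rewrite mulrC.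
- rewrite jE (negbTE iN') mulr0 -[RHS](@avg_const _ (Om N) 0) ?card_Om//.
  by apply: eq_avg => w; rewrite avgZ xi1 mulr0.
- rewrite (eq_avg (fun w => avg_const _ V0)) IH//.
    by rewrite ltn_neqAle iN'.
  by rewrite ltn_neqAle jN'.
Qed.

End Moments.

End Product.

(** Adding one variable increases the moment by at most [C] times
    [delta a^2 E |X|^(r-2) + delta |a|^r]. By Jensen the inner moment is at most [Z ^ (1 - 2 / r)],
    where [Z] is the very bound to be proved; [fix_] states that the resulting estimate stays below
    [Z], so the induction closes. *)
Lemma rosenthal (R : realType) (r : R) : 2 <= r -> exists2 C, 1 <= C &
  forall (V : finType) (xi : V -> R) delta N (a : nat -> R),
    signlike xi delta -> 0 <= delta -> (0 < #|V|)%N ->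
    avg (fun w : Om V N => `|\sum_(0 <= j < N) a j * co xi w j| `^ r) <=
    C * (delta * (\sum_(0 <= j < N) `|a j| `^ r) +
         (delta * (\sum_(0 <= j < N) a j ^+ 2)) `^ (r / 2)).
Proof.
move=> r2; have [C C1 hC] := powR_symm_le r2; have r0 : 0 < r by lra.
(* Chosen with [B ^ (2 / r) = 2 C], so that each of the two terms in [fix_] takes at most half of
   [Z]. *)
pose B := (2 * C) `^ (r / 2).
have B2 : 2 * C <= B by apply: le1r_powR; lra.
have B1 : 1 <= B by lra.
exists B => // V xi delta N a xid d0 V0.
pose al n := delta * (\sum_(0 <= j < n) `|a j| `^ r).
pose be n := delta * (\sum_(0 <= j < n) a j ^+ 2).
have al_le n : (n <= N)%N -> al n <= al N.
  move=> nN; rewrite ler_wpM2l// [leRHS](@big_cat_nat _ _ _ n)//= lerDl.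
  by apply: sumr_ge0 => *; exact: powR_ge0.
have be_le n : (n <= N)%N -> be n <= be N.
  move=> nN; rewrite ler_wpM2l// [leRHS](@big_cat_nat _ _ _ n)//= lerDl.
  by apply: sumr_ge0 => *; exact: sqr_ge0.
have al0 n : 0 <= al n by rewrite mulr_ge0// sumr_ge0// => *; exact: powR_ge0.
have be0 n : 0 <= be n by rewrite mulr_ge0// sumr_ge0// => *; exact: sqr_ge0.
pose Z := B * (al N + be N `^ (r / 2)).
have Z0 : 0 <= Z by rewrite mulr_ge0 ?addr_ge0 ?powR_ge0//; lra.
pose Z' := Z `^ (1 - 2 / r).
have Z'0 : 0 <= Z' by exact: powR_ge0.
have r2V : 2 / r <= 1 by rewrite ler_pdivrMr//; lra.
have bZ : be N * Z' <= Z / (2 * C).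
  have [Z00|Zn0] := eqVneq Z 0.
    have /eqP := Z00; rewrite mulf_eq0 gt_eqF/=; last by lra.
    rewrite paddr_eq0 ?powR_ge0// => /andP[_ /eqP/powR_eq0_eq0->].
    by rewrite mul0r Z00 mul0r.
  have : be N `^ (r / 2) <= Z / B.
    by rewrite /Z mulrAC mulfV ?mul1r ?lerDr// gt_eqF//; lra.
  move=> /(ler_pow (ltW (_ : 0 < 2 / r)) (powR_ge0 _ _)) => h.
  have {h} : be N <= (Z / B) `^ (2 / r).
    move: h; rewrite divr_gt0// -[X in X <= _]powRrM => /(_ isT).
    have -> : r / 2 * (2 / r) = 1 by field; rewrite gt_eqF.
    by rewrite powRr1.
  rewrite powR_div//; last by lra.
  have -> : B `^ (2 / r) = 2 * C.
    rewrite -powRrM; have -> : r / 2 * (2 / r) = 1 by field; rewrite gt_eqF.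
    by rewrite powRr1//; lra.
  move=> /(ler_wpM2r Z'0) h; apply: le_trans h _.
  rewrite mulrAC -powRD; last by rewrite Zn0 implybT.
  by rewrite addrC subrK powRr1.
have fix_ : C * (al N + be N * Z') <= Z.
  have h1 : al N <= Z / (2 * C).
    rewrite ler_pdivlMr; last by lra.
    rewrite mulrC; apply: le_trans (ler_wpM2r (al0 _) B2) _.
    by rewrite ler_wpM2l ?lerDl ?powR_ge0//; lra.
  have -> : Z = C * (Z / (2 * C) + Z / (2 * C)) by field; rewrite gt_eqF//; lra.
  by rewrite ler_wpM2l ?lerD//; lra.
pose M n := avg (fun w : Om V n => `|\sum_(0 <= j < n) a j * co xi w j| `^ r).
(* This bound is additive in the increments and so passes through the induction; that the moments
   stay below [Z] is recovered from it at each stage. *)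
suff h n : (n <= N)%N -> M n <= C * (al n + be n * Z').
  by apply: le_trans fix_; exact: h.
elim: n => [_|n IH nN].
  rewrite /M (eq_avg (g := fun _ => 0)) => [|w]; last by rewrite big_nil normr0 powR0 ?gt_eqF.
  rewrite avg_const ?card_Om//; apply: mulr_ge0; first by lra.
  by apply: addr_ge0 => //; apply: mulr_ge0.
have {IH} IH := IH (ltnW nN).
have MZ : M n <= Z.
  apply: le_trans IH _; apply: le_trans fix_; rewrite ler_wpM2l//; first by lra.
  by rewrite lerD// ?ler_wpM2r// ?al_le ?be_le// ltnW.
have M0 : 0 <= M n by apply: avg_ge0 => *; exact: powR_ge0.
have -> : M n.+1 = _ := avg_coS xid n (fun x => `|x| `^ r) a.
pose X (w : Om V n) := \sum_(0 <= j < n) a j * co xi w j.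
apply: (@le_trans _ _ (avg (fun w : Om V n => `|X w| `^ r +
   (C * (delta * a n ^+ 2) * `|X w| `^ (r - 2) + C * (delta * `|a n| `^ r))))).
  apply: avg_le => w; rewrite -/(X w).
  have := ler_wpM2l d0 (hC (X w) (a n)).
  set p1 := `|X w + a n| `^ r; set p2 := `|X w - a n| `^ r; set p3 := `|X w| `^ r.
  set p4 := `|X w| `^ (r - 2); set p5 := `|a n| `^ r; set p6 := a n ^+ 2.
  move: p1 p2 p3 p4 p5 p6 => p1 p2 p3 p4 p5 p6; lra.
rewrite avgD avgD avgZ avg_const ?card_Om//.
have Mr : avg (fun w => `|X w| `^ (r - 2)) <= Z'.
  (* For [r = 2] the exponent [r - 2] is 0, which [avg_powR] does not allow; both sides are then
     1. *)
  have [r2'|r2'] := eqVneq r 2.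
    rewrite (eq_avg (g := fun _ => 1)) => [|w]; last by rewrite r2' subrr powRr0.
    by rewrite avg_const ?card_Om// /Z' r2' mulfV// subrr powRr0.
  have r2p : 2 < r by rewrite lt_neqAle eq_sym r2'.
  have s01 : 0 < (r - 2) / r <= 1.
    by rewrite divr_gt0 ?subr_gt0//= ler_pdivrMr//; lra.
  apply: (@le_trans _ _ (M n `^ ((r - 2) / r))).
    have X0 w : 0 <= `|X w| `^ r by exact: powR_ge0.
    apply: le_trans (avg_powR (card_Om n V0) s01 X0).
    apply: avg_le => w; rewrite -powRrM mulrCA mulfV ?gt_eqF//.
    by rewrite mulr1.
  have -> : (r - 2) / r = 1 - 2 / r by field; rewrite gt_eqF.
  by apply: ler_pow; rewrite // subr_ge0.
have alS : al n.+1 = al n + delta * `|a n| `^ r by rewrite /al big_nat_recr// mulrDr.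
have beS : be n.+1 = be n + delta * a n ^+ 2 by rewrite /be big_nat_recr// mulrDr.
have c0 : 0 <= C * (delta * a n ^+ 2).
  by apply: mulr_ge0; [lra|apply: mulr_ge0 => //; exact: sqr_ge0].
have := ler_wpM2l c0 Mr; rewrite -/(M n) alS beS.
clear -IH; move: IH; generalize (M n) (al n) (be n) Z' (delta * a n ^+ 2)
  (delta * `|a n| `^ r) (avg (fun w => `|X w| `^ (r - 2))).
by move=> m1 m2 m3 m4 x y v; lra.
Qed.

(** * Real and complex scalars; moments with scalar coefficients *)

Section Scalars.
Variables (R : realType) (K : scalarField R).
Implicit Types (z : K) (t : R).

Lemma modulus_ofreal t : modulus (ofreal t : K) = `|t|.
Proof.
apply: (@ofreal_inj R K); rewrite ofreal_modulus.
have [t0|t0] := leP 0 t; first by rewrite !ger0_norm// ofreal_ge0.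
rewrite [`|t|]ltr0_norm// rmorphN ler0_norm//.
by rewrite -oppr_ge0 -rmorphN ofreal_ge0 oppr_ge0 ltW.
Qed.

Lemma modulusN z : modulus (- z) = modulus z.
Proof. by apply: (@ofreal_inj R K); rewrite !ofreal_modulus normrN. Qed.

Lemma modulusB z w : modulus (z - w) <= modulus z + modulus w.
Proof. by rewrite -(modulusN w); exact: modulusD. Qed.

Lemma modulus_sum (I : Type) (s : seq I) (P : pred I) (F : I -> K) :
  modulus (\sum_(i <- s | P i) F i) <= \sum_(i <- s | P i) modulus (F i).
Proof.
elim/big_rec2 : _ => [|i y x _ xy]; first by rewrite modulus0.
by apply: le_trans (modulusD _ _) _; rewrite lerD2l.
Qed.

(** A factor turning [z] into its modulus. At [z = 0] division by zero makes it 0, whence a bound on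
    its modulus rather than an equality. *)
Definition phase z : K := ofreal (modulus z) / z.

Lemma phaseM z : phase z * z = ofreal (modulus z).
Proof.
have [->|z0] := eqVneq z 0; last by rewrite divfK.
by rewrite mulr0 modulus0 rmorph0.
Qed.

Lemma modulus_phase z : modulus (phase z) <= 1.
Proof.
have [->|z0] := eqVneq z 0; first by rewrite /phase invr0 mulr0 modulus0.
by rewrite modulusM modulus_ofreal ger0_norm ?modulus_ge0// modulusVr.
Qed.

(** What real and imaginary part share. Moment inequalities are proved for real coefficients and
    transferred through such maps, uniformly in the scalar field. *)
Definition coordinate (f : K -> R) :=
  [/\ forall z w, f (z + w) = f z + f w, f 0 = 0 &
      forall z t, f (z * ofreal t) = f z * t].

Lemma coordinate_sum f (a : nat -> K) (b : nat -> R) m n : coordinate f ->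
  f (\sum_(m <= j < n) a j * ofreal (b j)) = \sum_(m <= j < n) f (a j) * b j.
Proof.
move=> [fD f0 fM]; elim/big_rec2 : _ => // j y x _ <-.
by rewrite fD fM.
Qed.

Definition cartesian (re im : K -> R) :=
  [/\ coordinate re, coordinate im &
      forall z, modulus z ^+ 2 = re z ^+ 2 + im z ^+ 2].

End Scalars.

(** The assumption on the scalars is exploited here; over the reals the second part is taken to be
    0. *)
Lemma cartesian_exists (R : realType) (K : scalarField R) :
  K = real_scalars R \/ K = complex_scalars R ->
  exists re im : K -> R, cartesian re im.
Proof.
case=> E; subst K.
  exists id, (fun _ => 0); split=> //; first by split=> // *; rewrite ?mul0r ?addr0.
  by move=> z; rewrite /= expr0n/= addr0 real_normK// num_real.
exists (@complex.Re R), (@complex.Im R); split.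
- by split=> // [[a b] [c d]|[a b] t] //=; rewrite mulr0 subr0.
- by split=> // [[a b] [c d]|[a b] t] //=; rewrite mulr0 add0r.
- by move=> [a b] /=; rewrite sqr_sqrtr// addr_ge0 ?sqr_ge0.
Qed.

Section Cartesian.
Variables (R : realType) (K : scalarField R) (re im : K -> R).
Hypothesis ri : cartesian re im.

Lemma coordinate_le z : `|re z| <= modulus z /\ `|im z| <= modulus z.
Proof.
have [_ _ h] := ri; have m0 := modulus_ge0 z.
split; rewrite -ler_sqr ?nnegrE// real_normK ?num_real// h.
  by rewrite lerDl sqr_ge0.
by rewrite lerDr sqr_ge0.
Qed.

Lemma modulus_le_cartesian z : modulus z <= `|re z| + `|im z|.
Proof.
have [_ _ h] := ri; rewrite -ler_sqr ?nnegrE ?modulus_ge0 ?addr_ge0// h sqrrD.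
by rewrite !real_normK ?num_real// lerD2r lerDl mulrn_wge0// mulr_ge0.
Qed.

End Cartesian.

Section ScalarMoments.
Variables (R : realType) (K : scalarField R).
Hypothesis hK : K = real_scalars R \/ K = complex_scalars R.

Lemma sum_trunc_le N J (f : nat -> R) : (forall j, 0 <= f j) ->
  \sum_(0 <= j < N) (if (j < J)%N then f j else 0) <= \sum_(0 <= j < J) f j.
Proof.
move=> f0; rewrite -big_mkcond/=.
rewrite (@big_nat_widen _ _ _ 0 J (maxn J N)) ?leq_maxl//.
rewrite (@big_nat_widen _ _ _ 0 N (maxn J N)) ?leq_maxr//.
rewrite [leRHS]big_mkcond [leLHS]big_mkcond; apply: ler_sum => j _ /=.
by case: (j < J)%N => //=; case: ifP.
Qed.

(** The number [J] of coefficients is independent of the number [N] of variables: blocks of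
    different sizes will share one index set of coefficients. *)
Lemma moment_ge2 (r : R) : 2 <= r -> exists2 C, 1 <= C &
  forall (V : finType) (xi : V -> R) delta N J (z : nat -> K),
    signlike xi delta -> 0 <= delta -> (0 < #|V|)%N ->
    avg (fun w : Om V N => modulus (\sum_(0 <= j < J) z j * ofreal (co xi w j)) `^ r) <=
    C * (delta * (\sum_(0 <= j < J) modulus (z j) `^ r) +
         (delta * (\sum_(0 <= j < J) modulus (z j) ^+ 2)) `^ (r / 2)).
Proof.
move=> r2; have [C C1 hC] := rosenthal r2; have r0 : 0 <= r by lra.
have [re [im ri]] := cartesian_exists hK.
exists (2 `^ r * (2 * C)) => [|V xi delta N J z xid d0 V0].
  have : 1 <= 2 `^ r :> R by rewrite -[leLHS](powRr0 2) ler_powR//; lra.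
  by nra.
set S := delta * _ + _.
have key f : coordinate f -> (forall z, `|f z| <= modulus z) ->
    avg (fun w : Om V N => `|\sum_(0 <= j < J) f (z j) * co xi w j| `^ r) <= C * S.
  move=> fc fle.
  rewrite (eq_avg (g := fun w => `|\sum_(0 <= j < N)
      (if (j < J)%N then f (z j) else 0) * co xi w j| `^ r)); last first.
    by move=> w; rewrite sum_co_trunc.
  apply: le_trans (hC _ _ _ _ _ xid d0 V0) _; rewrite ler_wpM2l//; first by lra.
  apply: lerD; last apply: ler_pow.
  - rewrite ler_wpM2l//; apply: le_trans (sum_trunc_le N _ _) => [|j]; last exact: powR_ge0.
    by apply: ler_sum => j _; case: ifP => _; rewrite ?ler_pow// normr0 powR0//; lra.
  - by lra.
  - by rewrite mulr_ge0// sumr_ge0// => *; exact: sqr_ge0.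
  - rewrite ler_wpM2l//; apply: le_trans (sum_trunc_le N _ _) => [|j]; last exact: sqr_ge0.
    apply: ler_sum => j _; case: ifP => _; last by rewrite expr0n.
    by rewrite -real_normK ?num_real// lerXn2r ?nnegrE ?modulus_ge0.
have [rc ic _] := ri.
have := key _ rc (fun z => (coordinate_le ri z).1).
have := key _ ic (fun z => (coordinate_le ri z).2).
move=> h2 h1.
have -> : 2 `^ r * (2 * C) * S = 2 `^ r * (C * S + C * S) by rewrite -mulrA; congr (_ * _); rewrite -mulrA mulr_natl mulr2n.
apply: le_trans (ler_wpM2l (powR_ge0 _ _) (lerD h1 h2)).
rewrite -avgD -avgZ; apply: avg_le => w.
apply: le_trans (ler_pow r0 (modulus_ge0 _) (modulus_le_cartesian ri _)) _.
by rewrite !coordinate_sum//; exact: powRD_le.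
Qed.

Lemma avg_modulus_sqr (V : finType) (xi : V -> R) (delta : R) N (z : nat -> K) :
  signlike xi delta -> (0 < #|V|)%N ->
  avg (fun w : Om V N => modulus (\sum_(0 <= j < N) z j * ofreal (co xi w j)) ^+ 2) =
  delta * \sum_(0 <= j < N) modulus (z j) ^+ 2.
Proof.
move=> xid V0; have [re [im ri]] := cartesian_exists hK; have [rc ic h] := ri.
under eq_avg do rewrite h !coordinate_sum//.
rewrite avgD !(avg_sqr_sum xid)// -mulrDr -big_split/=.
by under [in RHS]eq_bigr do rewrite h.
Qed.

Lemma scalar_sum_co_trunc (V : finType) (xi : V -> R) N J (w : Om V N) (z : nat -> K) :
  \sum_(0 <= j < J) z j * ofreal (co xi w j) =
  \sum_(0 <= j < N) (if (j < J)%N then z j else 0) * ofreal (co xi w j).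
Proof.
rewrite (@big_nat_widen _ _ _ 0 J (maxn J N)) ?leq_maxl//.
rewrite (@big_nat_widen _ _ _ 0 N (maxn J N)) ?leq_maxr//.
rewrite big_mkcond [RHS]big_mkcond; apply: eq_bigr => j _ /=.
case: ltnP => jJ; case: ltnP => jN //; last by rewrite mul0r.
by rewrite co_out// rmorph0 mulr0.
Qed.

Lemma moment_le2 (s : R) (V : finType) (xi : V -> R) (delta : R) N J (z : nat -> K) :
  0 < s <= 2 -> signlike xi delta -> 0 <= delta -> (0 < #|V|)%N ->
  avg (fun w : Om V N => modulus (\sum_(0 <= j < J) z j * ofreal (co xi w j)) `^ s) <=
  (delta * (\sum_(0 <= j < J) modulus (z j) ^+ 2)) `^ (s / 2).
Proof.
move=> /andP[s0 s2] xid d0 V0.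
have s01 : 0 < s / 2 <= 1 by rewrite divr_gt0//= ler_pdivrMr//; lra.
under eq_avg do rewrite -powR_half ?modulus_ge0// scalar_sum_co_trunc.
apply: le_trans (avg_powR (card_Om N V0) s01 (fun w => sqr_ge0 _)) _.
rewrite (avg_modulus_sqr _ _ xid)//; apply: ler_pow.
- by case/andP: s01 => /ltW.
- by rewrite mulr_ge0// sumr_ge0// => *; exact: sqr_ge0.
- rewrite ler_wpM2l//; apply: le_trans (sum_trunc_le N _ _) => [|j]; last exact: sqr_ge0.
  by apply: ler_sum => j _; case: ifP => //; rewrite modulus0 expr0n.
Qed.

(* [t ^ s >= t ^ 2 - t ^ 4] turns a fourth moment bound into a lower bound for the moment of order [s]. *)
Lemma khintchine_lower_real (s : R) : 1 <= s <= 2 -> exists2 C, 1 <= C &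
  forall (V : finType) (xi : V -> R) N (a : nat -> R),
    signlike xi 1 -> (0 < #|V|)%N ->
    (\sum_(0 <= j < N) a j ^+ 2) `^ (s / 2) <=
    C * avg (fun w : Om V N => `|\sum_(0 <= j < N) a j * co xi w j| `^ s).
Proof.
move=> /andP[s1 s2]; have s0 : 0 < s by lra.
have [C C1 hC] := @rosenthal R 4 ltac:(lra).
exists (8 * C) => [|V xi N a xid V0]; first by lra.
set A := \sum_(_ <= _ < _) _.
have A0 : 0 <= A by apply: sumr_ge0 => *; exact: sqr_ge0.
have [->|An0] := eqVneq A 0.
  rewrite powR0; last by rewrite gt_eqF// divr_gt0.
  by apply: mulr_ge0; [lra|apply: avg_ge0 => *; exact: powR_ge0].
have Ap : 0 < A by rewrite lt_neqAle eq_sym An0.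
pose X (w : Om V N) := `|\sum_(0 <= j < N) a j * co xi w j|.
have m2 : avg (fun w => X w ^+ 2) = A.
  rewrite -[A]mul1r -(avg_sqr_sum xid V0); apply: eq_avg => w.
  by rewrite /X real_normK ?num_real.
have m4 : avg (fun w => X w ^+ 4) <= 2 * C * A ^+ 2.
  have := hC V xi 1 N a xid ler01 V0; rewrite !mul1r -/A.
  under eq_avg do rewrite powR_mulrn//.
  move=> h; apply: le_trans h _.
  have -> : 4 / 2 = 2%:R :> R by lra.
  rewrite powR_mulrn//.
  have hX : \sum_(0 <= j < N) `|a j| `^ 4 <= A ^+ 2.
    under eq_bigr do rewrite powR_mulrn// (exprM _ 2 2) real_normK ?num_real//
      -(powR_mulrn 2 (sqr_ge0 _)).
    by rewrite -(powR_mulrn 2 A0); apply: powR_sum_ge => *; [lra|exact: sqr_ge0].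
  by have := ler_wpM2l (le_trans ler01 C1) hX; lra.
(* The maximizer of [l A - 2 C l^2 A^2], whose maximum is [1 / (8 C)]. *)
pose l := (4 * C * A)^-1.
have CA0 : 0 < 4 * C * A by rewrite mulr_gt0//; lra.
have l0 : 0 < l by rewrite invr_gt0.
have pt t : 0 <= t -> l * t ^+ 2 - l ^+ 2 * t ^+ 4 <= l `^ (s / 2) * t `^ s.
  move=> t0; rewrite -(powR_half _ t0) -powRM ?sqr_ge0 ?(ltW l0)//.
  have -> : l ^+ 2 * t ^+ 4 = (l * t ^+ 2) ^+ 2 by ring.
  set u := l * t ^+ 2.
  have u0 : 0 <= u by rewrite mulr_ge0 ?sqr_ge0 ?(ltW l0).
  have [u1|u1] := leP u 1; last first.
    by apply: le_trans (powR_ge0 _ _); rewrite subr_le0 expr2; nra.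
  apply: (@le_trans _ _ u); first by rewrite lerBlDr lerDl sqr_ge0.
  have [->|un0] := eqVneq u 0; first exact: powR_ge0.
  rewrite -[leLHS]powRr1//; apply: ger_powR; last by lra.
  by rewrite lt_neqAle eq_sym un0 u0.
have := avg_le (fun w => pt (X w) (normr_ge0 _)).
rewrite avgZ -(subr0 (avg _)) => h.
have {h} : l * A - l ^+ 2 * (2 * C * A ^+ 2) <= l `^ (s / 2) * avg (fun w => X w `^ s).
  apply: le_trans (_ : _ <= avg (fun w => l * X w ^+ 2 - l ^+ 2 * X w ^+ 4)) _.
    rewrite (eq_avg (g := fun w => l * X w ^+ 2 + (- l ^+ 2) * X w ^+ 4)) => [|w].
      rewrite avgD !avgZ m2 lerD2l !mulNr lerN2 ler_wpM2l ?sqr_ge0//.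
    by rewrite mulNr.
  by move: h; rewrite subr0.
have -> : l * A - l ^+ 2 * (2 * C * A ^+ 2) = (8 * C)^-1.
  by rewrite /l; field; rewrite !gt_eqF//; lra.
have -> : l = A^-1 * (4 * C)^-1 by rewrite /l invfM mulrC.
rewrite -/X => h.
have C8 : 0 < 8 * C by lra.
move: h; rewrite -[leLHS]mulr1 ler_pdivrMl//.
set Q := (_ / _) `^ _; set m := avg _ => h.
have m0 : 0 <= m by apply: avg_ge0 => *; exact: powR_ge0.
have P0 : 0 <= A `^ (s / 2) by exact: powR_ge0.
have PQ : A `^ (s / 2) * Q <= 1.
  rewrite -powRM ?divr_ge0 ?invr_ge0//; last by lra.
  rewrite mulrA mulfV// mul1r.
  apply: (@le_trans _ _ (1 `^ (s / 2))); last by rewrite powR1.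
  by apply: ler_pow; [lra|rewrite invr_ge0; lra|rewrite invf_le1; lra].
apply: (@le_trans _ _ (A `^ (s / 2) * (8 * C * (Q * m)))); first exact: ler_peMr.
rewrite mulrCA ler_wpM2l ?(ltW C8)// mulrA.
exact: ler_piMl.
Qed.

Lemma khintchine_lower (s : R) : 1 <= s <= 2 -> exists2 C, 1 <= C &
  forall (V : finType) (xi : V -> R) N (z : nat -> K),
    signlike xi 1 -> (0 < #|V|)%N ->
    (\sum_(0 <= j < N) modulus (z j) ^+ 2) `^ (s / 2) <=
    C * avg (fun w : Om V N => modulus (\sum_(0 <= j < N) z j * ofreal (co xi w j)) `^ s).
Proof.
move=> s12; have [C C1 hC] := khintchine_lower_real s12.
have /andP[s1 s2] := s12.
exists (2 * C) => [|V xi N z xid V0]; first by lra.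
have [re [im ri]] := cartesian_exists hK; have [rc ic h] := ri.
have key f : coordinate f -> (forall z, `|f z| <= modulus z) ->
    (\sum_(0 <= j < N) f (z j) ^+ 2) `^ (s / 2) <=
    C * avg (fun w : Om V N => modulus (\sum_(0 <= j < N) z j * ofreal (co xi w j)) `^ s).
  move=> fc fle; apply: le_trans (hC _ _ _ _ xid V0) _.
  rewrite ler_wpM2l//; first by lra.
  apply: avg_le => w; rewrite -coordinate_sum//; apply: ler_pow => //; lra.
have := key _ rc (fun z => (coordinate_le ri z).1).
have := key _ ic (fun z => (coordinate_le ri z).2).
under [in X in _ -> _ -> X]eq_bigr do rewrite h.
rewrite big_split/= => h2 h1.
have s01 : 0 < s / 2 <= 1 by rewrite divr_gt0//= ?ler_pdivrMr//; lra.
pose f b := if b then \sum_(0 <= j < N) re (z j) ^+ 2 else \sum_(0 <= j < N) im (z j) ^+ 2.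
have := @powR_sum_le R bool [:: true; false] xpredT f _ s01.
rewrite !big_cons !big_nil !addr0 /f /= => hf; apply: le_trans (hf _) _.
  by case; apply: sumr_ge0 => *; exact: sqr_ge0.
by rewrite mulrAC -mulrA; lra.
Qed.

End ScalarMoments.

(** * Gauges and their dual norms *)

Section Gauges.
Variables (R : realType) (B J : finType).
Implicit Types (y tau : B -> J -> R) (wt : B -> R) (r e M : R).

Definition sqsum y b := \sum_j y b j ^+ 2.

(* The [r]-th power of the norm on the span of a sequence of Rosenthal blocks. *)
Definition gauge_s r wt y :=
  \sum_b (\sum_j y b j `^ r + wt b `^ r * sqsum y b `^ (r / 2)).

(** The [e]-th power of the norm of an l_e sum of l_2 spaces, which is what blocks of signs span. *)
Definition gauge_r e y := \sum_b sqsum y b `^ (e / 2).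

(** A bound [M] on the dual norm of [tau]. The dual norm is never computed; consequences are drawn
    by inserting extremal [y]. *)
Definition special r wt M tau := forall y, (forall b j, 0 <= y b j) ->
  \sum_b \sum_j y b j * tau b j <= M * gauge_s r wt y `^ r^-1.

Definition rademacher e M tau := forall y, (forall b j, 0 <= y b j) ->
  \sum_b \sum_j y b j * tau b j <= M * gauge_r e y `^ e^-1.

Lemma sqsum_ge0 y b : 0 <= sqsum y b.
Proof. by apply: sumr_ge0 => *; exact: sqr_ge0. Qed.

Lemma gauge_r_ge0 e y : 0 <= gauge_r e y.
Proof. by apply: sumr_ge0 => *; exact: powR_ge0. Qed.

Lemma gauge_s_ge0 r wt y : 0 <= gauge_s r wt y.
Proof.
apply: sumr_ge0 => b _; apply: addr_ge0; last by rewrite mulr_ge0 ?powR_ge0.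
by apply: sumr_ge0 => *; exact: powR_ge0.
Qed.

Lemma special_mono r wt M tau tau' : (forall b j, tau' b j <= tau b j) ->
  special r wt M tau -> special r wt M tau'.
Proof.
move=> tt h y y0; apply: le_trans (h y y0).
by apply: ler_sum => b _; apply: ler_sum => j _; rewrite ler_wpM2l.
Qed.

Lemma gauge_s_le r wt y : 2 <= r -> (forall b j, 0 <= y b j) ->
  (forall b, 0 <= wt b <= 1) ->
  gauge_s r wt y <= 2 * \sum_b sqsum y b `^ (r / 2).
Proof.
move=> r2 y0 w01; rewrite mulr_sumr; apply: ler_sum => b _.
rewrite mulr_natl mulr2n; apply: lerD.
  under eq_bigr do rewrite -powR_half//.
  by apply: powR_sum_ge => [|j]; [lra|exact: sqr_ge0].
apply: ler_piMl; first exact: powR_ge0.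
have /andP[w0 w1] := w01 b.
have <- : 1 `^ r = 1 :> R by rewrite powR1.
by apply: ler_pow => //; lra.
Qed.

Lemma conj2 : 2^-1 + 2^-1 = 1 :> R. Proof. lra. Qed.

(** For [r >= 2] and weights at most 1 the gauge norm is at most twice the l_2 norm, so by duality
    the l_2 norm of [tau] is controlled. The extremal vector is [tau] itself. *)
Lemma special_l2 r wt M tau : 2 <= r -> 0 <= M -> (forall b j, 0 <= tau b j) ->
  (forall b, 0 <= wt b <= 1) -> special r wt M tau ->
  \sum_b \sum_j tau b j ^+ 2 <= (2 * M) ^+ 2.
Proof.
move=> r2 M0 t0 w01 h; have r0 : 0 < r by lra.
set Q := \sum_b _.
have Q0 : 0 <= Q by apply: sumr_ge0 => b _; exact: sqsum_ge0.
have MM : 0 <= 2 * M by lra.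
rewrite -(powR_mulrn 2 MM); apply: (@self_bound R _ _ 2 2) => //; [exact: conj2|].
have QE : Q = \sum_b \sum_j tau b j * tau b j by [].
rewrite {1}QE; apply: le_trans (h _ t0) _.
rewrite [2 * M]mulrC -mulrA; apply: ler_wpM2l => //.
apply: (@le_trans _ _ ((2 * Q `^ (r / 2)) `^ r^-1)).
  apply: ler_pow; rewrite ?invr_ge0 ?gauge_s_ge0 ?(ltW r0)//.
  apply: le_trans (gauge_s_le r2 t0 w01) _; rewrite ler_wpM2l//.
  by apply: powR_sum_ge => [|b]; [lra|exact: sqsum_ge0].
rewrite powRM ?powR_ge0// -powRrM.
have -> : r / 2 * r^-1 = 2^-1 by rewrite mulrAC mulfV ?mul1r// gt_eqF.
rewrite ler_wpM2r ?powR_ge0//.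
rewrite -[leRHS]powRr1//; apply: ler_powR; first by lra.
by rewrite invf_le1//; lra.
Qed.

Section Conjugate.
Variables (r r' : R).
Hypotheses (r2 : 2 < r) (rr : r^-1 + r'^-1 = 1) (r'1 : 1 < r').

Let r0 : 0 < r. Proof. exact: lt_trans r2. Qed.
Let r'0 : 0 < r'. Proof. exact: lt_trans r'1. Qed.

Lemma conj_mul : (r' - 1) * r = r'.
Proof.
have : r * r' * (r^-1 + r'^-1) = r * r' by rewrite rr mulr1.
rewrite mulrDr mulrAC mulfV ?gt_eqF// mul1r -mulrA mulfV ?gt_eqF// mulr1.
by move=> h; rewrite mulrBl mul1r mulrC -h addrK.
Qed.

(** On vectors with at most [k] nonzero entries per block, the weighted l_2 part of the gauge is
    dominated by its l_r part once [wt * k <= 1]. The dual norm then controls the l_(r') norm, as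
    [y = tau ^ (r' - 1)] shows. *)
Lemma special_peak wt M tau (k : R) : 1 <= k -> 0 <= M ->
  (forall b j, 0 <= tau b j) -> (forall b, 0 <= wt b) -> (forall b, wt b * k <= 1) ->
  (forall b, \sum_j (tau b j != 0)%:R <= k) -> special r wt M tau ->
  \sum_b \sum_j tau b j `^ r' <= (2 * M) `^ r'.
Proof.
have [r_gt2 r'_gt1] := (r2, r'1).
move=> k1 M0 t0 w0 wk cnt h.
set Q := \sum_b _.
have Q0 : 0 <= Q by apply: sumr_ge0 => b _; apply: sumr_ge0 => *; exact: powR_ge0.
have MM : 0 <= 2 * M by lra.
apply: (self_bound r0 r'0 rr) => //.
pose y b j := tau b j `^ (r' - 1).
have y0 b j : 0 <= y b j by exact: powR_ge0.
have QE : Q = \sum_b \sum_j y b j * tau b j.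
  by apply: eq_bigr => b _; apply: eq_bigr => j _; rewrite mulrC mulr_powR.
have yr b j : y b j `^ r = tau b j `^ r' by rewrite -powRrM conj_mul.
rewrite {1}QE; apply: le_trans (h _ y0) _.
rewrite [2 * M]mulrC -mulrA; apply: ler_wpM2l => //.
apply: (@le_trans _ _ ((2 * Q) `^ r^-1)); last first.
  rewrite powRM// ler_wpM2r ?powR_ge0//.
  rewrite -[leRHS]powRr1//; apply: ler_powR; first by lra.
  by rewrite invf_le1//; lra.
apply: ler_pow; rewrite ?invr_ge0 ?gauge_s_ge0 ?(ltW r0)//.
rewrite mulr_sumr; apply: ler_sum => b _.
rewrite mulr_natl mulr2n; under eq_bigr do rewrite yr; rewrite lerD2l.
set S := \sum_j _.
have S0 : 0 <= S by apply: sumr_ge0 => *; exact: powR_ge0.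
have n2 : sqsum y b <= k * S `^ (2 / r).
  apply: (@le_trans _ _ (\sum_j (tau b j != 0)%:R * S `^ (2 / r))); last first.
    by rewrite -mulr_suml ler_wpM2r ?powR_ge0.
  apply: ler_sum => j _; have [tj|tj] := eqVneq (tau b j) 0.
    by rewrite /y tj powR0 ?expr0n ?mul0r// subr_eq0 gt_eqF.
  rewrite mul1r -(powR_mulrn 2 (y0 b j)).
  rewrite (_ : y b j `^ 2%:R = (y b j `^ r) `^ (2 / r)); last first.
    by rewrite -powRrM mulrCA mulfV ?mulr1// gt_eqF.
  rewrite yr; apply: ler_pow; rewrite ?powR_ge0//; first by rewrite divr_ge0// ltW.
  by rewrite /S (bigD1 j)//= lerDl sumr_ge0// => *; exact: powR_ge0.
have h1 : sqsum y b `^ (r / 2) <= k `^ (r / 2) * S.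
  apply: le_trans (ler_pow _ (sqsum_ge0 _ _) n2) _; first by lra.
  rewrite powRM ?powR_ge0//; last by lra.
  rewrite -powRrM (_ : 2 / r * (r / 2) = 1) ?powRr1//.
  by field; rewrite gt_eqF.
apply: le_trans (ler_wpM2l (powR_ge0 _ _) h1) _.
rewrite mulrA; apply: ler_piMl => //.
apply: (@le_trans _ _ (wt b `^ r * k `^ r)).
  by rewrite ler_wpM2l ?powR_ge0// ler_powR//; lra.
rewrite -powRM//; last by lra.
have <- : 1 `^ r = 1 :> R by rewrite powR1.
by apply: ler_pow; rewrite ?(ltW r0) ?mulr_ge0//; lra.
Qed.

(** Testing [tau] on a single block, with square sum [q], gives
    [q^r <= M^r (c^(r-2) q + w^r q^(r/2))]. If [q > z], the two smallness conditions make each term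
    less than half of [q^r]. *)
Lemma special_block wt M tau (c w z : R) : 0 < M -> 0 < z -> 0 <= c ->
  (forall b j, 0 <= tau b j <= c) -> (forall b, 0 <= wt b <= w) ->
  special r wt M tau ->
  2 * M `^ r * c `^ (r - 2) <= z `^ (r - 1) -> 2 * M `^ r * w `^ r <= z `^ (r / 2) ->
  forall b, sqsum tau b <= z.
Proof.
have r_gt2 := r2.
move=> M0 z0 c0 tc ww h hc hw b; rewrite leNgt; apply/negP => zq.
set q := sqsum tau b in zq.
have q0 : 0 < q by exact: lt_trans zq.
have t0 b' j : 0 <= tau b' j by have /andP[] := tc b' j.
pose y b' j := if b' == b then tau b' j else 0.
have y0 b' j : 0 <= y b' j by rewrite /y; case: ifP.
have := h y y0.
rewrite (bigD1 b)//= [X in _ + X]big1 ?addr0; last first.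
  by move=> b' /negbTE bb'; apply: big1 => j _; rewrite /y bb' mul0r.
rewrite (_ : \sum_j _ = q); last by apply: eq_bigr => j _; rewrite /y eqxx expr2.
rewrite (_ : gauge_s r wt y = \sum_j tau b j `^ r + wt b `^ r * q `^ (r / 2)); last first.
  rewrite /gauge_s (bigD1 b)//= [X in _ + X]big1 ?addr0.
    congr (_ + _ * (_ `^ _)); first by apply: eq_bigr => j _; rewrite /y eqxx.
    by apply: eq_bigr => j _; rewrite /y eqxx.
  move=> b' /negbTE bb'; rewrite /sqsum !big1 ?powR0 ?mulr0 ?addr0//.
  - by rewrite gt_eqF//; lra.
  - by move=> j _; rewrite /y bb' expr0n.
  - by move=> j _; rewrite /y bb' powR0// gt_eqF.
apply/negP; rewrite -ltNge.
set G := _ + _; have G0 : 0 <= G.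
  by rewrite addr_ge0 ?mulr_ge0 ?powR_ge0// sumr_ge0// => *; exact: powR_ge0.
have h1 : \sum_j tau b j `^ r <= c `^ (r - 2) * q.
  rewrite mulr_sumr; apply: ler_sum => j _.
  have [->|tj] := eqVneq (tau b j) 0; first by rewrite powR0 ?gt_eqF// expr0n mulr0.
  rewrite -(powR_mulrn 2 (t0 b j)).
  rewrite (_ : tau b j `^ r = tau b j `^ (r - 2) * tau b j `^ 2%:R); last first.
    by rewrite -powRD ?subrK// tj implybT.
  rewrite ler_wpM2r ?powR_ge0//; apply: ler_pow => //; first by lra.
  by have /andP[] := tc b j.
have h2 : wt b `^ r <= w `^ r.
  by have /andP[wb0 wbw] := ww b; apply: ler_pow => //; lra.
have Mr0 : 0 < M `^ r by exact: powR_gt0.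
have hG : M `^ r * G < q `^ r.
  have e1 : 2 * M `^ r * (c `^ (r - 2) * q) < q `^ r.
    have -> : q `^ r = q `^ (r - 1) * q by rewrite mulrC mulr_powR// ltW.
    rewrite mulrA ltr_pM2r//; apply: le_lt_trans hc _.
    by apply: gt0_ltr_powR; rewrite ?nnegrE ?ltW//; lra.
  have e2 : 2 * M `^ r * (w `^ r * q `^ (r / 2)) < q `^ r.
    rewrite (_ : q `^ r = q `^ (r / 2) * q `^ (r / 2)); last first.
      rewrite -powRD; last by rewrite (gt_eqF q0) implybT.
      by congr (_ `^ _); lra.
    rewrite mulrA ltr_pM2r ?powR_gt0//; apply: le_lt_trans hw _.
    by apply: gt0_ltr_powR; rewrite ?nnegrE ?ltW//; lra.
  have e3 : G <= c `^ (r - 2) * q + w `^ r * q `^ (r / 2).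
    by apply: lerD => //; rewrite ler_wpM2r ?powR_ge0.
  have := ler_wpM2l (ltW Mr0) e3; rewrite [in leRHS]mulrDr.
  move: e1 e2; rewrite -!(mulrA 2).
  move: (M `^ r * G) (q `^ r) (M `^ r * (c `^ (r - 2) * q)) (M `^ r * (w `^ r * q `^ (r / 2))).
  by move=> x1 x2 x3 x4; lra.
have -> : M * G `^ r^-1 = (M `^ r * G) `^ r^-1.
  by rewrite powRM ?powR_ge0// powRK ?gt_eqF// ltW.
have -> : q = (q `^ r) `^ r^-1 by rewrite powRK ?gt_eqF// ltW.
by apply: gt0_ltr_powR; rewrite ?invr_gt0 ?nnegrE ?mulr_ge0 ?powR_ge0.
Qed.

(** The gauge norm is at most twice that of an l_r sum of l_2 spaces, whose dual is the l_(r') sum.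
    The extremal [y] is [tau] rescaled block by block. *)
Lemma special_sum_block wt M tau : r' < 2 -> 0 <= M -> (forall b j, 0 <= tau b j) ->
  (forall b, 0 <= wt b <= 1) -> special r wt M tau ->
  \sum_b sqsum tau b `^ (r' / 2) <= (2 * M) `^ r'.
Proof.
have [r_gt2 r'_gt1] := (r2, r'1).
move=> r'2 M0 t0 w01 h; set Q := \sum_b _.
have Q0 : 0 <= Q by apply: sumr_ge0 => *; exact: powR_ge0.
have MM : 0 <= 2 * M by lra.
apply: (self_bound r0 r'0 rr) => //.
pose y b j := tau b j * sqsum tau b `^ ((r' - 2) / 2).
have y0 b j : 0 <= y b j by rewrite mulr_ge0 ?powR_ge0.
have QE : Q = \sum_b \sum_j y b j * tau b j.
  apply: eq_bigr => b _; under eq_bigr do rewrite /y mulrAC -expr2.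
  rewrite -mulr_suml -/(sqsum tau b); have [->|q0] := eqVneq (sqsum tau b) 0.
    by rewrite powR0 ?mul0r// gt_eqF//; lra.
  rewrite -{2}[sqsum tau b]powRr1 ?sqsum_ge0// -powRD ?q0 ?implybT//.
  by congr (_ `^ _); lra.
have yn b : sqsum y b = sqsum tau b `^ (r' - 1).
  rewrite /sqsum; under eq_bigr do rewrite /y exprMn.
  rewrite -mulr_suml -/(sqsum tau b); have [->|q0] := eqVneq (sqsum tau b) 0.
    by rewrite mul0r powR0// gt_eqF//; lra.
  rewrite -(powR_mulrn 2 (powR_ge0 _ _)) -powRrM.
  rewrite -{1}[sqsum tau b]powRr1 ?sqsum_ge0// -powRD ?q0 ?implybT//.
  by congr (_ `^ _); lra.
rewrite {1}QE; apply: le_trans (h _ y0) _.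
rewrite [2 * M]mulrC -mulrA; apply: ler_wpM2l => //.
apply: (@le_trans _ _ ((2 * Q) `^ r^-1)); last first.
  rewrite powRM// ler_wpM2r ?powR_ge0//.
  rewrite -[leRHS]powRr1//; apply: ler_powR; first by lra.
  by rewrite invf_le1//; lra.
apply: ler_pow; rewrite ?invr_ge0 ?gauge_s_ge0 ?(ltW r0)//.
apply: le_trans (gauge_s_le (ltW r2) y0 w01) _; apply: eq_ler; congr (_ * _).
apply: eq_bigr => b _; rewrite yn -powRrM; congr (_ `^ _).
by rewrite mulrA conj_mul.
Qed.

End Conjugate.

End Gauges.

Section Smallness.
Variable R : realType.

Lemma small_pow (a x k : R) : 0 < a -> 0 < x -> 0 < k ->
  exists2 c, 0 < c & k * c `^ a <= x.
Proof.
move=> a0 x0 k0; exists ((x / k) `^ a^-1); first by rewrite powR_gt0// divr_gt0.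
have xk : 0 <= x / k by rewrite ltW// divr_gt0.
by rewrite powRVK ?gt_eqF// mulrCA mulfV ?gt_eqF// mulr1.
Qed.

(* [r' < e] leaves room for a positive power of [c]. *)
Lemma special_small (r r' e M eps : R) : 2 < r -> r^-1 + r'^-1 = 1 -> 1 < r' -> r' < 2 ->
  r' < e -> 0 < M -> 0 < eps ->
  exists2 c, 0 < c <= 1 & forall (B J : finType) wt (tau : B -> J -> R),
    (forall b, 0 <= wt b <= c) -> (forall b j, 0 <= tau b j <= c) ->
    special r wt M tau -> gauge_r e tau `^ e^-1 <= eps.
Proof.
move=> r2 rr r'1 r'2 r'e M0 eps0.
have r'0 : 0 < r' by lra.
have e0 : 0 < e by lra.
have Mr : 0 < (2 * M) `^ r' by rewrite powR_gt0//; lra.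
have epse : 0 < eps `^ e by rewrite powR_gt0.
have er : 0 < (e - r') / 2 by lra.
(* [z] is to bound the square sum of every block; the excess exponent [(e - r') / 2] over
   [special_sum_block] converts this into smallness of the whole sum. The constants [c1] and [c2]
   then serve [special_block]. *)
have [z z0 hz] := small_pow er epse Mr.
have M2 : 0 < 2 * M `^ r by rewrite mulr_gt0 ?powR_gt0.
have r20 : 0 < r - 2 by lra.
have [c1 c10 hc1] := small_pow r20 (powR_gt0 (r - 1) z0) M2.
have r0 : 0 < r by lra.
have [c2 c20 hc2] := small_pow r0 (powR_gt0 (r / 2) z0) M2.
pose c := Num.min 1 (Num.min c1 c2).
have c0 : 0 < c by rewrite !lt_min ltr01 c10 c20.
have c_1 : c <= 1 by rewrite ge_min lexx.
have c_c1 : c <= c1 by rewrite !ge_min lexx orbT.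
have c_c2 : c <= c2 by rewrite !ge_min lexx !orbT.
exists c; first by rewrite c0.
move=> B J wt tau wc tc h; clearbody c.
have t0 b j : 0 <= tau b j by have /andP[] := tc b j.
have w01 b : 0 <= wt b <= 1.
  by have /andP[-> /= wb] := wc b; exact: le_trans wb c_1.
have qz : forall b, sqsum tau b <= z.
  apply: (special_block r2 M0 z0 (ltW c0) tc wc h).
    by apply: le_trans hc1; rewrite ler_wpM2l ?(ltW M2)//; apply: ler_pow => //; exact: ltW.
  by apply: le_trans hc2; rewrite ler_wpM2l ?(ltW M2)//; apply: ler_pow => //; exact: ltW.
have hQ := special_sum_block r2 rr r'1 r'2 (ltW M0) t0 w01 h.
rewrite -[leRHS](powRK (_ : e != 0)) ?(ltW eps0) ?gt_eqF//.
apply: ler_pow; rewrite ?gauge_r_ge0 ?invr_ge0 ?(ltW e0)//.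
apply: le_trans hz; apply: (@le_trans _ _ (\sum_b z `^ ((e - r') / 2) * sqsum tau b `^ (r' / 2))).
  apply: ler_sum => b _; have [->|q0] := eqVneq (sqsum tau b) 0.
    by rewrite powR0 ?mulr_ge0 ?powR_ge0// gt_eqF// divr_gt0.
  have -> : e / 2 = (e - r') / 2 + r' / 2 by rewrite -mulrDl subrK.
  rewrite powRD ?q0 ?implybT// ler_wpM2r ?powR_ge0//; apply: ler_pow => //; first exact: ltW.
  exact: sqsum_ge0.
by rewrite -mulr_sumr mulrC ler_wpM2r ?powR_ge0.
Qed.

(** As [s] is at most both exponents of the mixed norm, the plain l_s norm over all entries
    dominates it. This is the [s] that determines the gain. *)
Lemma gauge_r_le (B J : finType) (e s : R) (y : B -> J -> R) :
  0 < e -> s = Num.min e 2 -> (forall b j, 0 <= y b j) ->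
  gauge_r e y `^ e^-1 <= (\sum_b \sum_j y b j `^ s) `^ s^-1.
Proof.
move=> e0 -> y0; have [e2|e2] := leP e 2.
  apply: ler_pow; rewrite ?gauge_r_ge0 ?invr_ge0 ?(ltW e0)//.
  apply: ler_sum => b _; apply: le_trans (powR_sum_le _ _ _ _) _.
  - by rewrite divr_gt0//= ler_pdivrMr//; lra.
  - by move=> j; exact: sqr_ge0.
  - by apply: ler_sum => j _; rewrite powR_half.
have S0 : 0 <= \sum_b sqsum y b by apply: sumr_ge0 => b _; exact: sqsum_ge0.
apply: (@le_trans _ _ (((\sum_b sqsum y b) `^ (e / 2)) `^ e^-1)).
  apply: ler_pow; rewrite ?gauge_r_ge0 ?invr_ge0 ?(ltW e0)//.
  by apply: powR_sum_ge => [|b]; [lra|exact: sqsum_ge0].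
rewrite -powRrM (_ : e / 2 / e = 2^-1); last by field; rewrite gt_eqF.
apply: eq_ler; congr (_ `^ _); apply: eq_bigr => b _; apply: eq_bigr => j _.
by rewrite powR_mulrn.
Qed.

End Smallness.

(** * Testing a finite matrix with random signs *)

Section SignAverages.
Variables (R : realType) (K : scalarField R).
Hypothesis hK : K = real_scalars R \/ K = complex_scalars R.

Definition sgb (b : bool) : R := if b then 1 else -1.

Lemma sgb_signlike : signlike sgb 1.
Proof.
by move=> f; rewrite /avg card_bool big_bool /= subrr mul0r add0r; field.
Qed.

Lemma modulus_co_sgb N (w : Om bool N) j : (j < N)%N -> modulus (ofreal (co sgb w j) : K) = 1.
Proof.
rewrite modulus_ofreal; elim: N w => //= N IH [v w] jN.
case: eqP => [_|/eqP jN']; first by rewrite /sgb; case: v; rewrite ?normrN1 ?normr1.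
by rewrite IH// ltn_neqAle jN'.
Qed.

(** Orthogonality of signs. It replaces a sum of products by an average of products of two signed
    sums, to which the bounds on linear combinations apply. *)
Lemma sign_polarization N (t h : nat -> K) :
  #|Om bool N|%:R * \sum_(0 <= i < N) t i * h i =
  \sum_(w : Om bool N) (\sum_(0 <= i < N) t i * ofreal (co sgb w i)) *
                       (\sum_(0 <= i < N) h i * ofreal (co sgb w i)).
Proof.
have V0 : (0 < #|{: bool}|)%N by rewrite card_bool.
have sumE i j : (i < N)%N -> (j < N)%N ->
    \sum_(w : Om bool N) co sgb w i * co sgb w j = (#|Om bool N|%:R * (i == j)%:R : R).
  move=> iN jN; have := avg_coM sgb_signlike V0 iN jN; rewrite mul1r => <-.
  by rewrite mulrC divfK// pnatr_eq0 -lt0n card_Om.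
under [RHS]eq_bigr do rewrite big_distrlr/=.
rewrite [RHS]exchange_big/= mulr_sumr; apply: eq_big_nat => i /andP[_ iN].
rewrite [RHS]exchange_big/= (eq_big_nat _ _ (F2 := fun j =>
   if j == i then #|Om bool N|%:R * (t i * h i) else 0)); last first.
  move=> j /andP[_ jN]; under eq_bigr do rewrite mulrACA -rmorphM.
  rewrite -mulr_sumr -rmorph_sum sumE// rmorphM rmorph_nat rmorph_nat eq_sym.
  case: eqP => [->|_]; last by rewrite !mulr0.
  by rewrite mulr1 mulrC.
by rewrite -big_mkcond big_nat1_eq/= iN.
Qed.

End SignAverages.

Section Test.
Variables (R : realType) (K : scalarField R).
Hypothesis hK : K = real_scalars R \/ K = complex_scalars R.

Lemma modulus_natr n : modulus (n%:R : K) = n%:R.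
Proof. by rewrite -(rmorph_nat (@ofreal R K)) modulus_ofreal normr_nat. Qed.

Lemma powR_half_sqr (x : R) : 0 <= x -> (x `^ 2^-1) ^+ 2 = x.
Proof. by move=> x0; rewrite -(powR_mulrn 2 (powR_ge0 _ _)) powRVK. Qed.

Section RowBound.
Variables (B J : finType) (wt : B -> R) (r c : R) (N : nat) (t : nat -> B -> J -> K).
Hypotheses (r2 : 2 <= r) (w01 : forall b, 0 <= wt b <= 1) (c0 : 0 <= c).
Hypothesis H : forall a : nat -> K,
  special r wt (c * (\sum_(0 <= i < N) modulus (a i) ^+ 2) `^ 2^-1)
    (fun b j => modulus (\sum_(0 <= i < N) t i b j * a i)).

(** With [a] the conjugate of the row [(t i b j)_i], the entry at [(b, j)] alone equals the square
    sum [rho], while [special_l2] bounds it by [2 c] times the root of [rho]. *)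
Lemma row_bound b j : \sum_(0 <= i < N) modulus (t i b j) ^+ 2 <= (2 * c) ^+ 2.
Proof.
set rho := \sum_(_ <= _ < _) _.
have rho0 : 0 <= rho by apply: sumr_ge0 => *; exact: sqr_ge0.
pose a i := phase (t i b j) * ofreal (modulus (t i b j)).
have a2 : \sum_(0 <= i < N) modulus (a i) ^+ 2 <= rho.
  apply: ler_sum => i _; rewrite modulusM modulus_ofreal ger0_norm ?modulus_ge0//.
  rewrite exprMn; apply: ler_piMl; first exact: sqr_ge0.
  by rewrite expr_le1 ?modulus_ge0// modulus_phase.
have ta : modulus (\sum_(0 <= i < N) t i b j * a i) = rho.
  rewrite (eq_bigr (fun i => ofreal (modulus (t i b j) ^+ 2))) => [|i _]; last first.
    by rewrite /a mulrA [_ * phase _]mulrC phaseM -rmorphM expr2.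
  by rewrite -rmorph_sum modulus_ofreal ger0_norm.
set A := \sum_(0 <= i < N) _ in a2.
have A0 : 0 <= A by apply: sumr_ge0 => *; exact: sqr_ge0.
have cA0 : 0 <= c * A `^ 2^-1 by rewrite mulr_ge0 ?powR_ge0.
have := special_l2 r2 cA0 (fun b j => modulus_ge0 _) w01 (H a).
set tau := fun b j => modulus (\sum_(0 <= i < N) t i b j * a i).
rewrite mulrA [leRHS]exprMn powR_half_sqr// => h.
have : rho ^+ 2 <= (2 * c) ^+ 2 * A.
  apply: le_trans h; rewrite (bigD1 b)//= (bigD1 j)//= ta.
  rewrite -addrA lerDl; apply: addr_ge0; apply: sumr_ge0 => *; first exact: sqr_ge0.
  by apply: sumr_ge0 => *; exact: sqr_ge0.
move=> {}h; have : rho * rho <= (2 * c) ^+ 2 * rho.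
  by rewrite -expr2; apply: le_trans h _; rewrite ler_wpM2l ?sqr_ge0.
have [->|rn0] := eqVneq rho 0; first by rewrite sqr_ge0.
by rewrite ler_pM2r// lt_neqAle eq_sym rn0.
Qed.

End RowBound.

(** Without any gain the bound would be of order [W * N]. For signed sums restricted to the peaks,
    [special_peak] controls the l_(r') norm by [W] times the root of [N]; needed against [h] is only
    the l_s norm with [s > r'], and this saves the power of [N]. *)
Lemma peak_part (r r' e s M : R) : 2 < r -> r^-1 + r'^-1 = 1 -> 1 < r' -> r' < 2 ->
  r' < e -> s = Num.min e 2 -> 1 <= M -> exists2 C, 1 <= C &
  forall N W (B J : finType) (wt : B -> R) (t h : nat -> B -> J -> K)
    (P : B -> J -> bool) k,
  (0 < N)%N -> 1 <= W -> 1 <= k ->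
  (forall b, 0 <= wt b <= 1) -> (forall b, wt b * k <= 1) ->
  (forall b, \sum_j (P b j)%:R <= k) ->
  (forall a : nat -> K,
    special r wt (M * W * (\sum_(0 <= i < N) modulus (a i) ^+ 2) `^ 2^-1)
      (fun b j => modulus (\sum_(0 <= i < N) t i b j * a i))) ->
  (forall a : nat -> K,
    rademacher e (M * (\sum_(0 <= i < N) modulus (a i) ^+ 2) `^ 2^-1)
      (fun b j => modulus (\sum_(0 <= i < N) h i b j * a i))) ->
  modulus (\sum_b \sum_(j | P b j) \sum_(0 <= i < N) t i b j * h i b j) <=
  C * N%:R * (W * N%:R `^ (r' / (2 * s) - 2^-1)).
Proof.
move=> r2 rr r'1 r'2 r'e sE M1.
have r'12 : 1 <= r' <= 2 by rewrite !ltW.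
have [C C1 hC] := khintchine_lower hK r'12.
exists (2 * C * M ^+ 2).
  by have : 1 <= M ^+ 2 by [rewrite expr_ge1//; lra]; nra.
move=> N W B J wt t h P k N0 W1 k1 w01 wk cnt H1 H2.
have V0 : (0 < #|{: bool}|)%N by rewrite card_bool.
have [M0 W0] : 0 < M /\ 0 < W by split; exact: lt_le_trans ltr01 _.
have r'0 : 0 < r' by lra.
have e0 : 0 < e by lra.
have s_r' : r' < s by rewrite sE lt_min r'e.
have s_2 : s <= 2 by rewrite sE ge_min lexx orbT.
have s0 : 0 < s by lra.
have sV : 0 < s^-1 <= 1 by rewrite invr_gt0 s0 invf_le1//; lra.
have n0 : 0 < N%:R :> R by rewrite ltr0n.
pose T (w : Om bool N) b j := modulus (\sum_(0 <= i < N) t i b j * ofreal (co (sgb R) w i)).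
pose H (w : Om bool N) b j := modulus (\sum_(0 <= i < N) h i b j * ofreal (co (sgb R) w i)).
pose y w b j := if P b j then T w b j else 0.
have y0 w b j : 0 <= y w b j by rewrite /y; case: ifP => // _; exact: modulus_ge0.
have sgN (w : Om bool N) : \sum_(0 <= i < N) modulus (ofreal (co (sgb R) w i) : K) ^+ 2 = N%:R.
  rewrite (eq_big_nat _ _ (F2 := fun=> 1)) => [|i /andP[_ iN]]; last first.
    by rewrite modulus_co_sgb// expr1n.
  by rewrite sumr_const_nat subn0.
have c0 : (0 < #|Om bool N|)%N by exact: card_Om.
have cR : 0 < #|Om bool N|%:R :> R by rewrite ltr0n.
pose S w := \sum_b \sum_j y w b j * H w b j.
have step1 : modulus (\sum_b \sum_(j | P b j) \sum_(0 <= i < N) t i b j * h i b j) <= avg S.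
  rewrite /avg ler_pdivlMr// mulrC -modulus_natr -modulusM mulr_sumr.
  rewrite (eq_bigr (fun b => \sum_(w : Om bool N) \sum_(j | P b j)
      (\sum_(0 <= i < N) t i b j * ofreal (co (sgb R) w i)) *
      (\sum_(0 <= i < N) h i b j * ofreal (co (sgb R) w i)))) => [|b _]; last first.
    rewrite mulr_sumr exchange_big/=.
    by apply: eq_bigr => j _; rewrite sign_polarization.
  rewrite exchange_big/=; apply: le_trans (modulus_sum _ _ _) _.
  apply: ler_sum => w _; apply: le_trans (modulus_sum _ _ _) _.
  apply: ler_sum => b _; apply: le_trans (modulus_sum _ _ _) _.
  rewrite big_mkcond/=; apply: ler_sum => j _; rewrite /y.
  by case: ifP => _; rewrite ?mul0r// modulusM.
pose Z w := \sum_b \sum_j y w b j `^ s.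
have Z0 w : 0 <= Z w by apply: sumr_ge0 => b _; apply: sumr_ge0 => *; exact: powR_ge0.
have sN0 : 0 <= M * N%:R `^ 2^-1 by rewrite mulr_ge0 ?powR_ge0 ?(ltW M0).
have step2 w : S w <= M * N%:R `^ 2^-1 * Z w `^ s^-1.
  have := H2 (fun i => ofreal (co (sgb R) w i)) _ (y0 w); rewrite sgN => h2.
  apply: le_trans h2 _; rewrite ler_wpM2l//; exact: gauge_r_le.
apply: le_trans step1 _; apply: le_trans (avg_le step2) _.
rewrite avgZ; apply: le_trans (ler_wpM2l sN0 (avg_powR c0 sV Z0)) _.
have MW : 0 < 2 * (M * W) by rewrite !mulr_gt0.
have MW0 : 0 <= M * W by exact/ltW/mulr_gt0.
have MWN : 0 <= M * W * N%:R `^ 2^-1 by rewrite mulr_ge0// powR_ge0.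
(* For each entry the moment of order [s] is at most [rho ^ (s / 2)]. Of this,
   [rho ^ ((s - r') / 2)] is bounded by [row_bound], and Khintchine turns the remaining factor into
   a moment of order [r'], to be summed by [special_peak]. *)
have step3 : avg Z <= C * (2 * (M * W)) `^ s * N%:R `^ (r' / 2).
  apply: (@le_trans _ _ ((2 * (M * W)) `^ (s - r') * C *
      avg (fun w => \sum_b \sum_j y w b j `^ r'))); last first.
    apply: (@le_trans _ _ ((2 * (M * W)) `^ (s - r') * C * (2 * (M * W * N%:R `^ 2^-1)) `^ r')).
      rewrite ler_wpM2l//; first by rewrite mulr_ge0 ?powR_ge0// (le_trans ler01 C1).
      rewrite -[leRHS](avg_const _ c0); apply: avg_le => w.
      have wt0 b : 0 <= wt b by have /andP[] := w01 b.
      apply: (special_peak r2 rr r'1 k1 MWN (y0 w) wt0 wk) => [b|].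
      - apply: le_trans (cnt b); apply: ler_sum => j _; rewrite /y.
        by case: ifP => _; rewrite ?eqxx// ler_nat leq_b1.
      - apply: special_mono (_ : forall b j, y w b j <= T w b j) _.
          by move=> b j; rewrite /y; case: ifP => // _; exact: modulus_ge0.
        by have := H1 (fun i => ofreal (co (sgb R) w i)); rewrite sgN.
    rewrite (mulrA 2 (M * W)) (@powRM _ (2 * (M * W)) (N%:R `^ 2^-1)) ?powR_ge0 ?(ltW MW)//.
    rewrite -powRrM [2^-1 * r']mulrC.
    have -> : (2 * (M * W)) `^ s = (2 * (M * W)) `^ (s - r') * (2 * (M * W)) `^ r'.
      by rewrite -powRD ?subrK// (gt_eqF MW) implybT.
    by apply: eq_ler; rewrite mulrA -!mulrA mulrCA.
  rewrite /Z !avg_sum; under eq_bigr do rewrite avg_sum.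
  under [X in _ <= _ * X]eq_bigr do rewrite avg_sum.
  rewrite mulr_sumr; apply: ler_sum => b _; rewrite mulr_sumr; apply: ler_sum => j _.
  rewrite /y; case: (P b j); last first.
    by rewrite !powR0 ?(avg_const 0 c0) ?mulr0// gt_eqF.
  set rho := \sum_(0 <= i < N) modulus (t i b j) ^+ 2.
  have rho0 : 0 <= rho by apply: sumr_ge0 => *; exact: sqr_ge0.
  have rhoM : rho <= (2 * (M * W)) ^+ 2 by apply: (row_bound (ltW r2) w01 MW0 H1).
  apply: (@le_trans _ _ (rho `^ (s / 2))).
    have s02 : 0 < s <= 2 by rewrite s0.
    by have := moment_le2 hK N N (fun i => t i b j) s02 (@sgb_signlike R) ler01 V0;
      rewrite mul1r.
  apply: (@le_trans _ _ ((2 * (M * W)) `^ (s - r') * rho `^ (r' / 2))); last first.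
    rewrite -mulrA ler_wpM2l ?powR_ge0//.
    exact: (hC _ _ _ (fun i => t i b j) (@sgb_signlike R) V0).
  have [->|rn0] := eqVneq rho 0.
    by rewrite powR0 ?mulr_ge0 ?powR_ge0// gt_eqF// divr_gt0.
  have -> : s / 2 = (s - r') / 2 + r' / 2 by rewrite -mulrDl subrK.
  rewrite (@powRD _ rho) ?rn0 ?implybT// ler_wpM2r ?powR_ge0//.
  by rewrite -(powR_half _ (ltW MW)); apply: ler_pow => //; rewrite divr_ge0 ?subr_ge0 ?(ltW s_r').
apply: le_trans (ler_wpM2l sN0 (ler_pow _ _ step3)) _.
- by have /andP[/ltW] := sV.
- by apply: avg_ge0.
have C0 : 0 <= C := le_trans ler01 C1.
have CX0 : 0 <= C * (2 * (M * W)) `^ s by rewrite mulr_ge0 ?powR_ge0.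
rewrite (powRM _ CX0) ?powR_ge0// (powRM _ C0) ?powR_ge0//.
rewrite powRK ?(gt_eqF s0)// ?(ltW MW)// -powRrM.
have CC : C `^ s^-1 <= C.
  by rewrite -[leRHS]powRr1; [apply: ler_powR => //; case/andP: sV|exact: C0].
rewrite powRD; last by rewrite (gt_eqF n0) implybT.
rewrite (_ : r' / 2 / s = r' / (2 * s)); last by rewrite invfM mulrA.
rewrite powRN.
have hh : N%:R = N%:R `^ 2^-1 * N%:R `^ 2^-1 :> R by rewrite -expr2 powR_half_sqr// ltW.
have N2 : 0 < N%:R `^ 2^-1 :> R by exact: powR_gt0.
have Nr : 0 <= N%:R `^ (r' / (2 * s)) :> R by exact: powR_ge0.
apply: (@le_trans _ _ (M * N%:R `^ 2^-1 * (C * (2 * (M * W)) * N%:R `^ (r' / (2 * s))))).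
  by rewrite ler_wpM2l// ler_wpM2r// ler_wpM2r// ltW.
apply: eq_ler; rewrite [X in _ * X * (W * _)]hh.
move: N2; clear; move: (N%:R `^ (r' / _)) => u; move: (N%:R `^ _) => x x0.
by field; rewrite gt_eqF.
Qed.

(* Where no [t i b j] exceeds a threshold, each row is small by [special_small]. The other entries
   are few, and averaging [sum_i sgn_i t_i] and [sum_i sgn_i h_i] over signs there gains a power of [N]. *)
Lemma test_bound (r r' e s M eps : R) : 2 < r -> r^-1 + r'^-1 = 1 -> 1 < r' -> r' < 2 ->
  r' < e -> s = Num.min e 2 -> 1 <= M -> 0 < eps -> exists2 c, 0 < c <= 1 &
  forall N W (B J : finType) (wt : B -> R) (t h : nat -> B -> J -> K),
  (0 < N)%N -> 1 <= W ->
  (forall b, 0 <= wt b <= c) -> (forall b, wt b * N%:R <= c) ->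
  (forall i, (i < N)%N -> special r wt M (fun b j => modulus (t i b j))) ->
  (forall a : nat -> K,
    special r wt (M * W * (\sum_(0 <= i < N) modulus (a i) ^+ 2) `^ 2^-1)
      (fun b j => modulus (\sum_(0 <= i < N) t i b j * a i))) ->
  (forall i, (i < N)%N -> rademacher e M (fun b j => modulus (h i b j))) ->
  (forall a : nat -> K,
    rademacher e (M * (\sum_(0 <= i < N) modulus (a i) ^+ 2) `^ 2^-1)
      (fun b j => modulus (\sum_(0 <= i < N) h i b j * a i))) ->
  W * N%:R `^ (r' / (2 * s) - 2^-1) <= c ->
  modulus (\sum_(0 <= i < N) \sum_b \sum_j t i b j * h i b j) <= eps * N%:R.
Proof.
move=> r2 rr r'1 r'2 r'e sE M1 eps0; have M0 : 0 < M by lra.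
have eM0 : 0 < eps / (2 * M) by rewrite divr_gt0//; lra.
have [c0 /andP[c00 c01] hc0] := special_small r2 rr r'1 r'2 r'e M0 eM0.
have [C C1 hC] := peak_part r2 rr r'1 r'2 r'e sE M1.
(* Makes [wt] times the number of peaks at most 1/2; the other half of [wt * k <= 1] comes from
   [c <= 1/2]. *)
pose c1 := c0 ^+ 2 / (8 * M ^+ 2).
have M20 : 0 < M ^+ 2 by rewrite exprn_gt0.
have c020 : 0 < c0 ^+ 2 by rewrite exprn_gt0.
have c10 : 0 < c1 by rewrite divr_gt0// mulr_gt0.
have e2C : 0 < eps / (2 * C) by rewrite divr_gt0//; lra.
pose c := Num.min (Num.min c0 c1) (Num.min (1/2) (eps / (2 * C))).
have c_c0 : c <= c0 by rewrite !ge_min lexx.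
have c_c1 : c <= c1 by rewrite !ge_min lexx orbT.
have c_2 : c <= 1/2 by rewrite !ge_min lexx !orbT.
have c_e : c <= eps / (2 * C) by rewrite !ge_min lexx !orbT.
have cp : 0 < c by rewrite !lt_min c00 c10 e2C !andbT/= divr_gt0.
have c_1 : c <= 1 := le_trans c_c0 c01.
clearbody c; exists c; first by rewrite cp.
move=> N W B J wt t h N0 W1 wc wN H1' H1 H2' H2 WN.
have n0 : 0 < N%:R :> R by rewrite ltr0n.
have w01 b : 0 <= wt b <= 1 by have /andP[-> /= wb] := wc b; exact: le_trans wb c_1.
pose P b j := [exists i : 'I_N, c0 < modulus (t i b j)].
have split i : \sum_b \sum_j t i b j * h i b j =
    \sum_b \sum_(j | P b j) t i b j * h i b j + \sum_b \sum_(j | ~~ P b j) t i b j * h i b j.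
  by rewrite -big_split/=; apply: eq_bigr => b _; rewrite (bigID (P b)).
under eq_bigr do rewrite split.
rewrite big_split/=; apply: le_trans (modulusD _ _) _.
have -> : eps * N%:R = eps / 2 * N%:R + eps / 2 * N%:R by rewrite -mulrDl -splitr.
apply: lerD; last first.
  apply: le_trans (modulus_sum _ _ _) _; rewrite mulrC -[N in leRHS]subn0.
  rewrite mulr_natl -sumr_const_nat; apply: ler_sum_nat => i /andP[_ iN].
  pose y b j := if P b j then 0 else modulus (t i b j).
  have y0 b j : 0 <= y b j by rewrite /y; case: ifP => // _; exact: modulus_ge0.
  apply: (@le_trans _ _ (\sum_b \sum_j y b j * modulus (h i b j))).
    apply: le_trans (modulus_sum _ _ _) _; apply: ler_sum => b _.
    apply: le_trans (modulus_sum _ _ _) _; rewrite big_mkcond/=; apply: ler_sum => j _.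
    by rewrite /y; case: (P b j); rewrite /= ?mul0r// modulusM.
  apply: le_trans (H2' i iN y y0) _.
  have -> : eps / 2 = M * (eps / (2 * M)) by field; rewrite gt_eqF.
  rewrite ler_wpM2l ?(ltW M0)//; apply: (hc0 _ _ wt).
  - by move=> b; have /andP[-> /= wb] := wc b; exact: le_trans wb c_c0.
  - move=> b j; rewrite y0/= /y; case: ifP => [_|/negbT]; first exact: ltW.
    by rewrite negb_exists => /forallP/(_ (Ordinal iN)); rewrite -leNgt.
  - apply: special_mono (H1' i iN) => b j.
    by rewrite /y; case: ifP => // _; exact: modulus_ge0.
(* By [special_l2] each of the [N] vectors has at most [(2 M)^2 / c0^2] entries above [c0]; the
   summand 1 ensures [1 <= k]. *)
pose k := 1 + N%:R * (2 * M) ^+ 2 / c0 ^+ 2.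
have kk0 : 0 <= N%:R * (2 * M) ^+ 2 / c0 ^+ 2.
  exact: divr_ge0 (mulr_ge0 (ltW n0) (sqr_ge0 _)) (sqr_ge0 _).
have k1 : 1 <= k by rewrite lerDl.
have wk b : wt b * k <= 1.
  rewrite mulrDr mulr1; have /andP[_ wb] := wc b.
  have -> : wt b * (N%:R * (2 * M) ^+ 2 / c0 ^+ 2) = wt b * N%:R * (2 * M) ^+ 2 / c0 ^+ 2.
    by rewrite !mulrA.
  have h1 : wt b * N%:R * (2 * M) ^+ 2 / c0 ^+ 2 <= c1 * (2 * M) ^+ 2 / c0 ^+ 2.
    rewrite ler_pM2r ?invr_gt0// ler_wpM2r ?sqr_ge0//; exact: le_trans (wN b) c_c1.
  have h2 : c1 * (2 * M) ^+ 2 / c0 ^+ 2 = 1/2.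
    by rewrite /c1; field; rewrite !gt_eqF.
  by move: h1 h2 wb c_2; clear => *; lra.
have cnt b : \sum_j (P b j)%:R <= k.
  apply: (@le_trans _ _ (N%:R * (2 * M) ^+ 2 / c0 ^+ 2)); last by rewrite lerDr.
  apply: (@le_trans _ _ (\sum_(0 <= i < N) \sum_b \sum_j modulus (t i b j) ^+ 2 / c0 ^+ 2)).
    rewrite exchange_big (bigD1 b)//= exchange_big/=.
    apply: (@le_trans _ _ (\sum_j \sum_(0 <= i < N) modulus (t i b j) ^+ 2 / c0 ^+ 2)).
      apply: ler_sum => j _; case PE : (P b j); last first.
        by apply: sumr_ge0 => i _; rewrite divr_ge0 ?sqr_ge0.
      have /existsP[i ci] : [exists i : 'I_N, c0 < modulus (t i b j)] by exact: PE.
      rewrite big_mkord (bigD1 i)//=.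
      apply: (@le_trans _ _ (modulus (t i b j) ^+ 2 / c0 ^+ 2)).
        rewrite ler_pdivlMr// mul1r; apply: lerXn2r; rewrite ?nnegrE ?(ltW c00) ?modulus_ge0//.
        exact: ltW.
      by rewrite lerDl sumr_ge0// => *; rewrite divr_ge0 ?sqr_ge0.
    rewrite lerDl; apply: sumr_ge0 => b' _; apply: sumr_ge0 => i _; apply: sumr_ge0 => j _.
    by rewrite divr_ge0 ?sqr_ge0.
  rewrite -mulrA mulr_natl -[N in leRHS]subn0 -sumr_const_nat; apply: ler_sum_nat => i /andP[_ iN].
  under eq_bigr do rewrite -mulr_suml.
  rewrite -mulr_suml ler_pM2r ?invr_gt0//.
  by apply: special_l2 (ltW r2) (ltW M0) _ w01 (H1' i iN) => b' j; exact: modulus_ge0.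
have := hC N W B J wt t h P k N0 W1 k1 w01 wk cnt H1 H2.
rewrite exchange_big/=; under [in X in _ -> X]eq_bigr do rewrite exchange_big/=.
move=> hh; apply: le_trans hh _; rewrite mulrAC; apply: ler_wpM2r; first exact: ltW.
apply: (@le_trans _ _ (C * (eps / (2 * C)))).
  apply: ler_wpM2l; [exact: le_trans ler01 C1|exact: le_trans WN c_e].
have C0 : 0 < C := lt_le_trans ltr01 C1.
by apply: eq_ler; field; rewrite gt_eqF.
Qed.

Lemma sum_cauchy_schwarz N (t h : nat -> K) :
  modulus (\sum_(0 <= i < N) t i * h i) <=
  (\sum_(0 <= i < N) modulus (t i) ^+ 2) `^ 2^-1 * (\sum_(0 <= i < N) modulus (h i) ^+ 2) `^ 2^-1.
Proof.
apply: le_trans (modulus_sum _ _ _) _; under eq_bigr do rewrite modulusM.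
have E (u : nat -> K) : \sum_(0 <= i < N) modulus (u i) `^ 2 = \sum_(0 <= i < N) modulus (u i) ^+ 2.
  by apply: eq_bigr => i _; rewrite powR_mulrn ?modulus_ge0.
rewrite -!E; apply: hoelder_sum => //; first exact: conj2.
  by move=> i; exact: modulus_ge0.
by move=> i; exact: modulus_ge0.
Qed.

Lemma sum_l2_dual N (t : nat -> K) (c : R) : 0 <= c ->
  (forall a : nat -> K, modulus (\sum_(0 <= i < N) t i * a i) <=
     c * (\sum_(0 <= i < N) modulus (a i) ^+ 2) `^ 2^-1) ->
  (\sum_(0 <= i < N) modulus (t i) ^+ 2) `^ 2^-1 <= c.
Proof.
move=> c0 h; set rho := \sum_(_ <= _ < _) _.
have rho0 : 0 <= rho by apply: sumr_ge0 => *; exact: sqr_ge0.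
pose a i := phase (t i) * ofreal (modulus (t i)).
have a2 : \sum_(0 <= i < N) modulus (a i) ^+ 2 <= rho.
  apply: ler_sum => i _; rewrite modulusM modulus_ofreal ger0_norm ?modulus_ge0//.
  rewrite exprMn; apply: ler_piMl; first exact: sqr_ge0.
  by rewrite expr_le1 ?modulus_ge0// modulus_phase.
have ta : modulus (\sum_(0 <= i < N) t i * a i) = rho.
  rewrite (eq_bigr (fun i => ofreal (modulus (t i) ^+ 2))) => [|i _]; last first.
    by rewrite /a mulrA [_ * phase _]mulrC phaseM -rmorphM expr2.
  by rewrite -rmorph_sum modulus_ofreal ger0_norm.
have : rho <= c * rho `^ 2^-1.
  rewrite -{1}ta; apply: le_trans (h a) _; rewrite ler_wpM2l//.
  by apply: ler_pow => //; apply: sumr_ge0 => *; exact: sqr_ge0.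
move=> /(self_bound (_ : 0 < 2) (_ : 0 < 2) (conj2 R) rho0 c0) hh.
have := ler_pow (_ : 0 <= 2^-1) rho0 (hh _ _).
by rewrite powRK//; apply.
Qed.

End Test.

(** * Norms and operators on the sequence spaces *)

Section EllInterface.
Variables (R : realType) (K : scalarField R) (p : R) (p1 : 1 <= p).
Local Notation E := (@ell R K p p1).

Let p0 : 0 < p. Proof. exact: lt_le_trans p1. Qed.

Lemma ell_norm_powR (x : E) :
  (ell_norm x `^ p)%:E = (\sum_(k <oo) (modulus (x k) `^ p)%:E)%E.
Proof.
rewrite -poweR_EFin ell_normE ell_enormE// -poweRrM mulVf ?gt_eqF// poweRe1//.
by apply: nneseries_ge0 => *; rewrite lee_fin powR_ge0.
Qed.

Lemma ell_sum_le (x : E) n :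
  \sum_(0 <= k < n) modulus (x k) `^ p <= ell_norm x `^ p.
Proof.
rewrite -lee_fin ell_norm_powR -sumEFin; apply: nneseries_lim_ge => k _ _.
by rewrite lee_fin powR_ge0.
Qed.

Lemma ell_enorm_le (f : nat -> (Defs.scalar K)^o) M : 0 <= M ->
  (forall n, \sum_(0 <= k < n) modulus (f k) `^ p <= M `^ p) -> (ell_enorm p f <= M%:E)%E.
Proof.
move=> M0 h; rewrite ell_enormE//.
have -> : M%:E = ((M `^ p)%:E `^ p^-1)%E.
  by rewrite poweR_EFin -powRrM mulfV ?gt_eqF// powRr1.
apply: ge0_lee_poweR; first by rewrite invr_ge0 ltW.
  by apply: nneseries_ge0 => *; rewrite lee_fin powR_ge0.
apply: lime_le; first by apply: is_cvg_nneseries => *; rewrite lee_fin powR_ge0.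
by apply: nearW => n; rewrite sumEFin lee_fin.
Qed.

Lemma ell_norm_le (x : E) M : 0 <= M ->
  (forall n, \sum_(0 <= k < n) modulus (x k) `^ p <= M `^ p) -> ell_norm x <= M.
Proof. by move=> M0 h; rewrite -lee_fin ell_normE; exact: ell_enorm_le. Qed.

Lemma ell_predI (f : nat -> (Defs.scalar K)^o) M : 0 <= M ->
  (forall n, \sum_(0 <= k < n) modulus (f k) `^ p <= M `^ p) -> f \in @ell_pred R K p.
Proof. by move=> M0 h; rewrite unfold_in; apply: le_lt_trans (ell_enorm_le M0 h) (ltry _). Qed.

Lemma ell_inj_sum_le (x : E) (T : finType) (f : T -> nat) : injective f ->
  \sum_t modulus (x (f t)) `^ p <= ell_norm x `^ p.
Proof.
move=> fI; pose F k := modulus (x k) `^ p.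
pose n := (\max_t f t).+1.
have fn t : (f t < n)%N by rewrite ltnS; exact: leq_bigmax.
apply: le_trans (ell_sum_le x n); rewrite -/(F _) big_mkord.
have -> : \sum_t modulus (x (f t)) `^ p = \sum_t \sum_(k < n) (if k == Ordinal (fn t) then F k else 0).
  by apply: eq_bigr => t _; rewrite -big_mkcond big_pred1_eq.
rewrite exchange_big/=; apply: ler_sum => k _.
have F0 : 0 <= F k by exact: powR_ge0.
rewrite -big_mkcond/=; have [/existsP[t /eqP tk]|/existsPn h] := boolP [exists t, k == Ordinal (fn t)].
  rewrite (big_pred1 t) => [|t'] //; rewrite tk -val_eqE /= (inj_eq fI).
  by rewrite eq_sym.
by rewrite big1// => t kt; have := h t; rewrite kt.
Qed.

Lemma ell_sum_approx (x : E) (eps : R) : 0 < eps ->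
  exists n, ell_norm x `^ p - eps < \sum_(0 <= k < n) modulus (x k) `^ p.
Proof.
move=> e0; apply: contrapT => /forallNP h.
have S0 n : 0 <= \sum_(0 <= k < n) modulus (x k) `^ p.
  by apply: sumr_ge0 => *; exact: powR_ge0.
have hle n : \sum_(0 <= k < n) modulus (x k) `^ p <= ell_norm x `^ p - eps.
  by rewrite leNgt; apply/negP; exact: h.
have d0 : 0 <= ell_norm x `^ p - eps by exact: le_trans (S0 0%N) (hle 0%N).
have : ell_norm x <= (ell_norm x `^ p - eps) `^ p^-1.
  by apply: ell_norm_le => [|n]; rewrite ?powR_ge0// powRVK ?gt_eqF.
move=> /(ler_pow (ltW p0) (ell_norm_ge0 x)); rewrite powRVK ?gt_eqF//.
lra.
Qed.

(** Stated for vectors that at each coordinate agree with [x] or vanish, because what remains after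
    removing finitely many levels is not a tail of the enumeration of coordinates. *)
Lemma ell_tail (x : E) (eps : R) : 0 < eps -> exists n, forall y : E,
  (forall k, (k < n)%N -> y k = 0) -> (forall k, y k = x k \/ y k = 0) -> ell_norm y <= eps.
Proof.
move=> e0; have ep : 0 < eps `^ p by exact: powR_gt0.
have [n hn] := ell_sum_approx x ep; exists n => y yn yx.
apply: ell_norm_le => [|m]; first exact: ltW.
have y0 k : 0 <= modulus (y k) `^ p by exact: powR_ge0.
have x0 k : 0 <= modulus (x k) `^ p by exact: powR_ge0.
apply: (@le_trans _ _ (\sum_(0 <= k < maxn n m) modulus (y k) `^ p)).
  rewrite [leRHS](@big_cat_nat _ _ _ m)//= ?leq_maxr// lerDl.
  exact: sumr_ge0.
have y00 : \sum_(0 <= k < n) modulus (y k) `^ p = 0.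
  by rewrite big_nat big1// => k /andP[_ kn]; rewrite yn// modulus0 powR0// gt_eqF.
have := ell_sum_le x (maxn n m).
rewrite (@big_cat_nat _ _ _ n)//= ?leq_maxl//.
rewrite [X in _ -> X <= _](@big_cat_nat _ _ _ n)//= ?leq_maxl//.
rewrite y00 add0r.
have : \sum_(n <= k < maxn n m) modulus (y k) `^ p <= \sum_(n <= k < maxn n m) modulus (x k) `^ p.
  by apply: ler_sum => k _; have [->//|->] := yx k; rewrite modulus0 powR0 ?gt_eqF.
by lra.
Qed.

Lemma ell_norm0 : ell_norm (0 : E) = 0.
Proof. by rewrite -(scale0r (0 : E)) ell_normZ modulus0 mul0r. Qed.

Lemma ell_norm_sum (I : Type) (s : seq I) (P : pred I) (F : I -> E) :
  ell_norm (\sum_(i <- s | P i) F i) <= \sum_(i <- s | P i) ell_norm (F i).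
Proof.
elim/big_rec2 : _ => [|i y x _ xy]; first by rewrite ell_norm0.
by apply: le_trans (ell_normD _ _) _; rewrite lerD2l.
Qed.

Lemma ellD (x y : E) k : (x + y) k = x k + y k. Proof. by []. Qed.

Lemma ellB (x y : E) k : (x - y) k = x k - y k. Proof. by []. Qed.

Lemma ellZ a (x : E) k : (a *: x) k = a * x k. Proof. by []. Qed.

Lemma ell_sumE (I : Type) (s : seq I) (P : pred I) (F : I -> E) k :
  (\sum_(i <- s | P i) F i) k = \sum_(i <- s | P i) F i k.
Proof. by elim/big_rec2 : _ => // i y x _ <-; rewrite ellD. Qed.

End EllInterface.

Section BopInterface.
Variables (R : realType) (K : scalarField R) (p q : R) (p1 : 1 <= p) (q1 : 1 <= q).

Lemma bop_norm_le (T : bop (ell K p1) (ell K q1)) x : ell_norm (T x) <= opnorm T * ell_norm x.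
Proof.
by rewrite -(ler_ofreal K) rmorphM/= -!norm_ellE; exact: norm_le_opnorm.
Qed.

Lemma bop_exists (f : ell K p1 -> ell K q1) (C : R) :
  (forall a x y, f (a *: x + y) = a *: f x + f y) ->
  (forall x, ell_norm (f x) <= C * ell_norm x) ->
  f \in bop_pred (ell K p1) (ell K q1).
Proof.
move=> fl fC; apply/asboolP; split; first exact: fl.
by exists (ofreal C) => x; rewrite !norm_ellE -rmorphM ler_ofreal.
Qed.

End BopInterface.

(** * Controlled operators and finite strict singularity *)

Section Controlled.
Variables (R : realType) (K : scalarField R) (p q : R) (p1 : 1 <= p) (q1 : 1 <= q).
Local Notation X := (@ell R K p p1).
Local Notation Y := (@ell R K q q1).

(* A family of functionals mapping balls of [X] uniformly into [c_0]. *)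
Record null_family (I : eqType) (b : I -> X -> K) : Prop := NullFamily {
  null_linear : forall k a x y, b k (a *: x + y) = a * b k x + b k y;
  null_bounded : exists2 C, 0 <= C & forall k x, modulus (b k x) <= C * ell_norm x;
  null_count : forall r : R, exists n : nat, forall x (s : seq I), uniq s -> ell_norm x <= r ->
    (forall k, k \in s -> 1 <= modulus (b k x)) -> (size s <= n)%N }.

(* These operators form a closed ideal containing the formal inclusion, and they are finitely strictly
   singular because a subspace of large dimension contains a vector [x] with many coordinates [b k x]
   close to their supremum. *)
Definition controlled (T : X -> Y) := forall eps : R, 0 < eps ->
  exists (I : eqType) (b : I -> X -> K), null_family b /\
    exists2 D, 0 <= D & forall x c, 0 <= c -> (forall k, modulus (b k x) <= c) ->
      ell_norm (T x) <= eps * ell_norm x + D * c.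

Lemma functional_linear (f : X -> K) : (forall a x y, f (a *: x + y) = a * f x + f y) ->
  [/\ f 0 = 0, forall a x, f (a *: x) = a * f x & forall x y, f (x + y) = f x + f y].
Proof.
move=> fl; have f0 : f 0 = 0.
  have := fl (-1) 0 0; rewrite scaler0 addr0 mulN1r => /eqP.
  by rewrite eq_sym addNr => /eqP<-.
split=> // [a x|x y]; first by rewrite -[a *: x]addr0 fl f0 addr0.
by rewrite -[x]scale1r fl mul1r scale1r.
Qed.

Lemma null_familyU (I1 I2 : eqType) (b1 : I1 -> X -> K) (b2 : I2 -> X -> K) :
  null_family b1 -> null_family b2 ->
  null_family (fun k : I1 + I2 => match k with inl i => b1 i | inr i => b2 i end).
Proof.
move=> [l1 [C1 C10 h1] c1] [l2 [C2 C20 h2] c2]; split.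
- by case.
- exists (C1 + C2) => [|[k|k] x]; first exact: addr_ge0.
    by apply: le_trans (h1 k x) _; rewrite ler_wpM2r ?ell_norm_ge0// lerDl.
  by apply: le_trans (h2 k x) _; rewrite ler_wpM2r ?ell_norm_ge0// lerDr.
- move=> r; have [n1 hn1] := c1 r; have [n2 hn2] := c2 r.
  exists (n1 + n2)%N => x s us xr hs.
  pose s1 := pmap (fun k : I1 + I2 => if k is inl i then Some i else None) s.
  pose s2 := pmap (fun k : I1 + I2 => if k is inr i then Some i else None) s.
  have -> : size s = (size s1 + size s2)%N.
    by rewrite /s1 /s2; elim: (s) => //= -[i|i] t /= ->; rewrite ?addnS ?addSn.
  have m1 i : (i \in s1) = (inl i \in s).
    rewrite /s1 mem_pmap; apply/mapP/idP => [[[j|j] js //= [->]] //|js].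
    by exists (inl i).
  have m2 i : (i \in s2) = (inr i \in s).
    rewrite /s2 mem_pmap; apply/mapP/idP => [[[j|j] js //= [->]] //|js].
    by exists (inr i).
  apply: leq_add.
    apply: (hn1 x) => // [|k]; last by rewrite m1 => /hs.
    by apply: (pmap_uniq (g := inl)) => // -[].
  apply: (hn2 x) => // [|k]; last by rewrite m2 => /hs.
  by apply: (pmap_uniq (g := inr)) => // -[].
Qed.

Lemma controlledD (a : K) (S T : bop X Y) : controlled S -> controlled T ->
  controlled (a *: S + T).
Proof.
move=> hS hT eps e0; have ma0 := modulus_ge0 a.
have e1 : 0 < eps / (2 * (modulus a + 1)) by rewrite divr_gt0//; lra.
have e2 : 0 < eps / 2 by rewrite divr_gt0.
have [I1 [b1 [n1 [D1 D10 h1]]]] := hS _ e1.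
have [I2 [b2 [n2 [D2 D20 h2]]]] := hT _ e2.
exists (I1 + I2)%type, (fun k => match k with inl i => b1 i | inr i => b2 i end).
split; first exact: null_familyU.
exists (modulus a * D1 + D2) => [|x c c0 hc]; first by rewrite addr_ge0// mulr_ge0.
have -> : (a *: S + T) x = a *: S x + T x by [].
apply: le_trans (ell_normD _ _) _; rewrite ell_normZ.
have := h1 x c c0 (fun k => hc (inl k)); have := h2 x c c0 (fun k => hc (inr k)).
move=> {}h2 /(ler_wpM2l ma0) {}h1; have x0 := ell_norm_ge0 x.
have : modulus a * (eps / (2 * (modulus a + 1))) * ell_norm x <= eps / 2 * ell_norm x.
  rewrite ler_wpM2r// mulrA ler_pdivrMr; last by lra.
  by rewrite mulrA divfK//; nra.
by rewrite mulrDr mulrA in h1; lra.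
Qed.

Lemma controlled_comp (A : bop Y Y) (T : bop X Y) (B : bop X X) : controlled T ->
  controlled (bcomp A (bcomp T B)).
Proof.
move=> hT eps e0; set nA := opnorm A; set nB := opnorm B.
have nA0 : 0 <= nA by exact: opnorm_ge0.
have nB0 : 0 <= nB by exact: opnorm_ge0.
have d0 : 0 < nA * nB + 1 by rewrite ltr_wpDl// mulr_ge0.
have e1 : 0 < eps / (nA * nB + 1) by rewrite divr_gt0.
have [I [b [[bl [C C0 bC] bc] [D D0 h]]]] := hT _ e1.
exists I, (fun k x => b k (B x)); split.
  split=> [k a x y||r].
  - by rewrite linearP bl.
  - exists (C * nB) => [|k x]; first exact: mulr_ge0.
    by apply: le_trans (bC _ _) _; rewrite -mulrA ler_wpM2l// bop_norm_le.
  - have [n hn] := bc (nB * `|r|); exists n => x s us xr hs; apply: (hn (B x)) => //.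
    apply: le_trans (bop_norm_le _ _) _; rewrite ler_wpM2l//.
    by apply: le_trans xr _; exact: ler_norm.
exists (nA * D) => [|x c c0 hc]; first exact: mulr_ge0.
have -> : bcomp A (bcomp T B) x = A (T (B x)) by [].
apply: le_trans (bop_norm_le _ _) _; rewrite -/nA.
apply: le_trans (ler_wpM2l nA0 (h (B x) c c0 hc)) _.
rewrite mulrDr -(mulrA nA D c) lerD2r mulrA.
apply: le_trans (ler_wpM2l _ (bop_norm_le B x)) _; first by rewrite mulr_ge0// ltW.
rewrite -/nB mulrA; apply: ler_wpM2r; first exact: ell_norm_ge0.
have -> : nA * (eps / (nA * nB + 1)) * nB = eps * (nA * nB / (nA * nB + 1)) by ring.
rewrite -[leRHS]mulr1 ler_wpM2l ?(ltW e0)// ler_pdivrMr// mul1r lerDl.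
exact: ler01.
Qed.

Lemma controlled_closed (T : bop X Y) :
  (forall eps, 0 < eps -> exists2 S : bop X Y, controlled S & opnorm (T - S) <= eps) ->
  controlled T.
Proof.
move=> h eps e0; have e2 : 0 < eps / 2 by rewrite divr_gt0.
have [S hS TS] := h _ e2; have [I [b [nb [D D0 hb]]]] := hS _ e2.
exists I, b; split=> //; exists D => // x c c0 hc.
have -> : T x = (T - S) x + S x.
  by rewrite -[(T - S) x]/(T x - S x) subrK.
apply: le_trans (ell_normD _ _) _.
have := le_trans (bop_norm_le (T - S) x) (ler_wpM2r (ell_norm_ge0 x) TS).
by have := hb x c c0 hc; lra.
Qed.

Lemma finite_support_list (I : eqType) (P : I -> Prop) n :
  (forall s, uniq s -> (forall k, k \in s -> P k) -> (size s <= n)%N) ->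
  exists s, uniq s /\ forall k, k \in s <-> P k.
Proof.
elim: n P => [|n IH] P h.
  exists [::]; split=> // k; split=> // Pk.
  by have : (size [:: k] <= 0)%N by apply: h => // j; rewrite inE => /eqP->.
have [[k Pk]|nP] := pselect (exists k, P k); last first.
  by exists [::]; split=> // k; split=> // Pk; case: nP; exists k.
have [s [us hs]] : exists s, uniq s /\ forall j, j \in s <-> (P j /\ j != k).
  apply: IH => s us hs.
  have kn : k \notin s by apply/negP => /hs[_]; rewrite eqxx.
  have := h (k :: s); rewrite /= kn us ltnS; apply=> // j.
  by rewrite inE => /predU1P[->|/hs[]].
have kn : k \notin s by apply/negP => /hs[_]; rewrite eqxx.
exists (k :: s); split=> [|j]; first by rewrite /= kn.
rewrite inE; split=> [/predU1P[->|/hs[]]//|Pj].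
by have [//|jk] := eqVneq j k; apply/hs.
Qed.

Lemma exists_annihilated N (v : 'I_N -> X) (I : eqType) (b : I -> X -> K) (s : seq I) :
  lin_indep v -> (forall k a x y, b k (a *: x + y) = a * b k x + b k y) -> (size s < N)%N ->
  exists a : 'I_N -> K, \sum_(i < N) a i *: v i != 0 /\
    forall k, k \in s -> b k (\sum_(i < N) a i *: v i) = 0.
Proof.
move=> vi bl sN.
have b0 k : b k 0 = 0 by have [] := functional_linear (bl k).
have bsum k (a : 'I_N -> K) : b k (\sum_(i < N) a i *: v i) = \sum_(i < N) a i * b k (v i).
  elim/big_rec2 : _ => [|i y x _ <-]; first exact: b0.
  by rewrite bl.
pose A : 'M[K]_(N, size s) := \matrix_(i, l) b (tnth (in_tuple s) l) (v i).
have kA : kermx A != 0.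
  rewrite kermx_eq0 /row_free neq_ltn (leq_ltn_trans _ sN)//.
  exact: rank_leq_col.
have /rowV0Pn[u /sub_kermxP uA u0] := kA.
exists (fun i => u 0 i); split.
  apply: contra u0 => /eqP/vi ui; apply/eqP/rowP => i; rewrite mxE.
  exact: ui.
move=> k ks; rewrite bsum.
have [l kl] : exists l, k = tnth (in_tuple s) l by apply/tnthP.
have := congr1 (fun M : 'rV_(size s) => M 0 l) uA; rewrite !mxE => uAl.
by rewrite -[RHS]uAl; apply: eq_bigr => i _; rewrite mxE -kl.
Qed.

(** Induction on [j]. While the set [s] of peaks has fewer than [N] elements, some nonzero [y] in
    [F] is annihilated by the functionals of [s]; adding a multiple of [y] with a suitable sign
    keeps the old peaks and creates a new one at [k0]. *)
Lemma flat_vector N (F : set X) (I : eqType) (b : I -> X -> K) : null_family b ->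
  Defs.subspace F -> dim_ge N F -> forall j, (j <= N)%N ->
  (exists2 y, F y & y != 0 /\ forall k, b k y = 0) \/
  exists2 x, F x & (forall k, modulus (b k x) <= 1) /\
    exists2 s, uniq s /\ (forall k, k \in s <-> 1/4 <= modulus (b k x)) & (j <= size s)%N.
Proof.
move=> [bl [C C0 bC] bc] [F0 FD] [v [vi Fv]].
have b0 k : b k 0 = 0 by have [] := functional_linear (bl k).
have bZ k a x : b k (a *: x) = a * b k x by have [] := functional_linear (bl k).
have bD k x y : b k (x + y) = b k x + b k y by have [] := functional_linear (bl k).
have Fsum (a : 'I_N -> K) : F (\sum_(i < N) a i *: v i).
  elim/big_rec : _ => // i x _ Fx; exact: FD.
have supp x : exists s, uniq s /\ forall k, k \in s <-> 1/4 <= modulus (b k x).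
  have [n hn] := bc (4 * ell_norm x).
  apply: (@finite_support_list _ _ n) => s us hs.
  have m4 : modulus (ofreal 4 : K) = 4 by rewrite modulus_ofreal ger0_norm.
  apply: (hn (ofreal 4 *: x)) => // [|k ks]; first by rewrite ell_normZ m4.
  by rewrite bZ modulusM m4; have := hs k ks; lra.
elim=> [_|j IH jN].
  right; exists 0 => //; split=> [k|]; first by rewrite b0 modulus0.
  by have [s hs] := supp 0; exists s.
case: (IH (ltnW jN)) => [|[x Fx [bx1 [s [us hs] js]]]]; first by left.
have [sj|sj] := ltnP j (size s); first by right; exists x => //; split=> //; exists s.
have sN : (size s < N)%N by exact: leq_ltn_trans jN.
have [a [y0 ys]] := exists_annihilated vi bl sN.
set y := \sum_(i < N) a i *: v i in y0 ys.
have Fy : F y by exact: Fsum.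
have [by0|/existsNP[k1 /eqP k1y]] := pselect (forall k, b k y = 0).
  by left; exists y.
pose A : set R := [set modulus (b k y) | k in [set: I]].
have supA : has_sup A.
  split; first by exists (modulus (b k1 y)); exists k1.
  by exists (C * ell_norm y) => _ [k _ <-].
have Ale k : modulus (b k y) <= sup A by apply: ub_le_sup; [exact: supA.2|exists k].
have A0 : 0 < sup A.
  apply: lt_le_trans (Ale k1); rewrite lt_neqAle modulus_ge0 andbT eq_sym.
  by apply: contra k1y => /eqP/modulus_eq0->.
have [_ [k0 _ <-] k0y] := sup_adherent (divr_gt0 A0 (ltr0n _ 2)) supA.
(* Scaled to supremum 3/4, [y] preserves the bound 1 off [s], where [x] stays below 1/4. At [k0] the
   scaled value exceeds 3/8, so the values for the two signs have moduli adding up to more than 3/4,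
   and one of them is at least 1/4. *)
pose l : R := 3/4 / sup A.
have l0 : 0 < l by rewrite divr_gt0//; lra.
have ml : modulus (ofreal l : K) = l by rewrite modulus_ofreal gtr0_norm.
have bl1 k : modulus (ofreal l * b k y) <= 3/4.
  by rewrite modulusM ml /l mulrAC ler_pdivrMr// ler_wpM2l//; lra.
have bl0 : 3/8 < modulus (ofreal l * b k0 y).
  rewrite modulusM ml /l mulrAC ltr_pdivlMr//; lra.
have k0s : k0 \notin s.
  by apply/negP => /ys k0y0; move: bl0; rewrite k0y0 mulr0 modulus0; lra.
have done_ z : F z -> (forall k, k \in s -> b k z = b k x) ->
    (forall k, k \notin s -> modulus (b k z) <= 1) -> 1/4 <= modulus (b k0 z) ->
    exists2 x, F x & (forall k, modulus (b k x) <= 1) /\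
    exists2 s, uniq s /\ (forall k, k \in s <-> 1/4 <= modulus (b k x)) & (j < size s)%N.
  move=> Fz zs zn zk; exists z => //; split=> [k|].
    by have [ks|/zn//] := boolP (k \in s); rewrite zs.
  have [s' [us' hs']] := supp z; exists s' => //.
  apply: (@leq_trans (size (k0 :: s))); first by rewrite /= ltnS.
  apply: uniq_leq_size; first by rewrite /= k0s.
  move=> k; rewrite inE => /predU1P[->|ks]; apply/hs' => //.
  by rewrite zs//; apply/hs.
have off k : k \notin s -> modulus (b k x) + modulus (ofreal l * b k y) <= 1.
  move=> ks; have := bl1 k; suff : modulus (b k x) < 1/4 by lra.
  by rewrite ltNge; apply: contra ks => /hs.
right; have : 2 * modulus (ofreal l * b k0 y) <=
    modulus (b k0 x + ofreal l * b k0 y) + modulus (b k0 x - ofreal l * b k0 y).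
  apply: le_trans (modulusB _ _).
  have -> : b k0 x + ofreal l * b k0 y - (b k0 x - ofreal l * b k0 y) =
      ofreal 2 * (ofreal l * b k0 y) by rewrite rmorph_nat; ring.
  by rewrite (modulusM (ofreal 2)) modulus_ofreal ger0_norm.
move=> h2; have [h3|h3] := leP (1/4) (modulus (b k0 x + ofreal l * b k0 y)).
  apply: (done_ (x + ofreal l *: y)).
  - by rewrite addrC; exact: FD.
  - by move=> k ks; rewrite bD bZ (ys k ks) mulr0 addr0.
  - by move=> k ks; rewrite bD bZ; apply: le_trans (modulusD _ _) (off k ks).
  - by rewrite bD bZ.
apply: (done_ (x + - ofreal l *: y)).
- by rewrite addrC; exact: FD.
- by move=> k ks; rewrite bD bZ (ys k ks) mulr0 addr0.
- by move=> k ks; rewrite bD bZ mulNr; apply: le_trans (modulusB _ _) (off k ks).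
- by rewrite bD bZ mulNr; lra.
Qed.

Lemma controlled_FS (T : bop X Y) : controlled T -> FS X Y T.
Proof.
move=> hT eps e0.
have epsE : eps = ofreal (modulus eps) by rewrite ofreal_modulus gtr0_norm.
set r := modulus eps in epsE.
have r0 : 0 < r by rewrite lt_neqAle eq_sym modulus_ge0 andbT; apply: contraTneq e0;
  rewrite -/r epsE => ->; rewrite rmorph0 ltxx.
have r4 : 0 < r / 4 by rewrite divr_gt0.
have [I [b [nb [D D0 h]]]] := hT _ r4.
(* More than [n] peaks of height 1/4 force [4 x] to have norm above [Q], so that [D] is less than a
   quarter of [r] times the norm of [x]. *)
pose Q := 16 * (D + 1) / r.
have Q0 : 0 < Q by rewrite divr_gt0//; lra.
have [bl [C C0 bC] bc] := nb; have [n hn] := bc Q.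
have ltN x : ell_norm (T x) < r * ell_norm x -> `|T x| < eps * `|x|.
  rewrite !norm_ellE epsE -rmorphM !lt_def !ler_ofreal => /andP[ne ->].
  by rewrite andbT; apply: contra ne => /eqP/ofreal_inj->.
exists n.+1 => F sF dF.
case: (flat_vector nb sF dF (leqnn _)) => [[y Fy [y0 by0]]|[x Fx [bx1 [s [us hs] ns]]]].
  exists y => //; apply: ltN.
  have yp : 0 < ell_norm y.
    rewrite lt_neqAle eq_sym ell_norm_ge0 andbT; apply: contra y0 => /eqP.
    by move=> /ell_norm0_eq0->.
  have := h y 0 (lexx _) (fun k => _); rewrite mulr0 addr0 => hy.
  apply: le_lt_trans (hy _) _ => [k|]; first by rewrite by0 modulus0.
  by rewrite ltr_pM2r//; lra.
exists x => //; apply: ltN.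
have m4 : modulus (ofreal 4 : K) = 4 by rewrite modulus_ofreal ger0_norm.
have xQ : Q < 4 * ell_norm x.
  rewrite ltNge; apply/negP => xQ; move: ns; rewrite ltnNge => /negP; apply.
  apply: (hn (ofreal 4 *: x)) => // [|k ks]; first by rewrite ell_normZ m4.
  have [_ bZ _] := functional_linear (bl k).
  by rewrite bZ modulusM m4; have := (hs k).1 ks; lra.
apply: le_lt_trans (h x 1 ler01 bx1) _; rewrite mulr1.
have : Q * r = 16 * (D + 1) by rewrite /Q divfK// gt_eqF.
by nra.
Qed.

End Controlled.

(** * Monotonicity of gauges, and duality on the sign side *)

Section MoreGauges.
Variables (R : realType).

Lemma sqsum_mono (B J : finType) (y y' : B -> J -> R) b : (forall b j, 0 <= y b j <= y' b j) ->
  sqsum y b <= sqsum y' b.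
Proof.
move=> yy; apply: ler_sum => j _; have /andP[y0 yy'] := yy b j.
by apply: lerXn2r => //; rewrite nnegrE// (le_trans y0).
Qed.

Lemma gauge_r_mono (B J : finType) (e : R) (y y' : B -> J -> R) : 0 <= e ->
  (forall b j, 0 <= y b j <= y' b j) -> gauge_r e y <= gauge_r e y'.
Proof.
move=> e0 yy; apply: ler_sum => b _; apply: ler_pow; rewrite ?sqsum_ge0 ?sqsum_mono//.
by rewrite divr_ge0.
Qed.

Lemma gauge_s_mono (B J : finType) (r : R) wt (y y' : B -> J -> R) : 0 <= r ->
  (forall b j, 0 <= y b j <= y' b j) -> gauge_s r wt y <= gauge_s r wt y'.
Proof.
move=> r0 yy; apply: ler_sum => b _; apply: lerD.
  by apply: ler_sum => j _; have /andP[y0 yy'] := yy b j; apply: ler_pow.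
rewrite ler_wpM2l ?powR_ge0//; apply: ler_pow; rewrite ?sqsum_ge0 ?sqsum_mono//.
by rewrite divr_ge0.
Qed.

Section Rademacher.
Variables (B J : finType) (e e' M : R) (tau : B -> J -> R).
Hypotheses (e1 : 1 < e) (e'1 : 1 < e') (ee : e^-1 + e'^-1 = 1) (M0 : 0 <= M).
Hypothesis t0 : forall b j, 0 <= tau b j.

(** The counterpart of [special_sum_block], with the same extremal vector: the dual of the l_e sum
    of l_2 spaces is their l_(e') sum. *)
Lemma rademacher_sum_block : rademacher e M tau ->
  \sum_b sqsum tau b `^ (e' / 2) <= M `^ e'.
Proof.
have [e_1 e'_1] := (e1, e'1).
have e0 : 0 < e by lra.
have e'0 : 0 < e' by lra.
move=> h; set Q := \sum_b _.
have Q0 : 0 <= Q by apply: sumr_ge0 => *; exact: powR_ge0.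
apply: (self_bound e0 e'0 ee) => //.
pose y b j := tau b j * sqsum tau b `^ ((e' - 2) / 2).
have y0 b j : 0 <= y b j by rewrite mulr_ge0 ?powR_ge0.
have QE : \sum_b \sum_j y b j * tau b j = Q.
  apply: eq_bigr => b _; under eq_bigr do rewrite /y mulrAC -expr2.
  rewrite -mulr_suml -/(sqsum tau b); have [->|q0] := eqVneq (sqsum tau b) 0.
    by rewrite mul0r powR0// gt_eqF//; lra.
  rewrite -{1}[sqsum tau b]powRr1 ?sqsum_ge0// -powRD ?q0 ?implybT//.
  by congr (_ `^ _); lra.
have yn b : sqsum y b = sqsum tau b `^ (e' - 1).
  rewrite /sqsum; under eq_bigr do rewrite /y exprMn.
  rewrite -mulr_suml -/(sqsum tau b); have [->|q0] := eqVneq (sqsum tau b) 0.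
    by rewrite mul0r powR0// gt_eqF//; lra.
  rewrite -(powR_mulrn 2 (powR_ge0 _ _)) -powRrM.
  rewrite -{1}[sqsum tau b]powRr1 ?sqsum_ge0// -powRD ?q0 ?implybT//.
  by congr (_ `^ _); lra.
have gE : gauge_r e y = Q.
  apply: eq_bigr => b _; rewrite yn -powRrM; congr (_ `^ _).
  rewrite mulrA; congr (_ / _).
  have : e * e' * (e^-1 + e'^-1) = e * e' by rewrite ee mulr1.
  rewrite mulrDr mulrAC mulfV ?gt_eqF// mul1r -mulrA mulfV ?gt_eqF// mulr1.
  by move=> E; rewrite mulrBl mul1r mulrC -E addrK.
by have := h y y0; rewrite QE gE.
Qed.

End Rademacher.

(** The mirror image of [special_small], for Rosenthal blocks in the range. Small entries gain
    [c ^ (r - e')] in the l_r part of the gauge, and in its l_2 part the weights themselves are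
    small. *)
Lemma rademacher_small (e e' r M eps : R) : 1 < e -> 2 <= e' -> e^-1 + e'^-1 = 1 ->
  e' < r -> 0 < M -> 0 < eps ->
  exists2 c, 0 < c <= 1 & forall (B J : finType) wt (tau : B -> J -> R),
    (forall b, 0 <= wt b <= c) -> (forall b j, 0 <= tau b j <= c) ->
    rademacher e M tau -> gauge_s r wt tau `^ r^-1 <= eps.
Proof.
move=> e1 e'2 ee e'r M0 eps0; have r0 : 0 < r by lra.
have e'1 : 1 < e' by lra.
have e'0 : 0 < e' by lra.
have re0 : 0 < r - e' by lra.
have eps_r : 0 < eps `^ r / 2 by rewrite divr_gt0// powR_gt0.
have Me : 0 < M `^ e' by exact: powR_gt0.
have Mr : 0 < M `^ r by exact: powR_gt0.
have [c1 c10 h1] := small_pow re0 eps_r Me.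
have [c2 c20 h2] := small_pow r0 eps_r Mr.
pose c := Num.min 1 (Num.min c1 c2).
have c0 : 0 < c by rewrite !lt_min ltr01 c10 c20.
have c_1 : c <= 1 by rewrite ge_min lexx.
have c_c1 : c <= c1 by rewrite !ge_min lexx orbT.
have c_c2 : c <= c2 by rewrite !ge_min lexx !orbT.
clearbody c; exists c; first by rewrite c0.
move=> B J wt tau wc tc h.
have t0 b j : 0 <= tau b j by have /andP[] := tc b j.
have hQ := rademacher_sum_block e1 e'1 ee (ltW M0) t0 h.
have q0 := sqsum_ge0 tau.
rewrite -[leRHS](powRK (_ : r != 0)) ?(ltW eps0) ?gt_eqF//.
apply: ler_pow; rewrite ?gauge_s_ge0 ?invr_ge0 ?(ltW r0)//.
rewrite [leRHS]splitr.
rewrite /gauge_s big_split/=; apply: lerD.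
  apply: le_trans h1; apply: (@le_trans _ _ (\sum_b c `^ (r - e') * sqsum tau b `^ (e' / 2))); last first.
    rewrite -mulr_sumr mulrC; apply: ler_pM => //; rewrite ?powR_ge0//.
      by apply: sumr_ge0 => *; exact: powR_ge0.
    by apply: ler_pow => //; exact: ltW.
  apply: ler_sum => b _; apply: (@le_trans _ _ (c `^ (r - e') * \sum_j (tau b j ^+ 2) `^ (e' / 2))).
    rewrite mulr_sumr; apply: ler_sum => j _; rewrite powR_half//.
    have [->|tj] := eqVneq (tau b j) 0; first by rewrite !powR0 ?mulr0// gt_eqF.
    rewrite -{1}(subrK e' r) (@powRD _ (tau b j)); last by rewrite tj implybT.
    rewrite ler_wpM2r ?powR_ge0//; apply: ler_pow => //; first exact: ltW.
    by have /andP[] := tc b j.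
  rewrite ler_wpM2l ?powR_ge0//; apply: powR_sum_ge => [|j]; [lra|exact: sqr_ge0].
apply: le_trans h2; rewrite [leRHS]mulrC; apply: (@le_trans _ _ (\sum_b c2 `^ r * sqsum tau b `^ (r / 2))).
  apply: ler_sum => b _; rewrite ler_wpM2r ?powR_ge0//.
  by have /andP[wb0 wb] := wc b; apply: ler_pow => //; [exact: ltW|exact: le_trans wb c_c2].
rewrite -mulr_sumr ler_wpM2l ?powR_ge0//.
have re : 1 <= r / e' by rewrite ler_pdivlMr ?mul1r ?ltW.
apply: (@le_trans _ _ ((\sum_b sqsum tau b `^ (e' / 2)) `^ (r / e'))).
  apply: le_trans (powR_sum_ge _ _ re (fun b => powR_ge0 _ _)).
  apply: ler_sum => b _; rewrite -powRrM; apply: eq_ler; congr (_ `^ _).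
  by field; rewrite gt_eqF.
have -> : M `^ r = (M `^ e') `^ (r / e').
  by rewrite -powRrM mulrCA mulfV ?mulr1// gt_eqF.
by apply: ler_pow => //; [lra|apply: sumr_ge0 => *; exact: powR_ge0].
Qed.

Section Phases.
Variables (K : scalarField R) (B J : finType).

(** The phases of [t] are absorbed into the coefficients, which leaves a statement on moduli as in
    [special] and [rademacher]. *)
Lemma phase_bound (G : (B -> J -> R) -> R) (M : R) (t : B -> J -> K) : 0 <= M ->
  (forall y y' : B -> J -> R, (forall b j, 0 <= y b j <= y' b j) -> G y <= G y') ->
  (forall z : B -> J -> K, modulus (\sum_b \sum_j z b j * t b j) <= M * G (fun b j => modulus (z b j))) ->
  forall y, (forall b j, 0 <= y b j) -> \sum_b \sum_j y b j * modulus (t b j) <= M * G y.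
Proof.
move=> M0 Gm h y y0; pose z b j := ofreal (y b j) * phase (t b j) : K.
have := h z; have -> : \sum_b \sum_j z b j * t b j = ofreal (\sum_b \sum_j y b j * modulus (t b j)).
  rewrite rmorph_sum; apply: eq_bigr => b _; rewrite rmorph_sum; apply: eq_bigr => j _.
  by rewrite /z -mulrA phaseM rmorphM.
rewrite modulus_ofreal ger0_norm; last first.
  by apply: sumr_ge0 => b _; apply: sumr_ge0 => j _; rewrite mulr_ge0 ?modulus_ge0.
move=> hz; apply: le_trans hz _; rewrite ler_wpM2l//; apply: Gm => b j.
rewrite modulus_ge0/= modulusM modulus_ofreal ger0_norm//.
by rewrite ler_piMr// modulus_phase.
Qed.

End Phases.

End MoreGauges.

(** * The random variables as vectors of the sequence spaces *)

Section System.
Variables (R : realType) (K : scalarField R).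
Hypothesis hK : K = real_scalars R \/ K = complex_scalars R.
Variables (d N : nat -> nat).

Definition fiber m : finType := ('I_(d m).+1 * bool)%type.

Definition Omg m : finType := Om (fiber m) (N m).

(* [xi true m] is a sign multiplied by the indicator of an independent event of probability
   [dl true m]; [xi false m] is the sign alone. *)
Definition xi (sp : bool) m : fiber m -> R :=
  fun v => if sp then (if v.1 == ord0 then sgb R v.2 else 0) else sgb R v.2.
Arguments xi : clear implicits.

Definition dl (sp : bool) m : R := if sp then (d m).+1%:R^-1 else 1.

Lemma dl_gt0 sp m : 0 < dl sp m.
Proof. by rewrite /dl; case: sp => //; rewrite invr_gt0. Qed.

Lemma dl_le1 sp m : dl sp m <= 1.
Proof. by rewrite /dl; case: sp => //; rewrite invf_le1// ler1n. Qed.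

Lemma card_fiber m : (0 < #|fiber m|)%N.
Proof. by rewrite card_prod card_ord card_bool. Qed.

Lemma card_Omg m : (0 < #|Omg m|)%N.
Proof. exact/card_Om/card_fiber. Qed.

Lemma xi_signlike sp m : signlike (xi sp m) (dl sp m).
Proof.
move=> f; rewrite avg_pair /xi /dl; case: sp; last first.
  rewrite (eq_avg (g := fun b => f (sgb R b))) => [|b]; last by rewrite /= avg_const ?card_ord.
  exact: sgb_signlike.
rewrite (eq_avg (g := fun b => (d m).+1%:R^-1 * f (sgb R b) + (1 - (d m).+1%:R^-1) * f 0)); last first.
  move=> b; rewrite /avg card_ord big_ord_recl/= (eq_bigr (fun=> f 0)) => [|i _//].
  rewrite sumr_const card_ord -[_ *+ d m]mulr_natr -[(d m).+1]addn1 natrD.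
  by field; rewrite gt_eqF// ltr_wpDl.
by rewrite /avg card_bool big_bool/=; field; rewrite gt_eqF// ltr_wpDl.
Qed.

(** The number of points at which a given coordinate function is nonzero; hence [nc x] normalizes
    that function in l_x for counting measure. *)
Definition vol sp m : R := dl sp m * #|Omg m|%:R.

Lemma vol_gt0 sp m : 0 < vol sp m.
Proof. by rewrite mulr_gt0 ?dl_gt0// ltr0n card_Omg. Qed.

Definition nc (x : R) sp m : R := vol sp m `^ (- x^-1).

Lemma nc_gt0 x sp m : 0 < nc x sp m. Proof. exact/powR_gt0/vol_gt0. Qed.

Definition cf (x : R) sp m j (w : Omg m) : R := nc x sp m * co (xi sp m) w j.

Lemma sum_ord_ext J (z : 'I_J -> K) (F : nat -> K) :
  \sum_(j < J) z j * F j = \sum_(0 <= j < J) (oapp z 0 (insub j)) * F j.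
Proof. by rewrite big_mkord; apply: eq_bigr => j _; rewrite valK. Qed.

Lemma sum_cf (x : R) sp m J (z : 'I_J -> K) : 0 < x ->
  \sum_(w : Omg m) modulus (\sum_(j < J) z j * ofreal (cf x sp j w)) `^ x =
  (dl sp m)^-1 * avg (fun w : Omg m =>
    modulus (\sum_(0 <= j < J) (oapp z 0 (insub j)) * ofreal (co (xi sp m) w j)) `^ x).
Proof.
move=> x0; have O0 : #|Omg m|%:R != 0 :> R by rewrite pnatr_eq0 -lt0n card_Omg.
rewrite (eq_bigr (fun w => (vol sp m)^-1 *
    modulus (\sum_(0 <= j < J) (oapp z 0 (insub j)) * ofreal (co (xi sp m) w j)) `^ x)).
  rewrite -mulr_sumr /avg /vol invfM -mulrA; congr (_ * _).
  by rewrite mulrC.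
move=> w _; rewrite -sum_ord_ext.
have -> : \sum_(j < J) z j * ofreal (cf x sp j w) =
    ofreal (nc x sp m) * \sum_(j < J) z j * ofreal (co (xi sp m) w j).
  by rewrite mulr_sumr; apply: eq_bigr => j _; rewrite rmorphM mulrCA.
rewrite modulusM modulus_ofreal gtr0_norm ?nc_gt0// powRM ?modulus_ge0 ?(ltW (nc_gt0 _ _ _))//.
by rewrite /nc -powRrM mulNr mulVf ?gt_eqF// powR_inv1// ltW// vol_gt0.
Qed.

Lemma sum_ext J (z : 'I_J -> K) (f : R -> R) :
  \sum_(0 <= j < J) f (modulus (oapp z 0 (insub j))) = \sum_(j < J) f (modulus (z j)).
Proof. by rewrite big_mkord; apply: eq_bigr => j _; rewrite valK. Qed.

(** One formula for two roles. For [x > 2] it is the small weight [w_n] of the overview; for the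
    conjugate exponent it is the reciprocal of that, at least 1, and measures the loss for the
    biorthogonal system. *)
Definition weight (x : R) m : R := dl true m `^ (2^-1 - x^-1).

Lemma weight_ge0 x m : 0 <= weight x m. Proof. exact: powR_ge0. Qed.

(** Normalization divides the moment by [dl]; in Rosenthal's second term this leaves
    [dl ^ (x / 2 - 1)], which is the [x]-th power of the weight. *)
Lemma synth_special (x : R) : 2 <= x -> exists2 C, 1 <= C & forall m J (z : 'I_J -> K),
  \sum_(w : Omg m) modulus (\sum_(j < J) z j * ofreal (cf x true j w)) `^ x <=
  C * (\sum_(j < J) modulus (z j) `^ x +
       weight x m `^ x * (\sum_(j < J) modulus (z j) ^+ 2) `^ (x / 2)).
Proof.
move=> x2; have [C C1 hC] := moment_ge2 hK x2; exists C => // m J z.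
have x0 : 0 < x by lra.
have d0 := dl_gt0 true m.
rewrite sum_cf// ler_pdivrMl//.
apply: le_trans (hC _ _ _ _ _ _ (@xi_signlike true m) (ltW d0) (card_fiber m)) _.
rewrite (sum_ext z (fun t => t `^ x)) (sum_ext z (fun t => t ^+ 2)).
rewrite mulrCA; apply: ler_wpM2l; first by lra.
rewrite mulrDr lerD2l powRM ?(ltW d0)//; last by apply: sumr_ge0 => *; exact: sqr_ge0.
rewrite mulrA ler_wpM2r ?powR_ge0// -powRrM mulrBl mulVf ?gt_eqF//.
rewrite mulr_powR ?(ltW d0)//; last by rewrite mulr_gt0.
by rewrite mulrC.
Qed.

Lemma synth_rad (x : R) : 1 <= x -> exists2 C, 1 <= C & forall m J (z : 'I_J -> K),
  \sum_(w : Omg m) modulus (\sum_(j < J) z j * ofreal (cf x false j w)) `^ x <=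
  C * (\sum_(j < J) modulus (z j) ^+ 2) `^ (x / 2).
Proof.
move=> x1; have x0 : 0 < x by lra.
have [x2|x2] := leP x 2.
  exists 1 => // m J z; rewrite sum_cf// invr1 !mul1r.
  have x02 : 0 < x <= 2 by rewrite x0.
  have := moment_le2 hK (N m) J (fun j => oapp z 0 (insub j)) x02 (@xi_signlike false m)
    ler01 (card_fiber m).
  by rewrite mul1r (sum_ext z (fun t => t ^+ 2)).
have [C C1 hC] := moment_ge2 hK (ltW x2); exists (2 * C) => [|m J z]; first by lra.
rewrite sum_cf// invr1 !mul1r.
apply: le_trans (hC _ _ _ _ _ _ (@xi_signlike false m) ler01 (card_fiber m)) _.
rewrite (sum_ext z (fun t => t `^ x)) (sum_ext z (fun t => t ^+ 2)) !mul1r.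
rewrite [2 * C]mulrC -mulrA; apply: ler_wpM2l; first by lra.
rewrite mulr_natl mulr2n lerD2r; under eq_bigr do rewrite -powR_half ?modulus_ge0//.
by apply: powR_sum_ge => [|j]; [lra|exact: sqr_ge0].
Qed.

Lemma synth_dual (x : R) m J (z : 'I_J -> K) : 0 < x <= 2 ->
  \sum_(w : Omg m) modulus (\sum_(j < J) z j * ofreal (cf x true j w)) `^ x <=
  weight x m `^ x * (\sum_(j < J) modulus (z j) ^+ 2) `^ (x / 2).
Proof.
move=> x02; have /andP[x0 x2] := x02; have d0 := dl_gt0 true m.
rewrite sum_cf// ler_pdivrMl//.
have := moment_le2 hK (N m) J (fun j => oapp z 0 (insub j)) x02 (@xi_signlike true m)
    (ltW d0) (card_fiber m).
rewrite (sum_ext z (fun t => t ^+ 2)) => h; apply: le_trans h _.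
rewrite powRM ?(ltW d0)//; last by apply: sumr_ge0 => *; exact: sqr_ge0.
rewrite mulrA ler_wpM2r ?powR_ge0// -powRrM mulrBl mulVf ?gt_eqF//.
rewrite mulr_powR ?(ltW d0)//; last by rewrite mulr_gt0.
by rewrite mulrC.
Qed.

Lemma biorthogonal (x x' : R) sp m i j : x^-1 + x'^-1 = 1 -> (i < N m)%N -> (j < N m)%N ->
  \sum_(w : Omg m) cf x sp i w * cf x' sp j w = (i == j)%:R.
Proof.
move=> xx iN jN; under eq_bigr do rewrite /cf mulrACA.
rewrite -mulr_sumr /nc -powRD; last by rewrite (gt_eqF (vol_gt0 _ _)) implybT.
rewrite -opprD xx powR_inv1 ?(ltW (vol_gt0 _ _))//.
have := avg_coM (@xi_signlike sp m) (card_fiber m) iN jN.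
rewrite /avg => /(canRL (divfK _))->; last by rewrite pnatr_eq0 -lt0n card_Omg.
by rewrite mulrAC -/(vol sp m) mulrA mulVf ?mul1r// gt_eqF ?vol_gt0.
Qed.

Lemma cf_out x sp m j (w : Omg m) : (N m <= j)%N -> cf x sp j w = 0.
Proof. by move=> Nj; rewrite /cf co_out// mulr0. Qed.

(** All levels are placed in one sequence space by coding the disjoint union of the probability
    spaces in the integers; [emb] is 0 at integers that code no point. *)
Definition idx m (w : Omg m) : nat := pickle (Tagged Omg w).

Definition emb (G : forall m, Omg m -> K) (k : nat) : K :=
  if @pickle_inv {m : nat & Omg m} k is Some t then G (tag t) (tagged t) else 0.

Lemma emb_idx G m (w : Omg m) : emb G (idx w) = G m w.
Proof. by rewrite /emb /idx pickleK_inv. Qed.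

Lemma emb_cases k :
  (exists m (w : Omg m), k = idx w) \/ (forall G, emb G k = 0).
Proof.
rewrite /emb; case E : (pickle_inv k) => [t|]; last by right.
left; exists (tag t), (tagged t); rewrite /idx.
have := @pickle_invK {m : nat & Omg m} k; rewrite E /= => <-.
by case: (t).
Qed.

Lemma emb_sum_le (f : K -> R) G n : f 0 = 0 -> (forall z, 0 <= f z) ->
  exists L, \sum_(0 <= k < n) f (emb G k) <= \sum_(m < L) \sum_(w : Omg m) f (G m w).
Proof.
move=> f0 fge0.
pose tg k := if @pickle_inv {m : nat & Omg m} k is Some t then tag t else 0%N.
pose L := (\max_(k < n) tg k).+1; exists L.
have tgi m (w : Omg m) : tg (idx w) = m by rewrite /tg /idx pickleK_inv.
pose F k := f (emb G k).
have F0 k : 0 <= F k by exact: fge0.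
apply: (@le_trans _ _ (\sum_(k < n) \sum_(m < L) \sum_(w : Omg m) (if idx w == k then F k else 0))).
  rewrite big_mkord; apply: ler_sum => k _.
  have s0 (m : nat) : 0 <= \sum_(w : Omg m) (if idx w == k then F k else 0).
    by apply: sumr_ge0 => w _; case: ifP.
  have [[m [w kE]]|kE] := emb_cases k; last by rewrite kE f0; apply: sumr_ge0 => *; exact: s0.
  have mL : (m < L)%N.
    by rewrite ltnS -(tgi m w) -kE; apply: (@leq_bigmax _ (fun k : 'I_n => tg k)).
  rewrite (bigD1 (Ordinal mL))//= (bigD1 w)//= -kE eqxx -addrA lerDl.
  by rewrite addr_ge0// sumr_ge0// => *; case: ifP.
rewrite exchange_big/=; apply: ler_sum => m _.
rewrite exchange_big/=; apply: ler_sum => w _.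
rewrite (eq_bigr (fun k : 'I_n => if k == idx w :> nat then f (G m w) else 0)); last first.
  move=> k _; rewrite eq_sym; case: eqP => // ->.
  by rewrite /F emb_idx.
rewrite -(big_mkord xpredT (fun k => if k == idx w then f (G m w) else 0)).
by rewrite -big_mkcond big_nat1_eq; case: ifP.
Qed.

Section EmbeddedVectors.
Variables (p : R) (p1 : 1 <= p).
Local Notation X := (@ell R K p p1).

Let p0 : 0 < p. Proof. exact: lt_le_trans p1. Qed.

Lemma emb_powR_le (G : forall m, Omg m -> K) (M : R) n :
  (forall L, \sum_(m < L) \sum_(w : Omg m) modulus (G m w) `^ p <= M `^ p) ->
  \sum_(0 <= k < n) modulus (emb G k) `^ p <= M `^ p.
Proof.
move=> h; have [||L hL] := @emb_sum_le (fun z => modulus z `^ p) G n.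
- by rewrite modulus0 powR0// gt_eqF.
- by move=> z; exact: powR_ge0.
exact: le_trans hL (h L).
Qed.

Lemma emb_norm_le (x : X) (G : forall m, Omg m -> K) (M : R) : 0 <= M -> (forall k, x k = emb G k) ->
  (forall L, \sum_(m < L) \sum_(w : Omg m) modulus (G m w) `^ p <= M `^ p) -> ell_norm x <= M.
Proof.
move=> M0 xG h; apply: ell_norm_le => // n.
by under eq_bigr do rewrite xG; exact: emb_powR_le.
Qed.

Lemma emb_pred (G : forall m, Omg m -> K) (M : R) : 0 <= M ->
  (forall L, \sum_(m < L) \sum_(w : Omg m) modulus (G m w) `^ p <= M `^ p) ->
  (emb G : nat -> (Defs.scalar K)^o) \in @ell_pred R K p.
Proof. by move=> M0 h; apply: (ell_predI p1 M0) => n; exact: emb_powR_le. Qed.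

Lemma idx_inj L : injective (fun t : {m : 'I_L & Omg m} => idx (tagged t)).
Proof.
move=> [m w] [m' w'] /= /(pcan_inj pickleK) E.
have mm : m = m' by apply: val_inj; exact: (congr1 tag E).
rewrite mm in w E *; congr existT.
by have := eq_from_Tagged E.
Qed.

Lemma blocks_hoelder (p' : R) (x : X) L (a : forall m, Omg m -> K) : 0 < p' -> p^-1 + p'^-1 = 1 ->
  modulus (\sum_(m < L) \sum_(w : Omg m) a m w * x (idx w)) <=
  ell_norm x * (\sum_(m < L) \sum_(w : Omg m) modulus (a m w) `^ p') `^ p'^-1.
Proof.
move=> p'0 pp.
rewrite (sig_big_dep xpredT (fun _ => xpredT) (fun (m : 'I_L) (w : Omg m) => a m w * x (idx w))).
rewrite (sig_big_dep xpredT (fun _ => xpredT) (fun (m : 'I_L) (w : Omg m) => modulus (a m w) `^ p')).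
apply: le_trans (modulus_sum _ _ _) _.
under eq_bigr do rewrite modulusM mulrC.
apply: le_trans (hoelder_sum _ p0 p'0 pp (fun _ => modulus_ge0 _) (fun _ => modulus_ge0 _)) _.
rewrite ler_wpM2r ?powR_ge0//.
rewrite -[leRHS](powRK (_ : p != 0)) ?ell_norm_ge0 ?gt_eqF//.
apply: ler_pow; rewrite ?invr_ge0 ?(ltW p0)//.
  by apply: sumr_ge0 => *; exact: powR_ge0.
exact: (ell_inj_sum_le x (@idx_inj L)).
Qed.

End EmbeddedVectors.

End System.

(** * Finite diagonal presentations and their tests *)

Section Presented.
Variables (R : realType) (K : scalarField R).
Hypothesis hK : K = real_scalars R \/ K = complex_scalars R.
Variables (p q p' q' : R) (p1 : 1 <= p) (q1 : 1 <= q) (sp : bool).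
Hypotheses (p_1 : 1 < p) (p_q : p < q) (p'_1 : 1 < p') (q'_1 : 1 < q').
Hypotheses (pp : p^-1 + p'^-1 = 1) (qq : q^-1 + q'^-1 = 1).
(* The dichotomy of the proof: the Rosenthal blocks live in the dual of the domain when [p < 2],
   and in the range when [p >= 2]. *)
Hypothesis hsp : if sp then p < 2 else 2 <= p.

Local Notation X := (@ell R K p p1).
Local Notation Y := (@ell R K q q1).

(** The exponent of the Rosenthal side, its conjugate, and the exponent of the sign side. *)
Definition rexp := if sp then p' else q.
Definition rexp' := if sp then p else q'.
Definition eexp := if sp then q else p'.

(** The last inequality is [p < q] in one case and its dual form [q' < p'] in the other. *)
Lemma exponents : [/\ 2 < rexp, rexp^-1 + rexp'^-1 = 1, 1 < rexp', rexp' < 2 & rexp' < eexp].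
Proof.
have [pos1 pos2 pos3 pos4] : [/\ 0 < p, 0 < q, 0 < p' & 0 < q'].
  by move: p_1 p_q p'_1 q'_1 => *; split; lra.
have hV (a b : R) : 0 < a -> 0 < b -> (a^-1 < b^-1) = (b < a).
  by move=> a0 b0; rewrite ltf_pV2.
have p'V : p'^-1 = 1 - p^-1 by move: pp; lra.
have q'V : q'^-1 = 1 - q^-1 by move: qq; lra.
have pqV : q^-1 < p^-1 by rewrite hV.
rewrite /rexp /rexp' /eexp; move: hsp; case: sp => h; split=> //.
- rewrite -hV// p'V; have : 2^-1 < p^-1 by rewrite hV.
  lra.
- by rewrite addrC.
- exact: le_lt_trans h p_q.
- rewrite -hV// q'V; have : q^-1 < 2^-1 by rewrite hV//; exact: le_lt_trans h p_q.
  lra.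
- by rewrite -hV// p'V q'V; lra.
Qed.

Definition GU (B J : finType) (wt : B -> R) (y : B -> J -> R) :=
  if sp then gauge_s p' wt y else gauge_r p' y.

Definition GV (B J : finType) (wt : B -> R) (y : B -> J -> R) :=
  if sp then gauge_r q y else gauge_s q wt y.

(* On finitely many vectors at a time, [S] is a diagonal operator between spaces normed by the two
   gauges; the weights vanish for the formal inclusion. *)
Definition presented (C w : R) (S : bop X Y) :=
  forall n (x : nat -> X) (eps : R), 0 < eps ->
  exists (B J : finType) (wt : B -> R) (u : B -> J -> X -> K) (v : B -> J -> Y),
  [/\ forall b, 0 <= wt b <= w,
      forall b j a x y, u b j (a *: x + y) = a * u b j x + u b j y,
      forall z x, modulus (\sum_b \sum_j z b j * u b j x) <=
        C * ell_norm x * GU wt (fun b j => modulus (z b j)) `^ p'^-1,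
      forall z : B -> J -> K, ell_norm (\sum_b \sum_j z b j *: v b j) <=
        C * GV wt (fun b j => modulus (z b j)) `^ q^-1 &
      forall i, (i < n)%N ->
        ell_norm (S (x i) - \sum_b \sum_j u b j (x i) *: v b j) <= eps].

(** The loss [W] falls on the system biorthogonal to the Rosenthal blocks: the vectors [r] of the
    domain if [sp], the functionals [g] on the range otherwise. *)
Record test_system (C W : R) (n : nat) (r : nat -> X) (g : nat -> Y -> K) : Prop := TestSystem {
  test_linear : forall i a x y, g i (a *: x + y) = a * g i x + g i y;
  test_r : forall i, (i < n)%N -> ell_norm (r i) <= C;
  test_g : forall i y, (i < n)%N -> modulus (g i y) <= C * ell_norm y;
  test_rsum : forall a : nat -> K, ell_norm (\sum_(0 <= i < n) a i *: r i) <=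
    C * (if sp then W else 1) * (\sum_(0 <= i < n) modulus (a i) ^+ 2) `^ 2^-1;
  test_gsum : forall (a : nat -> K) y, modulus (\sum_(0 <= i < n) a i * g i y) <=
    C * (if sp then 1 else W) * (\sum_(0 <= i < n) modulus (a i) ^+ 2) `^ 2^-1 * ell_norm y }.

Lemma GU_ge0 (B J : finType) wt (y : B -> J -> R) : 0 <= GU wt y.
Proof. by rewrite /GU; case: sp; rewrite ?gauge_s_ge0 ?gauge_r_ge0. Qed.

Lemma GV_ge0 (B J : finType) wt (y : B -> J -> R) : 0 <= GV wt y.
Proof. by rewrite /GV; case: sp; rewrite ?gauge_s_ge0 ?gauge_r_ge0. Qed.

Let p'0 : 0 < p'. Proof. exact: lt_trans p'_1. Qed.
Let q0 : 0 < q. Proof. exact: lt_le_trans q1. Qed.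

Lemma GU_mono (B J : finType) wt (y y' : B -> J -> R) :
  (forall b j, 0 <= y b j <= y' b j) -> GU wt y `^ p'^-1 <= GU wt y' `^ p'^-1.
Proof.
move=> yy; apply: ler_pow; rewrite ?GU_ge0 ?invr_ge0 ?(ltW p'0)//.
by rewrite /GU; case: sp; [apply: gauge_s_mono|apply: gauge_r_mono]; rewrite ?(ltW p'0).
Qed.

Lemma GV_mono (B J : finType) wt (y y' : B -> J -> R) :
  (forall b j, 0 <= y b j <= y' b j) -> GV wt y `^ q^-1 <= GV wt y' `^ q^-1.
Proof.
move=> yy; apply: ler_pow; rewrite ?GV_ge0 ?invr_ge0 ?(ltW q0)//.
by rewrite /GV; case: sp; [apply: gauge_r_mono|apply: gauge_s_mono]; rewrite ?(ltW q0).
Qed.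

Lemma dual_U (B J : finType) wt (t : B -> J -> K) (M M' : R) : 0 <= M -> M <= M' ->
  (forall z : B -> J -> K, modulus (\sum_b \sum_j z b j * t b j) <=
     M * GU wt (fun b j => modulus (z b j)) `^ p'^-1) ->
  forall y, (forall b j, 0 <= y b j) ->
    \sum_b \sum_j y b j * modulus (t b j) <= M' * GU wt y `^ p'^-1.
Proof.
move=> M0 MM h; apply: (@phase_bound R K B J (fun y => GU wt y `^ p'^-1)).
- exact: le_trans MM.
- by move=> y y' yy; exact: GU_mono.
- by move=> z; apply: le_trans (h z) _; rewrite ler_wpM2r ?powR_ge0.
Qed.

Lemma dual_V (B J : finType) wt (t : B -> J -> K) (M M' : R) : 0 <= M -> M <= M' ->
  (forall z : B -> J -> K, modulus (\sum_b \sum_j z b j * t b j) <=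
     M * GV wt (fun b j => modulus (z b j)) `^ q^-1) ->
  forall y, (forall b j, 0 <= y b j) ->
    \sum_b \sum_j y b j * modulus (t b j) <= M' * GV wt y `^ q^-1.
Proof.
move=> M0 MM h; apply: (@phase_bound R K B J (fun y => GV wt y `^ q^-1)).
- exact: le_trans MM.
- by move=> y y' yy; exact: GV_mono.
- by move=> z; apply: le_trans (h z) _; rewrite ler_wpM2r ?powR_ge0.
Qed.

(** The exponent found in [peak_part]; it is negative because [rexp'] is below both [eexp] and 2. *)
Definition gain := rexp' / (2 * Num.min eexp 2) - 2^-1.

(** A presentation of [S] splits the test into the matrices [t i b j = u b j (B (r i))] and
    [h i b j = g i (A (v b j))]. Norm bounds on [A] and [B] translate into bounds in the dual
    gauges, and [test_bound] applies. *)
Lemma test_presented (A : bop Y Y) (B : bop X X) (C eps : R) : 1 <= C -> 0 < eps ->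
  exists2 c, 0 < c & forall n W w S r g, (0 < n)%N -> 1 <= W -> w <= c -> w * n%:R <= c ->
    W * n%:R `^ gain <= c -> presented C w S -> test_system C W n r g ->
    modulus (\sum_(0 <= i < n) g i (A (S (B (r i))))) <= eps * n%:R.
Proof.
move=> C1 eps0; have [r2 rr r'1 r'2 r'e] := exponents.
set nA := opnorm A; set nB := opnorm B.
have nA0 : 0 <= nA by exact: opnorm_ge0.
have nB0 : 0 <= nB by exact: opnorm_ge0.
have C0 : 0 <= C by lra.
pose M := 1 + C * C * (nA + nB).
have CA0 : 0 <= C * C * nA by rewrite !mulr_ge0.
have CB0 : 0 <= C * C * nB by rewrite !mulr_ge0.
have M1 : 1 <= M by rewrite /M mulrDr; lra.
have MA : C * C * nA <= M by rewrite /M mulrDr; lra.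
have MB : C * C * nB <= M by rewrite /M mulrDr; lra.
clearbody M.
have e20 : 0 < eps / 2 by rewrite divr_gt0.
have [c /andP[c0 c1] hc] := test_bound hK r2 rr r'1 r'2 r'e erefl M1 e20.
exists c => // n W w S r g n0 W1 wc wn Wn pS [gl rC gC rsum gsum].
have n_gt0 : 0 < n%:R :> R by rewrite ltr0n.
(* An error of this size, pushed through [A] and [g i], costs at most [eps / 2] for each [i]; the
   summand 1 guards against [nA = 0]. *)
have e1 : 0 < eps / 2 / (C * (nA + 1)) by rewrite divr_gt0// mulr_gt0// ?ltr_wpDl// (lt_le_trans ltr01 C1).
have [I [J [wt [u [v [wtw ul uU vV app]]]]]] := pS n (fun i => B (r i)) _ e1.
have g0 i : g i 0 = 0 by have [] := functional_linear (gl i).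
have gZ i a y : g i (a *: y) = a * g i y by have [] := functional_linear (gl i).
have gD i x y : g i (x + y) = g i x + g i y by have [] := functional_linear (gl i).
have gsumE i (T : finType) (F : T -> Y) : g i (\sum_t F t) = \sum_t g i (F t).
  by elim/big_rec2 : _ => // t y x _ <-; rewrite gD.
pose t i b j := u b j (B (r i)).
pose h i b j := g i (A (v b j)).
have Wge0 : 0 <= W := le_trans ler01 W1.
have sq0 (a : nat -> K) : 0 <= (\sum_(0 <= i < n) modulus (a i) ^+ 2) `^ 2^-1 by exact: powR_ge0.
have wt0 b : 0 <= wt b by have /andP[] := wtw b.
have wtc b : 0 <= wt b <= c by rewrite wt0/=; have /andP[_ ww] := wtw b; exact: le_trans wc.
have wtn b : wt b * n%:R <= c.
  by apply: le_trans wn; rewrite ler_wpM2r ?(ltW n_gt0)//; have /andP[] := wtw b.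
have u0 b j : u b j 0 = 0 by have [] := functional_linear (ul b j).
have uZ b j a x : u b j (a *: x) = a * u b j x by have [] := functional_linear (ul b j).
have uD b j x y : u b j (x + y) = u b j x + u b j y by have [] := functional_linear (ul b j).
have t_lin (a : nat -> K) b j :
    \sum_(0 <= i < n) t i b j * a i = u b j (B (\sum_(0 <= i < n) a i *: r i)).
  elim/big_rec2 : _ => [|i x y _ ->]; first by rewrite linear0 u0.
  by rewrite linearD linearZ uD uZ mulrC.
have h_lin i (z : I -> J -> K) : \sum_b \sum_j z b j * h i b j = g i (A (\sum_b \sum_j z b j *: v b j)).
  rewrite linear_sum gsumE; apply: eq_bigr => b _.
  by rewrite linear_sum gsumE; apply: eq_bigr => j _; rewrite linearZ gZ.
have HU i y : (i < n)%N -> (forall b j, 0 <= y b j) ->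
    \sum_b \sum_j y b j * modulus (t i b j) <= M * GU wt y `^ p'^-1.
  move=> iN y0; apply: (dual_U CB0 MB) => // z; apply: le_trans (uU z _) _.
  rewrite ler_wpM2r ?powR_ge0//; apply: le_trans (ler_wpM2l C0 (bop_norm_le B _)) _.
  by rewrite -/nB -!mulrA ler_wpM2l// mulrC ler_wpM2r// rC.
have HUa (a : nat -> K) y : (forall b j, 0 <= y b j) ->
    \sum_b \sum_j y b j * modulus (\sum_(0 <= i < n) t i b j * a i) <=
    M * (if sp then W else 1) * (\sum_(0 <= i < n) modulus (a i) ^+ 2) `^ 2^-1 * GU wt y `^ p'^-1.
  have W0 : 0 <= (if sp then W else 1) by case: ifP.
  have MM : 0 <= C * C * nB * (if sp then W else 1) * (\sum_(0 <= i < n) modulus (a i) ^+ 2) `^ 2^-1.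
    by rewrite !mulr_ge0.
  apply: (dual_U MM) => [|z].
    by rewrite ler_wpM2r// ler_wpM2r.
  under eq_bigr do under eq_bigr do rewrite t_lin.
  apply: le_trans (uU z _) _; rewrite ler_wpM2r ?powR_ge0//.
  apply: le_trans (ler_wpM2l C0 (bop_norm_le B _)) _; rewrite -/nB.
  apply: le_trans (ler_wpM2l C0 (ler_wpM2l nB0 (rsum a))) _.
  by apply: eq_ler; rewrite -!mulrA; congr (_ * _); rewrite mulrCA.
have HV i y : (i < n)%N -> (forall b j, 0 <= y b j) ->
    \sum_b \sum_j y b j * modulus (h i b j) <= M * GV wt y `^ q^-1.
  move=> iN y0; apply: (dual_V CA0 MA) => // z; rewrite h_lin.
  apply: le_trans (gC _ _ iN) _; apply: le_trans (ler_wpM2l C0 (bop_norm_le A _)) _.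
  apply: le_trans (ler_wpM2l C0 (ler_wpM2l nA0 (vV z))) _.
  by apply: eq_ler; rewrite -/nA; ring.
have HVa (a : nat -> K) y : (forall b j, 0 <= y b j) ->
    \sum_b \sum_j y b j * modulus (\sum_(0 <= i < n) h i b j * a i) <=
    M * (if sp then 1 else W) * (\sum_(0 <= i < n) modulus (a i) ^+ 2) `^ 2^-1 * GV wt y `^ q^-1.
  have W0 : 0 <= (if sp then 1 else W) by case: ifP.
  have MM : 0 <= C * C * nA * (if sp then 1 else W) * (\sum_(0 <= i < n) modulus (a i) ^+ 2) `^ 2^-1.
    by rewrite !mulr_ge0.
  apply: (dual_V MM) => [|z].
    by rewrite ler_wpM2r// ler_wpM2r.
  have -> : \sum_b \sum_j z b j * (\sum_(0 <= i < n) h i b j * a i) =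
      \sum_(0 <= i < n) a i * g i (A (\sum_b \sum_j z b j *: v b j)).
    under [RHS]eq_bigr do rewrite -h_lin mulr_sumr.
    rewrite [RHS]exchange_big/=; apply: eq_bigr => b _.
    under [RHS]eq_bigr do rewrite mulr_sumr.
    rewrite [RHS]exchange_big/=; apply: eq_bigr => j _; rewrite mulr_sumr.
    by apply: eq_bigr => i _; ring.
  apply: le_trans (gsum a _) _; set s := _ `^ 2^-1.
  have Cs : 0 <= C * (if sp then 1 else W) * s := mulr_ge0 (mulr_ge0 C0 W0) (sq0 a).
  apply: le_trans (ler_wpM2l Cs (bop_norm_le A _)) _; rewrite -/nA.
  apply: le_trans (ler_wpM2l Cs (ler_wpM2l nA0 (vV z))) _.
  by apply: eq_ler; ring.
have main : modulus (\sum_(0 <= i < n) \sum_b \sum_j t i b j * h i b j) <= eps / 2 * n%:R.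
  move: hc Wn HU HUa HV HVa; rewrite /gain /rexp /rexp' /eexp /GU /GV.
  case: sp => hc Wn HU HUa HV HVa.
    apply: (hc n W I J wt t h n0 W1 wtc wtn (fun i iN y => HU i y iN) HUa
              (fun i iN y => HV i y iN) _ Wn) => a y y0.
    by have := HVa a y y0; rewrite mulr1.
  (* With the Rosenthal blocks in the range, [t] and [h] exchange their roles in [test_bound]. *)
  under eq_bigr do under eq_bigr do under eq_bigr do rewrite mulrC.
  apply: (hc n W I J wt h t n0 W1 wtc wtn (fun i iN y => HV i y iN) HVa
            (fun i iN y => HU i y iN) _ Wn) => a y y0.
  by have := HUa a y y0; rewrite mulr1.
have -> : \sum_(0 <= i < n) g i (A (S (B (r i)))) =
    \sum_(0 <= i < n) \sum_b \sum_j t i b j * h i b j +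
    \sum_(0 <= i < n) g i (A (S (B (r i)) - \sum_b \sum_j t i b j *: v b j)).
  rewrite -big_split/=; apply: eq_bigr => i _.
  by rewrite h_lin -gD -linearD addrC subrK.
apply: le_trans (modulusD _ _) _.
have -> : eps * n%:R = eps / 2 * n%:R + eps / 2 * n%:R by rewrite -mulrDl -splitr.
apply: lerD => //; apply: le_trans (modulus_sum _ _ _) _.
rewrite mulrC mulr_natl -[n in leRHS]subn0 -sumr_const_nat; apply: ler_sum_nat => i /andP[_ iN].
apply: le_trans (gC _ _ iN) _; apply: le_trans (ler_wpM2l C0 (bop_norm_le A _)) _.
apply: le_trans (ler_wpM2l C0 (ler_wpM2l nA0 (app i iN))) _; rewrite -/nA.
apply: (@le_trans _ _ (C * ((nA + 1) * (eps / 2 / (C * (nA + 1)))))).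
  by rewrite ler_wpM2l// ler_wpM2r ?(ltW e1)// lerDl.
have nC : C * (nA + 1) != 0.
  by rewrite gt_eqF// mulr_gt0// ?ltr_wpDl// (lt_le_trans ltr01 C1).
by rewrite mulrA [leLHS]mulrC divfK.
Qed.

End Presented.

(** * The formal inclusion *)

Section FormalInclusionOperator.
Variables (R : realType) (K : scalarField R) (p q p' : R) (p1 : 1 <= p) (q1 : 1 <= q).
Hypotheses (p_q : p < q).
Local Notation X := (@ell R K p p1).
Local Notation Y := (@ell R K q q1).
Local Notation incl := (formal_inclusion K p1 q1 (ltW p_q)).

Let p0 : 0 < p. Proof. exact: lt_le_trans p1. Qed.
Let q0 : 0 < q. Proof. exact: lt_le_trans q1. Qed.

Lemma nat_above (y : R) : exists n : nat, y <= n%:R.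
Proof.
exists (Num.bound `|y|); apply: le_trans (ler_norm y) _.
exact/ltW/archi_boundP.
Qed.

(** The null family consists of the coordinates. If all of them are at most [dt] times the norm of
    [x], then interpolating q between p and infinity gains [dt ^ (q - p)]; otherwise the term
    [D * c] already dominates. *)
Lemma incl_controlled : controlled incl.
Proof.
move=> eps e0; exists nat, (fun k x => x k); split.
  split=> //; first by exists 1 => // k x; rewrite mul1r; exact: modulus_le_ell_norm.
  move=> r; have [n hn] := nat_above (`|r| `^ p); exists n => x s us xr hs.
  rewrite -(ler_nat R); apply: le_trans hn; apply: (@le_trans _ _ (ell_norm x `^ p)); last first.
    by apply: ler_pow; rewrite ?ell_norm_ge0 ?(ltW p0)// (le_trans xr)// ler_norm.
  have fI : injective (fun i : 'I_(size s) => nth 0%N s i).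
    by move=> i j /eqP; rewrite nth_uniq// => /eqP/val_inj.
  apply: le_trans (ell_inj_sum_le x fI).
  have -> : (size s)%:R = \sum_(i < size s) 1 :> R by rewrite sumr_const card_ord.
  apply: ler_sum => i _; have h : 1 <= modulus (x (nth 0%N s i)) by apply/hs/mem_nth.
  by have := ler_pow (ltW p0) ler01 h; rewrite powR1.
have qp : 0 < q - p by rewrite subr_gt0.
have [dt d0 hd] := small_pow qp (powR_gt0 q e0) ltr01.
exists dt^-1 => [|x c c0 hc]; first by rewrite invr_ge0 ltW.
have x0 := ell_norm_ge0 x.
have [cd|cd] := leP c (dt * ell_norm x); last first.
  apply: (@le_trans _ _ (ell_norm x)); first by rewrite -lee_fin ell_normE; exact: (ell_enorm_incl q1 (ltW p_q)).
  apply: (@le_trans _ _ (dt^-1 * c)); first by rewrite ler_pdivlMl// ltW.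
  by rewrite lerDr mulr_ge0// ltW.
apply: (@le_trans _ _ (eps * ell_norm x)); last by rewrite lerDl mulr_ge0 ?invr_ge0 ?(ltW d0).
apply: ell_norm_le => [|n]; first by rewrite mulr_ge0// ltW.
apply: (@le_trans _ _ (\sum_(0 <= k < n) (dt * ell_norm x) `^ (q - p) * modulus (x k) `^ p)).
  apply: ler_sum => k _; rewrite formal_inclusionE.
  have [->|xk] := eqVneq (modulus (x k)) 0; first by rewrite !powR0 ?mulr0// gt_eqF.
  rewrite -{1}(subrK p q) (@powRD _ (modulus (x k))); last by rewrite xk implybT.
  rewrite ler_wpM2r ?powR_ge0//; apply: ler_pow; rewrite ?modulus_ge0 ?(ltW qp)//.
  exact: le_trans cd.
rewrite -mulr_sumr; apply: le_trans (ler_wpM2l (powR_ge0 _ _) (ell_sum_le x n)) _.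
rewrite !powRM ?(ltW e0) ?(ltW d0)// -mulrA; apply: (@le_trans _ _ (dt `^ (q - p) * ell_norm x `^ q)).
  rewrite ler_wpM2l ?powR_ge0//; have [->|xn] := eqVneq (ell_norm x) 0.
    by rewrite [0 `^ p]powR0 ?mulr0 ?powR_ge0// gt_eqF.
  by rewrite -powRD ?subrK// xn implybT.
by rewrite ler_wpM2r ?powR_ge0//; rewrite mul1r in hd.
Qed.

Lemma unit_vectors : exists e : nat -> Y, forall m k, e m k = (k == m)%:R.
Proof.
suff h m : exists e : Y, forall k, e k = (k == m)%:R by have [f hf] := choice h; exists f.
have eP : ((fun k => (k == m)%:R) : nat -> (Defs.scalar K)^o) \in @ell_pred R K q.
  apply: (ell_predI q1 ler01) => n; rewrite powR1.
  rewrite (eq_bigr (fun k => if k == m then 1 else 0)) => [|k _].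
    by rewrite -big_mkcond big_nat1_eq; case: ifP.
  case: eqP => _; first by rewrite -(rmorph1 (@ofreal R K)) modulus_ofreal normr1 powR1.
  by rewrite modulus0 powR0// gt_eqF.
by exists (Ell q1 eP).
Qed.

Lemma incl_presented (sp : bool) : 1 < p' -> p^-1 + p'^-1 = 1 -> presented p' sp 1 0 incl.
Proof.
move=> p'1 pp n x eps e0; have p'0 : 0 < p' by lra.
have [e eE] := unit_vectors.
have [L0 hL0] : exists L0, forall i L, (i < n)%N -> (L0 <= L)%N -> forall y : Y,
    (forall k, (k < L)%N -> y k = 0) -> (forall k, y k = x i k \/ y k = 0) -> ell_norm y <= eps.
  elim: n => [|n [L0 IH]]; first by exists 0%N.
  have [L1 h1] := ell_tail (incl (x n)) e0; exists (maxn L0 L1) => i L.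
  rewrite ltnS leq_eqVlt geq_max => /predU1P[->|iN] /andP[LL0 LL1] y yL yx.
    by apply: h1 => // k kL; apply: yL; exact: leq_trans LL1.
  exact: (IH i L).
(* Blocks of size one and weight 0, on which both gauges are plain power sums, so that the
   presentation serves both values of [sp]. *)
pose I := 'I_L0; pose wt (b : I) : R := 0.
have G0 (y : I -> 'I_1 -> R) r : 0 < r -> (forall b j, 0 <= y b j) ->
    gauge_s r wt y = \sum_b y b ord0 `^ r /\ gauge_r r y = \sum_b y b ord0 `^ r.
  move=> r0 y0; split; apply: eq_bigr => b _.
    by rewrite big_ord1 powR0 ?mul0r ?addr0// gt_eqF.
  by rewrite /sqsum big_ord1 powR_half.
have cE (z : I -> 'I_1 -> K) k :
    (\sum_b \sum_j z b j *: e b) k = oapp (fun b : I => z b ord0) 0 (insub k).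
  rewrite ell_sumE; under eq_bigr do rewrite big_ord1 ellZ eE.
  case: insubP => [b _ <-|kL] /=.
    rewrite (bigD1 b)//= eqxx mulr1 big1 ?addr0// => b' /negbTE bb'.
    by rewrite eq_sym -val_eqE/= in bb'; rewrite bb' mulr0.
  rewrite big1// => b _; case: eqP => [kb|_]; last by rewrite mulr0.
  by rewrite kb ltn_ord in kL.
exists I, 'I_1, wt, (fun (b : 'I_L0) _ (x : X) => x b), (fun (b : 'I_L0) _ => e b); split=> //.
- by move=> b; rewrite lexx.
- move=> z y; rewrite mul1r.
  have -> : GU p' sp wt (fun b j => modulus (z b j)) = \sum_b modulus (z b ord0) `^ p'.
    by rewrite /GU; have [-> ->] := G0 _ p' p'0 (fun b j => modulus_ge0 (z b j)); case: sp.
  apply: le_trans (modulus_sum _ _ _) _.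
  under eq_bigr do rewrite big_ord1 modulusM mulrC.
  apply: le_trans (hoelder_sum _ p0 p'0 pp (fun _ => modulus_ge0 _) (fun _ => modulus_ge0 _)) _.
  rewrite ler_wpM2r ?powR_ge0//.
  rewrite -[leRHS](powRK (_ : p != 0)) ?ell_norm_ge0 ?gt_eqF//.
  apply: ler_pow; rewrite ?invr_ge0 ?(ltW p0)//.
    by apply: sumr_ge0 => *; exact: powR_ge0.
  exact: (ell_inj_sum_le y (@ord_inj L0)).
- move=> z; rewrite mul1r.
  have -> : GV q sp wt (fun b j => modulus (z b j)) = \sum_b modulus (z b ord0) `^ q.
    by rewrite /GV; have [-> ->] := G0 _ q q0 (fun b j => modulus_ge0 (z b j)); case: sp.
  have S0 : 0 <= \sum_b modulus (z b ord0) `^ q by apply: sumr_ge0 => *; exact: powR_ge0.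
  apply: ell_norm_le => [|m]; first exact: powR_ge0.
  rewrite powRVK ?gt_eqF//.
  under eq_bigr do rewrite cE.
  apply: (@le_trans _ _ (\sum_(0 <= k < maxn m L0) modulus (oapp (fun b : I => z b ord0) 0 (insub k)) `^ q)).
    rewrite [leRHS](@big_cat_nat _ _ _ m)//= ?leq_maxl// lerDl.
    by apply: sumr_ge0 => *; exact: powR_ge0.
  rewrite (@big_cat_nat _ _ _ L0)//= ?leq_maxr//.
  rewrite [X in _ + X]big_nat_cond [X in _ + X]big1 ?addr0; last first.
    move=> k; rewrite andbT => /andP[kL _]; rewrite insubF ?modulus0 ?powR0 ?gt_eqF//.
    by rewrite ltnNge kL.
  by rewrite big_mkord; apply: ler_sum => b _; rewrite valK.
- move=> i iN; apply: (hL0 i L0) => // k => [kL|]; rewrite ellB formal_inclusionE cE.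
    by rewrite insubT/= subrr.
  by case: insubP => [b _ <-|_] /=; [right; rewrite subrr|left; rewrite subr0].
Qed.

End FormalInclusionOperator.

(** * The operators attached to sets of levels, and the ideals *)

Section BlockOperators.
Variables (R : realType) (K : scalarField R).
Hypothesis hK : K = real_scalars R \/ K = complex_scalars R.
Variables (p q p' q' : R) (p1 : 1 <= p) (q1 : 1 <= q) (sp : bool).
Hypotheses (p_1 : 1 < p) (p_q : p < q) (p'_1 : 1 < p') (q'_1 : 1 < q').
Hypotheses (pp : p^-1 + p'^-1 = 1) (qq : q^-1 + q'^-1 = 1).
Hypothesis hsp : if sp then p < 2 else 2 <= p.
Variables (d N : nat -> nat).

Local Notation X := (@ell R K p p1).
Local Notation Y := (@ell R K q q1).
Local Notation O := (Omg d N).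
Local Notation rexp := (rexp q p' sp).
Local Notation rexp' := (rexp' p q' sp).

Let p0 : 0 < p. Proof. exact: lt_trans p_1. Qed.
Let q0 : 0 < q. Proof. exact: lt_trans p_q. Qed.
Let p'0 : 0 < p'. Proof. exact: lt_trans p'_1. Qed.

Lemma synth (sp0 : bool) (x : R) : (if sp0 then 2 <= x else 1 <= x) ->
  exists2 C, 1 <= C & forall m J (z : 'I_J -> K),
  \sum_(w : O m) modulus (\sum_(j < J) z j * ofreal (cf x sp0 j w)) `^ x <=
  C * (if sp0 then \sum_(j < J) modulus (z j) `^ x +
       weight d x m `^ x * (\sum_(j < J) modulus (z j) ^+ 2) `^ (x / 2)
     else (\sum_(j < J) modulus (z j) ^+ 2) `^ (x / 2)).
Proof. by case: sp0 => h; [exact: synth_special|exact: synth_rad]. Qed.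

Definition ua (D : pred nat) m j (x : nat -> K) : K :=
  if D m then \sum_(w : O m) ofreal (cf p' sp j w) * x (idx w) else 0.

Definition tcoef (D : pred nat) (x : nat -> K) m (w : O m) : K :=
  if D m then \sum_(j < N m) ua D m j x * ofreal (cf q (~~ sp) j w) else 0.

(** The operator T^D of the overview, specified by its coordinates so that operators for different
    [D] can be compared and added directly. *)
Definition is_block (D : pred nat) (T : X -> Y) := forall x k, T x k = emb (tcoef D x) k.

Definition wtD (D : pred nat) m : R := if D m then weight d rexp m else 0.

Lemma wtD_ge0 D m : 0 <= wtD D m.
Proof. by rewrite /wtD; case: ifP => // _; exact: weight_ge0. Qed.

Lemma weight_le1 (x : R) m : 2 <= x -> weight d x m <= 1.
Proof.
move=> x2; rewrite /weight.
apply: (@le_trans _ _ (dl R d true m `^ 0)); last by rewrite powRr0.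
apply: ger_powR; first by rewrite dl_gt0 dl_le1.
by rewrite subr_ge0 lef_pV2 ?posrE//; lra.
Qed.

Lemma wtD_01 D m : 0 <= wtD D m <= 1.
Proof.
have [r2 _ _ _ _] := exponents p_1 p_q p'_1 q'_1 pp qq hsp.
rewrite wtD_ge0/= /wtD; case: ifP => // _; by apply: weight_le1; exact: ltW.
Qed.

Lemma ua_linear D m j a (x y : X) : ua D m j (a *: x + y : X) = a * ua D m j x + ua D m j y.
Proof.
rewrite /ua; case: ifP => _; last by rewrite mulr0 addr0.
rewrite mulr_sumr -big_split/=; apply: eq_bigr => w _.
by rewrite [X in _ * X](_ : _ = a * x (idx w) + y (idx w))// mulrDr mulrCA.
Qed.

Lemma powR_const_le (C x y : R) : 1 <= C -> 1 <= x -> 0 <= y -> (C * y) `^ x^-1 <= C * y `^ x^-1.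
Proof.
move=> C1 x1 y0; rewrite powRM//; last by lra.
rewrite ler_wpM2r ?powR_ge0// -[leRHS]powRr1; last by lra.
by apply: ler_powR => //; rewrite invf_le1//; lra.
Qed.

Lemma pexp2 : if sp then 2 <= p' else 1 <= p'.
Proof.
have [r2 _ _ _ _] := exponents p_1 p_q p'_1 q'_1 pp qq hsp.
by move: r2 hsp; rewrite /rexp; case: sp => r2 h; apply: ltW.
Qed.

Lemma qexp2 : if ~~ sp then 2 <= q else 1 <= q.
Proof.
have [r2 _ _ _ _] := exponents p_1 p_q p'_1 q'_1 pp qq hsp.
by move: r2 hsp; rewrite /rexp; case: sp => //= r2 h; apply: ltW.
Qed.

Lemma GUE L J (wt : 'I_L -> R) (y : 'I_L -> 'I_J -> R) : GU p' sp wt y =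
  \sum_m (if sp then \sum_j y m j `^ p' + wt m `^ p' * (\sum_j y m j ^+ 2) `^ (p' / 2)
    else (\sum_j y m j ^+ 2) `^ (p' / 2)).
Proof. by rewrite /GU; case: sp. Qed.

Lemma GVE L J (wt : 'I_L -> R) (y : 'I_L -> 'I_J -> R) : GV q sp wt y =
  \sum_m (if ~~ sp then \sum_j y m j `^ q + wt m `^ q * (\sum_j y m j ^+ 2) `^ (q / 2)
    else (\sum_j y m j ^+ 2) `^ (q / 2)).
Proof. by rewrite /GV; case: sp. Qed.

(** By Hölder's inequality the combination is bounded through the l_(p') norm of its coefficient
    vector, which the moment inequalities estimate by the gauge. *)
Lemma block_U : exists2 C, 1 <= C & forall (D : pred nat) L J (z : 'I_L -> 'I_J -> K) (x : X),
  modulus (\sum_m \sum_j z m j * ua D m j x) <=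
  C * ell_norm x * GU p' sp (fun m : 'I_L => wtD D m) (fun m j => modulus (z m j)) `^ p'^-1.
Proof.
have [C C1 hC] := synth pexp2.
exists C => // D L J z x; have x0 := ell_norm_ge0 x.
pose a (m : nat) (w : O m) : K := if insub m is Some o then
  (if D m then \sum_(j < J) z o j * ofreal (cf p' sp j w) else 0) else 0.
have -> : \sum_m \sum_j z m j * ua D m j x = \sum_(m < L) \sum_(w : O m) a m w * x (idx w).
  apply: eq_bigr => m _; rewrite /a /ua valK; case: (D m); last first.
    rewrite big1 => [|j _]; last by rewrite mulr0.
    by rewrite big1 => // w _; rewrite mul0r.
  under eq_bigr do rewrite mulr_sumr; rewrite exchange_big/=.
  by apply: eq_bigr => w _; rewrite mulr_suml; apply: eq_bigr => j _; rewrite mulrA.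
apply: le_trans (blocks_hoelder _ _ _ p'0 pp) _.
rewrite -mulrA mulrCA; apply: ler_wpM2l => //.
apply: le_trans (powR_const_le C1 _ (GU_ge0 _ _ _ _)); last by move: p'_1; exact: ltW.
apply: ler_pow; rewrite ?invr_ge0 ?(ltW p'0)//.
  by apply: sumr_ge0 => m _; apply: sumr_ge0 => *; exact: powR_ge0.
rewrite GUE mulr_sumr; apply: ler_sum => m _; rewrite /a valK /wtD; case: (D m).
  have := hC m J (z m); rewrite /rexp; case: sp => /=; exact.
rewrite big1 => [|w _]; last by rewrite modulus0 powR0// gt_eqF.
apply: mulr_ge0; first by lra.
case: sp; last exact: powR_ge0.
by apply: addr_ge0; rewrite ?mulr_ge0 ?powR_ge0// sumr_ge0// => *; exact: powR_ge0.
Qed.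

Lemma sum_bounded_le L L' (F : nat -> R) : (forall m, 0 <= F m) ->
  (forall m, (L <= m)%N -> F m = 0) -> \sum_(m < L') F m <= \sum_(m < L) F m.
Proof.
move=> F0 FL; rewrite -!(big_mkord xpredT F).
apply: le_trans (sum_trunc_le L' L F0); apply: ler_sum => m _.
by case: ltnP => // /FL->.
Qed.

Lemma level_vectors (x : R) (x1 : 1 <= x) (s : bool) : exists v : nat -> nat -> @ell R K x x1,
  forall m j k, v m j k = emb (fun m' (w : O m') => if m' == m then ofreal (cf x s j w) else 0) k.
Proof.
have x0 : 0 < x by exact: lt_le_trans x1.
suff h (t : nat * nat) : exists y : @ell R K x x1, forall k, y k =
    emb (fun m' (w : O m') => if m' == t.1 then ofreal (cf x s t.2 w) else 0) k.
  by have [f hf] := choice h; exists (fun m j => f (m, j)) => m j k; rewrite hf.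
case: t => [m j] /=.
pose S m' : R := \sum_(w : O m') modulus (ofreal (cf x s j w) : K) `^ x.
have S0 m' : 0 <= S m' by apply: sumr_ge0 => *; exact: powR_ge0.
have eP := @emb_pred R K d N x x1 (fun m' (w : O m') =>
   if m' == m then ofreal (cf x s j w) else 0) (S m `^ x^-1) (powR_ge0 _ _).
have hP L : \sum_(m0 < L) \sum_(w : O m0) modulus (if (m0 == m :> nat)
     then ofreal (cf x s j w) else 0 : K) `^ x <= (S m `^ x^-1) `^ x.
  rewrite powRVK ?gt_eqF//; apply: (@le_trans _ _ (\sum_(m0 < L) if m0 == m :> nat then S m0 else 0)).
    apply: ler_sum => m0 _; case: eqP => _ //=.
    by rewrite big1// => w _; rewrite modulus0 powR0// gt_eqF.
  rewrite -(big_mkord xpredT (fun m0 => if m0 == m then S m0 else 0)).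
  by rewrite -big_mkcond big_nat1_eq; case: ifP.
by exists (Ell x1 (eP hP)).
Qed.

Lemma co_xi (s : bool) m (w : O m) j :
  [\/ co (@xi R d s m) w j = 0, co (@xi R d s m) w j = 1 | co (@xi R d s m) w j = -1].
Proof.
rewrite /Omg in w *; elim: (N m) w => [|n IH] /=; first by move=> _; apply: Or31.
move=> [v w]; case: eqP => _; last exact: IH.
rewrite /xi /sgb; case: v => a [] /=; case: (s); try case: eqP => _;
  by [apply: Or31|apply: Or32|apply: Or33].
Qed.

(** The coordinates take only the values 0, 1 and -1, so every positive power of the modulus equals
    the square. Norms are thus read off biorthogonality. *)
Lemma cf_powR (x x' : R) (s : bool) m (w : O m) j : 0 < x -> x^-1 + x'^-1 = 1 ->
  modulus (ofreal (cf x s j w) : K) `^ x = cf x s j w * cf x' s j w.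
Proof.
move=> x0 xx; rewrite modulus_ofreal /cf mulrACA.
have v0 := vol_gt0 R d N s m.
have -> : nc d N x s m * nc d N x' s m = (vol R d N s m)^-1.
  rewrite /nc -powRD; last by rewrite (gt_eqF v0) implybT.
  by rewrite -opprD xx powR_inv1// ltW.
have n0 : 0 <= nc d N x s m by exact/ltW/nc_gt0.
have E : nc d N x s m `^ x = (vol R d N s m)^-1.
  by rewrite /nc -powRrM mulNr mulVf ?gt_eqF// powR_inv1// ltW.
by case: (co_xi s w j) => ->; rewrite ?mulr0 ?normr0 ?powR0 ?gt_eqF// ?mulr1 ?mulrNN
  ?mulr1 ?mulrN1 ?normrN ?ger0_norm.
Qed.

Lemma sum_cf_powR_le (x x' : R) (s : bool) m j : 0 < x -> x^-1 + x'^-1 = 1 ->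
  \sum_(w : O m) modulus (ofreal (cf x s j w) : K) `^ x <= 1.
Proof.
move=> x0 xx; under eq_bigr do rewrite (cf_powR _ _ _ x0 xx).
have [Nj|jN] := leqP (N m) j; last by rewrite biorthogonal// eqxx.
by rewrite big1// => w _; rewrite cf_out// mul0r.
Qed.

Lemma level_norm_le (x x' : R) (x1 : 1 <= x) (s : bool) (v : nat -> nat -> @ell R K x x1) :
  x^-1 + x'^-1 = 1 ->
  (forall m j k, v m j k = emb (fun m' (w : O m') => if m' == m then ofreal (cf x s j w) else 0) k) ->
  forall m j, ell_norm (v m j) <= 1.
Proof.
move=> xx vE m j; have x0 : 0 < x := lt_le_trans ltr01 x1.
apply: (emb_norm_le ler01 (vE m j)) => L; rewrite powR1.
apply: (@le_trans _ _ (\sum_(m0 < L) if m0 == m :> nat then 1 else 0)).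
  apply: ler_sum => m0 _; case: eqP => [->|_]; first exact: sum_cf_powR_le xx.
  by rewrite big1// => w _; rewrite modulus0 powR0// gt_eqF.
rewrite -(big_mkord xpredT (fun m0 => if m0 == m then 1 else 0)).
by rewrite -big_mkcond big_nat1_eq; case: ifP.
Qed.

Lemma block_vectors : exists2 v : pred nat -> nat -> nat -> Y, (forall D m j k, v D m j k =
    emb (fun m' (w : O m') => if (m' == m) && D m then ofreal (cf q (~~ sp) j w) else 0) k) &
  forall D m j, ell_norm (v D m j) <= 1.
Proof.
have [v vE] := level_vectors q1 (~~ sp).
exists (fun D m j => if D m then v m j else 0) => [D m j k|D m j]; case: (D m).
- by rewrite vE; have [[m0 [w ->]]|h] := emb_cases K d N k; rewrite ?h// !emb_idx andbT.
- by have [[m0 [w ->]]|h] := emb_cases K d N k; rewrite ?h// !emb_idx andbF.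
- exact: (level_norm_le qq vE).
- by rewrite ell_norm0.
Qed.

Lemma block_V : exists2 C, 1 <= C & forall (v : pred nat -> nat -> nat -> Y),
  (forall D m j k, v D m j k =
    emb (fun m' (w : O m') => if (m' == m) && D m then ofreal (cf q (~~ sp) j w) else 0) k) ->
  forall (D : pred nat) L J (z : 'I_L -> 'I_J -> K),
  ell_norm (\sum_m \sum_j z m j *: v D m j) <=
  C * GV q sp (fun m : 'I_L => wtD D m) (fun m j => modulus (z m j)) `^ q^-1.
Proof.
have [C C1 hC] := synth qexp2.
exists C => // v vE D L J z.
pose G (m : nat) (w : O m) : K := if insub m is Some o then
  (if D m then \sum_(j < J) z o j * ofreal (cf q (~~ sp) j w) else 0) else 0.
have cE k : (\sum_m \sum_j z m j *: v D m j) k = emb G k.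
  rewrite ell_sumE; under eq_bigr do rewrite ell_sumE.
  under eq_bigr do under eq_bigr do rewrite ellZ vE.
  have [[m0 [w ->]]|h] := emb_cases K d N k; last first.
    by rewrite h big1// => m _; rewrite big1// => j _; rewrite h mulr0.
  rewrite emb_idx /G; under eq_bigr do under eq_bigr do rewrite emb_idx.
  case: insubP => [u _ oE|m0L]; last first.
    rewrite big1// => m _; rewrite big1// => j _; case: eqP => /= [m0m|_]; last by rewrite mulr0.
    by rewrite m0m ltn_ord in m0L.
  rewrite (bigD1 u)//= oE eqxx/= [X in _ + X]big1 ?addr0; last first.
    move=> m mo; rewrite big1// => j _; have -> : (m0 == m) = false; last by rewrite mulr0.
    by apply/eqP; rewrite -oE => /val_inj um; rewrite um eqxx in mo.
  by case: (D m0) => //; rewrite big1// => j _; rewrite mulr0.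
have C0 : 0 <= C by lra.
apply: (emb_norm_le _ cE) => [|L']; first by rewrite mulr_ge0 ?powR_ge0.
apply: (@le_trans _ _ ((C * GV q sp (fun m : 'I_L => wtD D m) (fun m j => modulus (z m j))) `^ q^-1 `^ q)); last first.
  apply: ler_pow; rewrite ?(ltW q0) ?powR_ge0//.
  by apply: powR_const_le; rewrite ?GV_ge0.
rewrite powRVK ?gt_eqF// ?mulr_ge0 ?GV_ge0//.
apply: le_trans (@sum_bounded_le L L' (fun m => \sum_(w : O m) modulus (G m w) `^ q) _ _) _.
- by move=> m; apply: sumr_ge0 => *; exact: powR_ge0.
- move=> m mL; rewrite big1// => w _; rewrite /G insubF ?modulus0 ?powR0 ?gt_eqF//.
  by rewrite ltnNge mL.
rewrite GVE mulr_sumr; apply: ler_sum => m _; rewrite /G valK /wtD; case: (D m).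
  have := hC m J (z m); rewrite /rexp; case: sp => /=; exact.
rewrite big1 => [|w _]; last by rewrite modulus0 powR0// gt_eqF.
apply: mulr_ge0; first by lra.
case: (~~ sp); last exact: powR_ge0.
by apply: addr_ge0; rewrite ?mulr_ge0 ?powR_ge0// sumr_ge0// => *; exact: powR_ge0.
Qed.

(** Dual to [block_U]: wherever the Rosenthal blocks live, the coefficients of [x] belong to the l_p
    sum of l_2 spaces. *)
Lemma block_rows : exists2 C, 1 <= C & forall (D : pred nat) L J (x : X),
  \sum_(m < L) sqsum (fun (m : 'I_L) (j : 'I_J) => modulus (ua D m j x)) m `^ (p / 2) <=
  (C * ell_norm x) `^ p.
Proof.
have [C C1 hC] := block_U; exists (2 * C) => [|D L J x]; first by lra.
have C0 : 0 <= C * ell_norm x by rewrite mulr_ge0 ?ell_norm_ge0//; lra.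
have h := dual_U p'_1 C0 (lexx _) (fun z => hC D L J z x).
have t0 (m : 'I_L) (j : 'I_J) : 0 <= modulus (ua D m j x) by exact: modulus_ge0.
rewrite -mulrA; have [r2 rr r'1 r'2 r'e] := exponents p_1 p_q p'_1 q'_1 pp qq hsp.
move: (wtD_01 D) h r2 rr r'1 r'2; rewrite /GU /wtD /rexp /rexp'; case: sp => w01 h r2 rr r'1 r'2.
  exact: (special_sum_block r2 rr r'1 r'2 C0 t0 (fun m : 'I_L => w01 m) h).
have pp' : p'^-1 + p^-1 = 1 by rewrite addrC.
apply: le_trans (rademacher_sum_block p'_1 p_1 pp' C0 t0 h) _.
by apply: ler_pow; rewrite ?(ltW p0)//; lra.
Qed.

(** Serves as a common bound for the sizes of the first [L] blocks, and in [low_test] as their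
    number of vectors. *)
Definition width L := (\sum_(m < L) N m)%N.

Lemma tcoef_GV : exists2 C, 1 <= C & forall (D : pred nat) L J (x : X),
  (forall m, (m < L)%N -> (N m <= J)%N) ->
  \sum_(m < L) \sum_(w : O m) modulus (tcoef D x w) `^ q <=
  C * GV q sp (fun m : 'I_L => wtD D m) (fun m (j : 'I_J) => modulus (ua D m j x)).
Proof.
have [C C1 hC] := synth (qexp2).
exists C => // D L J x NJ.
rewrite GVE mulr_sumr; apply: ler_sum => m _.
have tE (w : O m) : tcoef D x w =
    if D m then \sum_(j < J) ua D m j x * ofreal (cf q (~~ sp) j w) else 0.
  rewrite /tcoef; case: ifP => // _.
  rewrite (big_ord_widen J (fun j => ua D m j x * ofreal (cf q (~~ sp) j w))) ?NJ//.
  rewrite big_mkcond; apply: eq_bigr => j _; case: ltnP => // Nj.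
  by rewrite cf_out// rmorph0 mulr0.
under eq_bigr do rewrite tE; rewrite /wtD; case Dm : (D m).
  have := hC m J (fun j => ua D m j x); rewrite /rexp; case: sp => /=; exact.
rewrite big1 => [|w _]; last by rewrite modulus0 powR0// gt_eqF.
apply: mulr_ge0; first by lra.
case: (~~ sp); last exact: powR_ge0.
by apply: addr_ge0; rewrite ?mulr_ge0 ?powR_ge0// sumr_ge0// => *; exact: powR_ge0.
Qed.

(** Both range gauges are dominated by the l_q sum of l_2 norms, and [p < q] lets the l_p sum of
    [block_rows] dominate that. *)
Lemma GV_le : exists2 C, 1 <= C & forall (D : pred nat) L J (x : X),
  GV q sp (fun m : 'I_L => wtD D m) (fun m (j : 'I_J) => modulus (ua D m j x)) <=
  C * ell_norm x `^ q.
Proof.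
have [C C1 hC] := block_rows; exists (2 * C `^ q) => [|D L J x].
  have : 1 <= C `^ q by have := ler_pow (ltW q0) ler01 C1; rewrite powR1.
  by lra.
have q2 := qexp2.
have C0 : 0 <= C by lra.
have m0 (m : 'I_L) (j : 'I_J) : 0 <= modulus (ua D m j x) by exact: modulus_ge0.
apply: (@le_trans _ _ (2 * \sum_(m < L)
    sqsum (fun (m : 'I_L) (j : 'I_J) => modulus (ua D m j x)) m `^ (q / 2))).
  move: q2 (wtD_01 D) m0; rewrite /GV; case: sp => /= q2 w01 m0.
    rewrite ler_peMl ?ler1n//; exact: gauge_r_ge0.
  exact: (gauge_s_le q2 m0 (fun m : 'I_L => w01 m)).
rewrite -mulrA ler_wpM2l//.
have -> : C `^ q * ell_norm x `^ q = ((C * ell_norm x) `^ p) `^ (q / p).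
  rewrite -powRrM mulrCA mulfV ?gt_eqF// mulr1 powRM//; exact: ell_norm_ge0.
apply: (@le_trans _ _ ((\sum_(m < L)
    sqsum (fun (m : 'I_L) (j : 'I_J) => modulus (ua D m j x)) m `^ (p / 2)) `^ (q / p))).
  under eq_bigr => m _.
    have -> : q / 2 = (p / 2) * (q / p) by field; rewrite gt_eqF.
    by rewrite powRrM; over.
  apply: powR_sum_ge => [|m]; last exact: powR_ge0.
  by rewrite ler_pdivlMr// mul1r ltW.
apply: ler_pow; rewrite ?divr_ge0 ?(ltW p0) ?(ltW q0)//.
by apply: sumr_ge0 => *; exact: powR_ge0.
Qed.

Lemma sum_le_width L m : (m < L)%N -> (N m <= width L)%N.
Proof. by move=> mL; rewrite /width (bigD1 (Ordinal mL))//= leq_addr. Qed.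

Lemma tcoef_bound : exists2 C, 1 <= C & forall (D : pred nat) L (x : X),
  \sum_(m < L) \sum_(w : O m) modulus (tcoef D x w) `^ q <= (C * ell_norm x) `^ q.
Proof.
have [C C1 hC] := tcoef_GV; have [C' C'1 hC'] := GV_le.
have CC : 1 <= C * C' by rewrite mulr_ege1.
exists ((C * C') `^ q^-1) => [|D L x].
  have qV : 0 <= q^-1 by rewrite invr_ge0 ltW.
  by have := ler_pow qV ler01 CC; rewrite powR1.
rewrite powRM ?powR_ge0 ?ell_norm_ge0// powRVK ?gt_eqF//; last by lra.
apply: le_trans (hC D L _ x (fun m => @sum_le_width L m)) _.
by rewrite -mulrA ler_wpM2l ?hC'//; lra.
Qed.

Lemma tcoef_linear (D : pred nat) a (x y : X) m (w : O m) :
  tcoef D (a *: x + y : X) w = a * tcoef D x w + tcoef D y w.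
Proof.
rewrite /tcoef; case: ifP => _; last by rewrite mulr0 addr0.
rewrite mulr_sumr -big_split/=; apply: eq_bigr => j _.
by rewrite ua_linear mulrDl mulrA.
Qed.

Lemma block_exists : exists2 C, 1 <= C & forall D : pred nat,
  exists2 T : bop X Y, is_block D T & opnorm T <= C.
Proof.
have [C C1 hC] := tcoef_bound; exists C => // D.
have C0 : 0 <= C by lra.
have Cx (x : X) : 0 <= C * ell_norm x by rewrite mulr_ge0 ?ell_norm_ge0.
pose f (x : X) : Y :=
  Ell q1 (@emb_pred R K d N q q1 (fun m w => tcoef D x w) _ (Cx x) (fun L => hC D L x)).
have fE x k : f x k = emb (tcoef D x) k by [].
have fl a x y : f (a *: x + y) = a *: f x + f y.
  apply/val_inj/funext => k; rewrite [LHS]fE [RHS](_ : _ = a * f x k + f y k)// !fE.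
  have [[m [w ->]]|h] := emb_cases K d N k; last by rewrite !h mulr0 addr0.
  by rewrite !emb_idx; exact: tcoef_linear.
have fC x : ell_norm (f x) <= C * ell_norm x.
  exact: (emb_norm_le (Cx x) (fE x) (fun L => hC D L x)).
exists (Bop (bop_exists fl fC)) => //; apply: opnorm_le => x x1 /=.
rewrite norm_ellE ler_ofreal; apply: le_trans (fC x) _.
by rewrite ler_piMr// -(ler_ofreal K) rmorph1 -norm_ellE.
Qed.

(** Flat coefficients have a small image as soon as the weights are small, by [special_small] or
    [rademacher_small] according to the side of the Rosenthal blocks. *)
Lemma GV_small (eps : R) : 0 < eps -> exists2 c, 0 < c & forall (D : pred nat) L J (x : X),
  ell_norm x <= 1 -> (forall m, wtD D m <= c) -> (forall m j, modulus (ua D m j x) <= c) ->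
  GV q sp (fun m : 'I_L => wtD D m) (fun m (j : 'I_J) => modulus (ua D m j x)) `^ q^-1 <= eps.
Proof.
move=> e0; have [C C1 hC] := block_U.
have C0 : 0 < C by lra.
have [r2 rr r'1 r'2 r'e] := exponents p_1 p_q p'_1 q'_1 pp qq hsp.
suff [c /andP[c0 c1] hc] : exists2 c, 0 < c <= 1 &
    forall (B J : finType) (wt : B -> R) (tau : B -> J -> R),
    (forall b, 0 <= wt b <= c) -> (forall b j, 0 <= tau b j <= c) ->
    (forall y, (forall b j, 0 <= y b j) ->
      \sum_b \sum_j y b j * tau b j <= C * GU p' sp wt y `^ p'^-1) ->
    GV q sp wt tau `^ q^-1 <= eps.
  exists c => // D L J x x1 wc uc; apply: hc => [m|m j|].
  - by rewrite wc; have /andP[->] := wtD_01 D m.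
  - by rewrite modulus_ge0 uc.
  have MM : 0 <= C * ell_norm x by rewrite mulr_ge0 ?ell_norm_ge0 ?(ltW C0).
  have CC : C * ell_norm x <= C by rewrite ler_piMr// ltW.
  exact: (dual_U p'_1 MM CC (fun z => hC D L J z x)).
move: hsp r2 rr r'1 r'2 r'e; rewrite /GU /GV /rexp /rexp' /eexp.
case: sp => hs r2 rr r'1 r'2 r'e.
  have [c c01 h] := special_small r2 rr r'1 r'2 r'e C0 e0.
  exact: (ex_intro2 _ _ c c01 h).
have pp' : p'^-1 + p^-1 = 1 by rewrite addrC.
have [c c01 h] := rademacher_small p'_1 hs pp' p_q C0 e0.
exact: (ex_intro2 _ _ c c01 h).
Qed.

Lemma block_small (eps : R) : 0 < eps -> exists2 c, 0 < c &
  forall (D : pred nat) (T : bop X Y) (x : X), is_block D T -> ell_norm x <= 1 ->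
  (forall m, wtD D m <= c) -> (forall m j, modulus (ua D m j x) <= c) -> ell_norm (T x) <= eps.
Proof.
move=> e0; have [C C1 hC] := tcoef_GV.
have eC : 0 < eps / C by rewrite divr_gt0//; lra.
have [c c0 hc] := GV_small eC; exists c => // D T x TD x1 wc uc.
apply: (emb_norm_le (ltW e0) (TD x)) => L.
apply: le_trans (hC D L _ x (fun m => @sum_le_width L m)) _.
have C0 : 0 <= C by lra.
apply: (@le_trans _ _ (C * (eps / C) `^ q)).
  rewrite ler_wpM2l// -[leLHS](powRVK (_ : q != 0)) ?gt_eqF ?GV_ge0//.
  by apply: ler_pow; rewrite ?powR_ge0 ?(ltW q0)//; exact: hc.
rewrite powRM ?invr_ge0 ?(ltW e0)// mulrCA ler_piMr ?powR_ge0//.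
have CV : 0 <= C^-1 <= 1 by rewrite invr_ge0 C0 invf_le1//; lra.
apply: (@le_trans _ _ (C * C^-1)); last by rewrite divff// gt_eqF//; lra.
rewrite ler_wpM2l// -[leRHS]powRr1; last by case/andP: CV.
by apply: ger_powR; rewrite ?invr_gt0 ?(andP CV).2 ?andbT//; lra.
Qed.

Lemma sum_block_vectors (v : pred nat -> nat -> nat -> Y) (D : pred nat) L (x : X) k :
  (forall D m j k, v D m j k =
    emb (fun m' (w : O m') => if (m' == m) && D m then ofreal (cf q (~~ sp) j w) else 0) k) ->
  (\sum_(m < L) \sum_(j < width L) ua D m j x *: v D m j) k =
  emb (fun m (w : O m) => if (m < L)%N then tcoef D x w else 0) k.
Proof.
move=> vE; rewrite ell_sumE; under eq_bigr do rewrite ell_sumE.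
under eq_bigr do under eq_bigr do rewrite ellZ vE.
have [[m0 [w ->]]|h] := emb_cases K d N k; last first.
  by rewrite h big1// => m _; rewrite big1// => j _; rewrite h mulr0.
rewrite emb_idx; under eq_bigr do under eq_bigr do rewrite emb_idx.
case: ltnP => m0L; last first.
  rewrite big1// => m _; rewrite big1// => j _; case: eqP => /= [m0m|_]; last by rewrite mulr0.
  by have := ltn_ord m; rewrite -[X in (X < _)%N]m0m ltnNge m0L.
rewrite (bigD1 (Ordinal m0L))//= eqxx/= [X in _ + X]big1 ?addr0; last first.
  move=> m mo; rewrite big1// => j _; have -> : (m0 == m) = false; last by rewrite mulr0.
  by apply: contraNF mo => /eqP m0m; apply/eqP/val_inj.
rewrite /tcoef; case: (D m0); last by rewrite big1// => j _; rewrite mulr0.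
rewrite (@big_ord_widen _ _ _ (N m0) (width L) (fun j => ua D m0 j x * ofreal (cf q (~~ sp) j w))); last exact: (sum_le_width m0L).
rewrite [RHS]big_mkcond; apply: eq_bigr => j _; case: ltnP => // Nj.
by rewrite cf_out// rmorph0 mulr0.
Qed.

Lemma block_presented : exists2 C, 1 <= C & forall (D : pred nat) (T : bop X Y) w,
  is_block D T -> (forall m, wtD D m <= w) -> presented p' sp C w T.
Proof.
have [C C1 hU] := block_U.
have [C' C'1 hV] := block_V.
have [v vE _] := block_vectors.
exists (Num.max C C') => [|D T w TD wD n x eps e0]; first by rewrite le_max C1.
have [n1 hn1] : exists n1, forall i, (i < n)%N -> forall y : Y,
    (forall k, (k < n1)%N -> y k = 0) -> (forall k, y k = T (x i) k \/ y k = 0) -> ell_norm y <= eps.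
  elim: n => [|n [L0 IH]]; first by exists 0%N.
  have [L1 h1] := ell_tail (T (x n)) e0; exists (maxn L0 L1) => i.
  rewrite ltnS leq_eqVlt => /predU1P[->|iN] y yL yx.
    by apply: h1 => // k kL; apply: yL; rewrite leq_max kL orbT.
  by apply: (IH i) => // k kL; apply: yL; rewrite leq_max kL.
pose tg k := if @pickle_inv {m : nat & O m} k is Some t then tag t else 0%N.
have tgi m (w' : O m) : tg (idx w') = m by rewrite /tg /idx pickleK_inv.
(* Enough levels to cover the first [n1] coordinates, beyond which the images of all [x i] are
   negligible. *)
pose L := (\max_(k < n1) tg k).+1.
have hL k : (k < n1)%N -> (tg k < L)%N.
  by move=> kn; rewrite ltnS; apply: (@leq_bigmax _ (fun k : 'I_n1 => tg k) (Ordinal kn)).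
exists 'I_L, 'I_(width L), (fun m : 'I_L => wtD D m),
  (fun (m : 'I_L) (j : 'I_(width L)) (x : X) => ua D m j x), (fun (m : 'I_L) (j : 'I_(width L)) => v D m j).
split=> [m|m j a y y'|z y|z|i iN].
- by rewrite wD; have /andP[->] := wtD_01 D m.
- exact: ua_linear.
- apply: le_trans (hU D L _ z y) _; rewrite ler_wpM2r ?powR_ge0// ler_wpM2r ?ell_norm_ge0//.
  by rewrite le_max lexx.
- apply: le_trans (hV v vE D L _ z) _; rewrite ler_wpM2r ?powR_ge0//.
  by rewrite le_max lexx orbT.
have dE k : (T (x i) - \sum_(m < L) \sum_(j < width L) ua D m j (x i) *: v D m j) k =
    T (x i) k - emb (fun m (w : O m) => if (m < L)%N then tcoef D (x i) w else 0) k.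
  by rewrite ellB sum_block_vectors.
apply: (hn1 i iN) => k => [kn|]; rewrite dE TD.
  have [[m [w' E]]|h] := emb_cases K d N k; last by rewrite !h subrr.
  by have := hL k kn; rewrite E tgi !emb_idx => ->; rewrite subrr.
have [[m [w' ->]]|h] := emb_cases K d N k; last by rewrite !h subrr; right.
by rewrite !emb_idx; case: ifP => _; [right; rewrite subrr|left; rewrite subr0].
Qed.

Lemma ua_bound : exists2 C, 1 <= C & forall (D : pred nat) m j (x : X),
  modulus (ua D m j x) <= C * ell_norm x.
Proof.
have [C C1 hC] := block_rows; exists C => // D m j x.
have C0 : 0 <= C * ell_norm x by rewrite mulr_ge0 ?ell_norm_ge0//; lra.
suff h : modulus (ua D m j x) `^ p <= (C * ell_norm x) `^ p.
  have pV : 0 <= p^-1 by rewrite invr_ge0 ltW.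
  have := ler_pow pV (powR_ge0 _ _) h.
  by rewrite !powRK ?gt_eqF ?modulus_ge0.
apply: le_trans (hC D m.+1 j.+1 x).
rewrite (bigD1 (ord_max : 'I_m.+1))//= -[leLHS]addr0; apply: lerD; last first.
  by apply: sumr_ge0 => *; exact: powR_ge0.
rewrite -powR_half ?modulus_ge0//; apply: ler_pow; rewrite ?sqr_ge0 ?divr_ge0 ?(ltW p0)//.
rewrite /sqsum (bigD1 (ord_max : 'I_j.+1))//= lerDl.
by apply: sumr_ge0 => *; exact: sqr_ge0.
Qed.

Lemma ua_null_family (D : pred nat) :
  null_family (fun (t : nat * nat) (x : X) => ua D t.1 t.2 x).
Proof.
split=> [t a x y||r]; first exact: ua_linear.
  have [C C1 hC] := ua_bound; exists C => [|t x]; last exact: hC.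
  by lra.
have [C C1 hC] := block_rows.
(* [P >= 2] gives [cnt <= cnt ^ (P / 2)], also when [p < 2]; [P >= p] makes the l_P sum of the block
   norms at most their l_p sum. *)
pose P := Num.max p 2; pose y := (C * `|r|) `^ P.
have [n hn] := nat_above y; exists n => x s us xr hs.
rewrite -(ler_nat R); apply: le_trans hn.
pose L := (\max_(t <- s) t.1).+1; pose J := (\max_(t <- s) t.2).+1.
have sL t : t \in s -> (t.1 < L)%N /\ (t.2 < J)%N.
  by move=> ts; rewrite !ltnS; split; exact: leq_bigmax_seq.
pose cnt (m : 'I_L) : nat := (\sum_(j < J) ((val m, val j) \in s))%N.
have sS : (size s <= \sum_(m < L) cnt m)%N.
  pose S := [set t : 'I_L * 'I_J | (val t.1, val t.2) \in s]%SET.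
  have -> : (\sum_(m < L) cnt m = #|S|)%N.
    rewrite /cnt pair_big/= -sum1dep_card [RHS]big_mkcond; apply: eq_bigr => t _.
    by rewrite /S; case: (_ \in s).
  rewrite cardE -(size_map (fun t : 'I_L * 'I_J => (val t.1, val t.2))).
  apply: uniq_leq_size => // t ts; have [tL tJ] := sL t ts.
  apply/mapP; exists (Ordinal tL, Ordinal tJ) => /=; last by case: (t).
  by rewrite mem_enum inE /=; case: (t) ts.
have a1 : 1 <= P / 2 by rewrite ler_pdivlMr// mul1r /P le_max lexx orbT.
have cP (m : 'I_L) : (cnt m)%:R <=
    sqsum (fun (m : 'I_L) (j : 'I_J) => modulus (ua D m j x)) m `^ (P / 2).
  apply: (@le_trans _ _ ((cnt m)%:R `^ (P / 2))).
    case: (cnt m) => [|k]; first exact: powR_ge0.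
    have k1 : 1 <= k.+1%:R :> R by rewrite ler1n.
    by rewrite -[leLHS]powRr1 ?ler_powR//; lra.
  apply: ler_pow; [lra|exact: ler0n|].
  rewrite natr_sum; apply: ler_sum => j _; case E : (_ \in s) => /=; last exact: sqr_ge0.
  have := hs _ E => /= h; rewrite expr2.
  by apply: le_trans (h) _; rewrite ler_peMr ?modulus_ge0.
apply: (@le_trans _ _ (\sum_(m < L) cnt m)%N%:R); first by rewrite ler_nat.
rewrite natr_sum; apply: le_trans (ler_sum _ (fun m _ => cP m)) _.
have pP : p <= P by rewrite /P le_max lexx.
apply: (@le_trans _ _ ((\sum_(m < L)
    sqsum (fun (m : 'I_L) (j : 'I_J) => modulus (ua D m j x)) m `^ (p / 2)) `^ (P / p))).
  under eq_bigr => m _.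
    have -> : P / 2 = (p / 2) * (P / p) by field; rewrite gt_eqF.
    by rewrite powRrM; over.
  apply: powR_sum_ge => [|m]; last exact: powR_ge0.
  by rewrite ler_pdivlMr// mul1r.
have P0 : 0 <= P by apply: le_trans pP; exact: ltW.
apply: (@le_trans _ _ (((C * ell_norm x) `^ p) `^ (P / p))).
  apply: ler_pow; rewrite ?divr_ge0 ?(ltW p0)//.
  by apply: sumr_ge0 => *; exact: powR_ge0.
have C0 : 0 <= C by lra.
rewrite -powRrM mulrCA mulfV ?gt_eqF// mulr1.
apply: ler_pow => //; first by rewrite mulr_ge0 ?ell_norm_ge0.
by rewrite ler_wpM2l// (le_trans xr)// ler_norm.
Qed.

Lemma is_blockD (D1 D2 D : pred nat) (T1 T2 T : bop X Y) :
  (forall m, ~~ (D1 m && D2 m)) -> (forall m, D m = D1 m || D2 m) ->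
  is_block D1 T1 -> is_block D2 T2 -> is_block D T -> forall x, T x = T1 x + T2 x.
Proof.
move=> D12 DE T1D T2D TD x; apply/val_inj/funext => k; rewrite [LHS]TD [RHS](_ : _ = T1 x k + T2 x k)// T1D T2D.
have [[m [w ->]]|h] := emb_cases K d N k; last by rewrite !h addr0.
rewrite !emb_idx /tcoef /ua DE; have := D12 m.
by case: (D1 m); case: (D2 m) => //= _; rewrite ?addr0 ?add0r.
Qed.

(** The levels below [m0] give an operator of finite rank, bounded through the functionals
    themselves; on the remaining ones the weights are small and [block_small] applies. *)
Lemma block_controlled (D : pred nat) (T : bop X Y) :
  (forall e : R, 0 < e -> exists m0, forall m, (m0 <= m)%N -> weight d rexp m <= e) ->
  is_block D T -> controlled T.
Proof.
move=> w0 TD eps e0; exists (nat * nat)%type, (fun t x => ua D t.1 t.2 x).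
split; first exact: ua_null_family.
have [C C1 hC] := block_exists.
have [c c0 hc] := block_small e0.
have [m0 hm0] := w0 c c0.
pose D1 m := D m && (m < m0)%N; pose D2 m := D m && (m0 <= m)%N.
have [T1 T1D T1C] := hC D1; have [T2 T2D T2C] := hC D2.
have TE x : T x = T1 x + T2 x.
  apply: (is_blockD _ _ T1D T2D TD) => m; rewrite /D1 /D2 ltnNge; first by case: (D m); case: (m0 <= m)%N.
  by case: (D m); case: (m0 <= m)%N.
have [v vE _] := block_vectors.
have uD P m j (x : X) : modulus (ua (fun m => D m && P m) m j x) <= modulus (ua D m j x).
  by rewrite /ua; case: (D m); case: (P m); rewrite //= modulus0 modulus_ge0.
pose B := \sum_(m < m0) \sum_(j < width m0) ell_norm (v D1 m j).
have B0 : 0 <= B by apply: sumr_ge0 => m _; apply: sumr_ge0 => j _; exact: ell_norm_ge0.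
have C0 : 0 <= C / c by rewrite divr_ge0//; lra.
exists (B + C / c) => [|x a a0 ha]; first exact: addr_ge0.
rewrite TE; apply: le_trans (ell_normD _ _) _.
have T1x : T1 x = \sum_(m < m0) \sum_(j < width m0) ua D1 m j x *: v D1 m j.
  apply/val_inj/funext => k; rewrite [LHS]T1D [RHS](sum_block_vectors D1 m0 x k vE)//.
  have [[m [w ->]]|h] := emb_cases K d N k; last by rewrite !h.
  by rewrite !emb_idx /tcoef /D1; case: ltnP => //; rewrite andbF.
have h1 : ell_norm (T1 x) <= B * a.
  rewrite T1x; apply: le_trans (ell_norm_sum _ _ _) _; rewrite mulr_suml.
  apply: ler_sum => m _; apply: le_trans (ell_norm_sum _ _ _) _; rewrite mulr_suml.
  apply: ler_sum => j _; rewrite ell_normZ mulrC ler_wpM2l ?ell_norm_ge0//.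
  by apply: le_trans (uD _ _ _ _) _; exact: (ha (_, _)).
have h2 : ell_norm (T2 x) <= eps * ell_norm x + C / c * a.
  (* Either [a] is so large against the norm of [x] that [C / c * a] absorbs the trivial bound, or
     the normalized [x] has all its coefficients at most [c]. *)
  have [ac|ac] := ltP (c * ell_norm x) a.
    apply: (@le_trans _ _ (C * ell_norm x)).
      by apply: le_trans (bop_norm_le _ _) _; rewrite ler_wpM2r ?ell_norm_ge0.
    rewrite -[leLHS]add0r lerD ?mulr_ge0 ?ell_norm_ge0 ?(ltW e0)//.
    rewrite -mulrA ler_wpM2l//; first by lra.
    by rewrite ler_pdivlMl// ltW.
  rewrite -[leLHS]addr0 lerD ?(mulr_ge0 C0 a0)//.
  have [x0|x0] := eqVneq (ell_norm x) 0.
    by rewrite (ell_norm0_eq0 x0) linear0 !ell_norm0 mulr0.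
  have xp : 0 < ell_norm x by rewrite lt_neqAle eq_sym x0 ell_norm_ge0.
  have sV : 0 <= (ell_norm x)^-1 by rewrite invr_ge0 ell_norm_ge0.
  have := hc D2 T2 (ofreal (ell_norm x)^-1 *: x) T2D.
  rewrite linearZ !ell_normZ modulus_ofreal ger0_norm// mulVf// ler_pdivrMl// mulrC; apply=> //.
    move=> m; rewrite /wtD /D2; case: (D m); rewrite /= ?(ltW c0)//.
    by case: ifP => [/hm0|_]; rewrite ?(ltW c0).
  move=> m j; have [_ uZ _] := functional_linear (@ua_linear D2 m j).
  rewrite uZ modulusM modulus_ofreal ger0_norm// ler_pdivrMl// mulrC.
  by apply: le_trans (uD _ _ _ _) _; apply: le_trans ac; exact: (ha (_, _)).
by apply: le_trans (lerD h1 h2) _; apply: eq_ler; ring.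
Qed.

Definition level_functional n i (y : Y) : K := \sum_(w : O n) ofreal (cf q' (~~ sp) i w) * y (idx w).

(** The loss [W] of [test_system]: [rexp' < 2] makes the exponent in [weight] negative. *)
Definition level_weight n : R := weight d rexp' n.

Definition level_vector (r : nat -> nat -> X) := forall n i k,
  r n i k = emb (fun m (w : O m) => if m == n then ofreal (cf p sp i w) else 0) k.

Lemma level_weight_ge1 n : 1 <= level_weight n.
Proof.
have [r2 rr r'1 r'2 r'e] := exponents p_1 p_q p'_1 q'_1 pp qq hsp.
rewrite /level_weight /weight.
have -> : 2^-1 - rexp'^-1 = - (rexp'^-1 - 2^-1) by rewrite opprB.
rewrite powRN invf_ge1 ?powR_gt0 ?dl_gt0//.
apply: (@le_trans _ _ (dl R d true n `^ 0)); last by rewrite powRr0.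
apply: ger_powR; first by rewrite dl_gt0 dl_le1.
by rewrite subr_ge0 lef_pV2 ?posrE//; lra.
Qed.

Lemma root_le (C w S x : R) : 1 <= C -> 1 <= x -> 0 <= w -> 0 <= S ->
  (C * (w `^ x * S `^ (x / 2))) `^ x^-1 <= C * w * S `^ 2^-1.
Proof.
move=> C1 x1 w0 S0; have x0 : 0 < x by lra.
apply: le_trans (powR_const_le C1 x1 (mulr_ge0 (powR_ge0 _ _) (powR_ge0 _ _))) _.
rewrite powRM ?powR_ge0// powRK ?gt_eqF// -powRrM mulrA; apply: eq_ler; congr (_ * _ `^ _).
by field; rewrite gt_eqF.
Qed.

Lemma synth_level (x : R) (s : bool) : 1 <= x -> (s -> x <= 2) ->
  exists2 C, 1 <= C & forall n (a : nat -> K),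
    (\sum_(w : O n) modulus (\sum_(0 <= i < N n) a i * ofreal (cf x s i w)) `^ x) `^ x^-1 <=
    C * (if s then weight d x n else 1) * (\sum_(0 <= i < N n) modulus (a i) ^+ 2) `^ 2^-1.
Proof.
move=> x1 sx; have x0 : 0 < x by lra.
have S0 n (a : nat -> K) : 0 <= \sum_(i < N n) modulus (a i) ^+ 2.
  by apply: sumr_ge0 => *; exact: sqr_ge0.
have P0 n (a : nat -> K) : 0 <= \sum_(w : O n) modulus (\sum_(i < N n) a i * ofreal (cf x s i w)) `^ x.
  by apply: sumr_ge0 => *; exact: powR_ge0.
case: s sx P0 => sx P0.
  exists 1 => // n a; have x02 : 0 < x <= 2 by rewrite x0 sx.
  have h := synth_dual hK d N n (fun i : 'I_(N n) => a i) x02.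
  have -> : \sum_(0 <= i < N n) modulus (a i) ^+ 2 = \sum_(i < N n) modulus (a i) ^+ 2.
    by rewrite big_mkord.
  apply: le_trans (root_le (lexx 1) x1 (weight_ge0 d x n) (S0 n a)).
  under eq_bigr do rewrite big_mkord.
  by apply: ler_pow; rewrite ?P0 ?invr_ge0 ?(ltW x0)// mul1r.
have [C C1 hC] := synth_rad hK d N x1; exists C => // n a.
have -> : \sum_(0 <= i < N n) modulus (a i) ^+ 2 = \sum_(i < N n) modulus (a i) ^+ 2.
  by rewrite big_mkord.
apply: le_trans (root_le C1 x1 ler01 (S0 n a)).
under eq_bigr do rewrite big_mkord.
by apply: ler_pow; rewrite ?P0 ?invr_ge0 ?(ltW x0)// powR1 mul1r.
Qed.

Let q'0 : 0 < q'. Proof. exact: lt_trans q'_1. Qed.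

Lemma level_hoelder (c : forall m, O m -> K) n (y : Y) :
  modulus (\sum_(w : O n) c n w * y (idx w)) <=
  ell_norm y * (\sum_(w : O n) modulus (c n w) `^ q') `^ q'^-1.
Proof.
have := blocks_hoelder y n.+1 (fun m (w : O m) => if m == n then c m w else 0) q'0 qq.
rewrite big_ord_recr/= eqxx big1 ?add0r => [|m _]; last first.
  by rewrite big1// => w _; rewrite ltn_eqF ?ltn_ord// mul0r.
by rewrite big_ord_recr/= eqxx [X in X + _]big1 ?add0r// => m _;
  rewrite big1// => w _; rewrite ltn_eqF ?ltn_ord// modulus0 powR0// gt_eqF.
Qed.

Lemma level_functional_linear n i a (x y : Y) : level_functional n i (a *: x + y) = a * level_functional n i x + level_functional n i y.
Proof.
rewrite /level_functional mulr_sumr -big_split/=; apply: eq_bigr => w _.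
by rewrite [X in _ * X](_ : _ = a * x (idx w) + y (idx w))// mulrDr mulrCA.
Qed.

Lemma level_test : exists2 C, 1 <= C & forall r, level_vector r ->
  forall n, test_system sp C (level_weight n) (N n) (r n) (level_functional n).
Proof.
have [r2 rr r'1 r'2 r'e] := exponents p_1 p_q p'_1 q'_1 pp qq hsp.
have sp2 : sp -> p <= 2 by move: hsp; case: sp => // + _; exact: ltW.
have sp2' : ~~ sp -> q' <= 2 by move: r'2; rewrite /rexp'; case: sp => // + _; exact: ltW.
have [C1 C11 h1] := synth_level p1 sp2.
have [C2 C21 h2] := synth_level (ltW q'_1) sp2'.
exists (Num.max C1 C2) => [|r rE n]; first by rewrite le_max C11.
have S0 (a : nat -> K) : 0 <= (\sum_(0 <= i < N n) modulus (a i) ^+ 2) `^ 2^-1 by exact: powR_ge0.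
have W0 : 0 <= level_weight n by exact: weight_ge0.
have M1 : 1 <= Num.max C1 C2 by rewrite le_max C11.
split=> [i a x y|i _|i y _|a|a y].
- exact: level_functional_linear.
- by apply: le_trans (level_norm_le pp rE n i) M1.
- apply: le_trans (level_hoelder (fun m w => ofreal (cf q' (~~ sp) i w)) n y) _.
  rewrite mulrC ler_wpM2r ?ell_norm_ge0//; apply: le_trans M1.
  have qV : 0 <= q'^-1 by rewrite invr_ge0 ltW.
  have qq' : q'^-1 + q^-1 = 1 by rewrite addrC.
  have s0 : 0 <= \sum_(w : O n) modulus (ofreal (cf q' (~~ sp) i w) : K) `^ q'.
    by apply: sumr_ge0 => *; exact: powR_ge0.
  by have := ler_pow qV s0 (sum_cf_powR_le (~~ sp) n i q'0 qq'); rewrite powR1.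
- have E k : (\sum_(0 <= i < N n) a i *: r n i) k = emb (fun m (w : O m) =>
      if m == n then \sum_(0 <= i < N n) a i * ofreal (cf p sp i w) else 0) k.
    rewrite ell_sumE; under eq_bigr do rewrite ellZ rE.
    have [[m [w ->]]|h] := emb_cases K d N k.
      rewrite emb_idx; under eq_bigr do rewrite emb_idx.
      by case: (m == n) => //; rewrite big1// => i _; rewrite mulr0.
    by rewrite h big1// => i _; rewrite h mulr0.
  have B0 : 0 <= C1 * (if sp then level_weight n else 1) * (\sum_(0 <= i < N n) modulus (a i) ^+ 2) `^ 2^-1.
    rewrite !mulr_ge0//; [by lra|by case: ifP].
  apply: (@le_trans _ _ (C1 * (if sp then level_weight n else 1) * (\sum_(0 <= i < N n) modulus (a i) ^+ 2) `^ 2^-1)).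
    apply: (emb_norm_le B0 E) => L.
    apply: (@le_trans _ _ (\sum_(w : O n) modulus (\sum_(0 <= i < N n) a i * ofreal (cf p sp i w)) `^ p)).
      have s0 : 0 <= \sum_(w : O n) modulus (\sum_(0 <= i < N n) a i * ofreal (cf p sp i w)) `^ p.
        by apply: sumr_ge0 => *; exact: powR_ge0.
      pose F m := \sum_(w : O m) modulus (\sum_(0 <= i < N n) a i * ofreal (cf p sp i w)) `^ p.
      apply: (@le_trans _ _ (\sum_(m < L) if m == n :> nat then F m else 0)).
        apply: ler_sum => m _; case: eqP => // _.
        by rewrite big1// => w _; rewrite modulus0 powR0// gt_eqF.
      rewrite -(big_mkord xpredT (fun m => if m == n then F m else 0)).
      by rewrite -big_mkcond big_nat1_eq; case: ifP.
    rewrite -[leLHS](powRVK (_ : p != 0)) ?gt_eqF//; last first.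
      by apply: sumr_ge0 => *; exact: powR_ge0.
    apply: ler_pow; rewrite ?powR_ge0 ?(ltW p0)//.
    apply: le_trans (h1 n a) _; rewrite /level_weight /rexp'.
    by case: (sp).
  rewrite ler_wpM2r// ler_wpM2r ?le_max ?lexx//; by case: ifP.
- have -> : \sum_(0 <= i < N n) a i * level_functional n i y =
      \sum_(w : O n) (\sum_(0 <= i < N n) a i * ofreal (cf q' (~~ sp) i w)) * y (idx w).
    rewrite /level_functional; under eq_bigr do rewrite mulr_sumr.
    rewrite exchange_big/=; apply: eq_bigr => w _; rewrite mulr_suml.
    by apply: eq_bigr => i _; rewrite mulrA.
  apply: le_trans (level_hoelder (fun m w => \sum_(0 <= i < N n) a i * ofreal (cf q' (~~ sp) i w)) n y) _.
  rewrite mulrC ler_wpM2r ?ell_norm_ge0//; apply: le_trans (h2 n a) _.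
  rewrite ler_wpM2r//; apply: ler_pM; rewrite ?le_max ?lexx ?orbT//; first by lra.
    by case: ifP => // _; exact: weight_ge0.
  by rewrite /level_weight /rexp'; case: (sp).
Qed.

Lemma level_exact (D : pred nat) (T : X -> Y) r n : level_vector r -> is_block D T -> D n ->
  \sum_(0 <= i < N n) level_functional n i (T (r n i)) = (N n)%:R.
Proof.
move=> rE TD Dn; rewrite -[RHS]mulr1 mulr_natl -[in RHS](subn0 (N n)) -sumr_const_nat.
apply: eq_big_nat => i /andP[_ iN].
have uE (j : nat) : (j < N n)%N -> ua D n j (r n i) = (j == i)%:R.
  move=> jN; rewrite /ua Dn; under eq_bigr do rewrite rE emb_idx eqxx -rmorphM.
  by rewrite -rmorph_sum biorthogonal ?rmorph_nat// addrC.
rewrite /level_functional; under eq_bigr => w _.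
  rewrite TD emb_idx /tcoef Dn (bigD1 (Ordinal iN))//= big1 ?addr0; last first.
    by move=> j ji; rewrite uE// -[X in _ == X]/(val (Ordinal iN)) val_eqE (negbTE ji) mul0r.
  rewrite uE// eqxx mul1r -rmorphM; over.
by rewrite -rmorph_sum biorthogonal ?eqxx ?rmorph1// addrC.
Qed.

(** Below level [n] the operator is a sum of [n * width n] operators of rank at most one.
    Cauchy-Schwarz bounds the unnormalized test of each by a multiple of [level_weight n],
    independently of [N n], so that a large [N n] makes the average small. *)
Lemma low_test (A : bop Y Y) (B : bop X X) : exists2 C, 0 <= C & forall (D : pred nat) (T : bop X Y) r n,
  level_vector r -> is_block D T -> (forall m, D m -> (m < n)%N) ->
  modulus (\sum_(0 <= i < N n) level_functional n i (A (T (B (r n i))))) <= (n * width n)%:R * (C * level_weight n).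
Proof.
have [C C1 hC] := level_test.
have [Cu Cu1 hCu] := ua_bound.
set nA := opnorm A; set nB := opnorm B.
have nA0 : 0 <= nA by exact: opnorm_ge0.
have nB0 : 0 <= nB by exact: opnorm_ge0.
have C0 : 0 <= C by lra.
have Cu0 : 0 <= Cu by lra.
exists (Cu * nB * C * (C * nA)) => [|D T r n rE TD Dn]; first by rewrite !mulr_ge0.
have [gl _ _ rsum gsum] := hC r rE n.
have [v vE v1] := block_vectors.
have W0 : 0 <= level_weight n by exact: weight_ge0.
have g0 i : level_functional n i 0 = 0 by have [] := functional_linear (gl i).
have gZ i a y : level_functional n i (a *: y) = a * level_functional n i y by have [] := functional_linear (gl i).
have gD i x y : level_functional n i (x + y) = level_functional n i x + level_functional n i y by have [] := functional_linear (gl i).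
have gsumE i (F : finType) (G : F -> Y) : level_functional n i (\sum_t G t) = \sum_t level_functional n i (G t).
  by elim/big_rec2 : _ => // t y x _ <-; rewrite gD.
have Tx x : T x = \sum_(m < n) \sum_(j < width n) ua D m j x *: v D m j.
  apply/val_inj/funext => k; rewrite [LHS]TD [RHS](sum_block_vectors D n x k vE)//.
  have [[m [w ->]]|h] := emb_cases K d N k; last by rewrite !h.
  rewrite !emb_idx; case: ltnP => // nm; rewrite /tcoef; case: ifP => // /Dn.
  by rewrite ltnNge nm.
have -> : \sum_(0 <= i < N n) level_functional n i (A (T (B (r n i)))) =
    \sum_(m < n) \sum_(j < width n) \sum_(0 <= i < N n) ua D m j (B (r n i)) * level_functional n i (A (v D m j)).
  under eq_bigr do rewrite Tx linear_sum gsumE.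
  rewrite exchange_big/=; apply: eq_bigr => m _.
  under eq_bigr do rewrite linear_sum gsumE.
  rewrite exchange_big/=; apply: eq_bigr => j _.
  by apply: eq_bigr => i _; rewrite linearZ gZ.
have hmj m j : modulus (\sum_(0 <= i < N n) ua D m j (B (r n i)) * level_functional n i (A (v D m j))) <=
    Cu * nB * C * (C * nA) * level_weight n.
  apply: le_trans (sum_cauchy_schwarz _ _ _) _.
  have [u0 uZ uD] := functional_linear (@ua_linear D m j).
  have Ws : 0 <= (if sp then level_weight n else 1) by case: ifP.
  have Ws' : 0 <= (if sp then 1 else level_weight n) by case: ifP.
  have -> : Cu * nB * C * (C * nA) * level_weight n =
      (Cu * nB * (C * (if sp then level_weight n else 1))) * (C * (if sp then 1 else level_weight n) * nA).
    by case: (sp); ring.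
  apply: ler_pM; [exact: powR_ge0|exact: powR_ge0| |].
    apply: sum_l2_dual => [|a]; first by rewrite !mulr_ge0.
    have -> : \sum_(0 <= i < N n) ua D m j (B (r n i)) * a i = ua D m j (B (\sum_(0 <= i < N n) a i *: r n i)).
      elim/big_rec2 : _ => [|i x y _ ->]; first by rewrite linear0 u0.
      by rewrite linearD linearZ uD uZ mulrC.
    apply: le_trans (hCu _ _ _ _) _; rewrite -!mulrA ler_wpM2l//.
    apply: le_trans (bop_norm_le B _) _; rewrite -/nB ler_wpM2l//.
    by apply: le_trans (rsum a) _; rewrite mulrA.
  apply: sum_l2_dual => [|a]; first by rewrite !mulr_ge0.
  under eq_bigr do rewrite mulrC.
  apply: le_trans (gsum a _) _; rewrite [leRHS]mulrAC ler_wpM2l ?mulr_ge0 ?powR_ge0//.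
  apply: le_trans (bop_norm_le A _) _.
  by rewrite -/nA -[leRHS]mulr1 ler_wpM2l.
apply: le_trans (modulus_sum _ _ _) _.
apply: (@le_trans _ _ (\sum_(m < n) \sum_(j < width n) (Cu * nB * C * (C * nA) * level_weight n))).
  by apply: ler_sum => m _; apply: le_trans (modulus_sum _ _ _) _; apply: ler_sum.
rewrite !sumr_const !card_ord -mulrnA mulnC -[_ *+ _]mulr_natl.
by rewrite mulrA.
Qed.

Lemma presented_weaken C C' w (S : bop X Y) : C <= C' ->
  presented p' sp C w S -> presented p' sp C' w S.
Proof.
move=> CC h n x eps e0; have [I [J [wt [u [v [h1 h2 h3 h4 h5]]]]]] := h n x eps e0.
exists I, J, wt, u, v; split=> // z; [move=> y|].
  by apply: le_trans (h3 z y) _; rewrite ler_wpM2r ?powR_ge0// ler_wpM2r// ell_norm_ge0.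
by apply: le_trans (h4 z) _; rewrite ler_wpM2r ?powR_ge0.
Qed.

Lemma test_weaken C C' W0 n r (f : nat -> Y -> K) : C <= C' -> 0 <= W0 ->
  test_system sp C W0 n r f -> @test_system R K p q p1 q1 sp C' W0 n r f.
Proof.
move=> CC w0 [h1 h2 h3 h4 h5].
have W1 : 0 <= (if sp then W0 else 1) by case: ifP.
have W2 : 0 <= (if sp then 1 else W0) by case: ifP.
split=> // [i iN|i y iN|a|a y].
- exact: le_trans (h2 i iN) CC.
- by apply: le_trans (h3 i y iN) _; rewrite ler_wpM2r ?ell_norm_ge0.
- by apply: le_trans (h4 a) _; rewrite ler_wpM2r ?powR_ge0// ler_wpM2r.
- by apply: le_trans (h5 a y) _; rewrite ler_wpM2r ?ell_norm_ge0// ler_wpM2r ?powR_ge0// ler_wpM2r.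
Qed.

(* [growth_low] disposes of the levels below [n] by counting them, and [growth_high] of those above [n],
   whose weights are negligible at the scale [N n]. *)
Record growth : Prop := Growth {
  growth_gt0 : forall n, (0 < N n)%N;
  growth_weight : forall e : R, 0 < e -> exists n0, forall n, (n0 <= n)%N -> weight d rexp n <= e;
  growth_high : forall e : R, 0 < e -> exists n0, forall n m, (n0 <= n)%N -> (n < m)%N ->
    weight d rexp m * (N n)%:R <= e;
  growth_gain : forall e : R, 0 < e -> exists n0, forall n, (n0 <= n)%N ->
    level_weight n * (N n)%:R `^ gain p q p' q' sp <= e;
  growth_low : forall e : R, 0 < e -> exists n0, forall n, (n0 <= n)%N ->
    (n * width n)%:R * level_weight n <= e * (N n)%:R }.

Hypothesis hgrow : growth.

Definition test r (S : bop X Y) (A : bop Y Y) (B : bop X X) n : R :=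
  modulus (\sum_(0 <= i < N n) level_functional n i (A (S (B (r n i))))) / (N n)%:R.

(** Level [n] being absent, [T] is the sum of the part below, settled by [low_test], and the part
    above, whose weights are at most [c / N n], as [test_presented] requires. *)
Lemma test_off r (A : bop Y Y) (B : bop X X) (eps : R) : level_vector r -> 0 < eps ->
  exists n0, forall n (D : pred nat) (T : bop X Y), (n0 <= n)%N -> is_block D T -> ~~ D n ->
  test r T A B n <= eps.
Proof.
move=> rE e0; have [N0 gw gh gg glow] := hgrow.
have [C1 C11 h1] := level_test.
have [C2 C21 h2] := block_presented.
have [CT CT1 hT] := block_exists.
have [C3 C30 h3] := low_test A B.
have [C C1C C2C] : exists2 C, C1 <= C & C2 <= C.
  by exists (Num.max C1 C2); rewrite le_max lexx// orbT.
have Cge1 : 1 <= C by exact: le_trans C1C.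
have e2 : 0 < eps / 2 by rewrite divr_gt0.
have [c c0 hc] := test_presented hK p_1 p_q p'_1 q'_1 pp qq hsp A B Cge1 e2.
have e3 : 0 < eps / 2 / (C3 + 1) by rewrite divr_gt0//; lra.
have [na hna] := gh c c0; have [nb hnb] := gg c c0; have [nl hnl] := glow _ e3.
exists (maxn na (maxn nb nl)) => n D T; rewrite !geq_max => /and3P[an bn ln] TD Dn.
have Nn : 0 < (N n)%:R :> R by rewrite ltr0n.
rewrite /test ler_pdivrMr//.
pose D1 m := D m && (m < n)%N; pose D2 m := D m && (n < m)%N.
have [T1 T1D _] := hT D1; have [T2 T2D _] := hT D2.
have TE x : T x = T1 x + T2 x.
  apply: (is_blockD _ _ T1D T2D TD) => m; rewrite /D1 /D2; case: (ltngtP m n) => mn; rewrite ?andbF ?andbT ?orbF//.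
  by rewrite mn (negbTE Dn).
have gl i : forall a x y, level_functional n i (a *: x + y) = a * level_functional n i x + level_functional n i y.
  by move=> a x y; exact: level_functional_linear.
have -> : \sum_(0 <= i < N n) level_functional n i (A (T (B (r n i)))) =
    \sum_(0 <= i < N n) level_functional n i (A (T1 (B (r n i)))) + \sum_(0 <= i < N n) level_functional n i (A (T2 (B (r n i)))).
  rewrite -big_split/=; apply: eq_bigr => i _; rewrite TE linearD.
  by have [_ _ gD] := functional_linear (gl i); rewrite gD.
have -> : eps * (N n)%:R = eps / 2 * (N n)%:R + eps / 2 * (N n)%:R by rewrite -mulrDl -splitr.
apply: le_trans (modulusD _ _) _; apply: lerD.
  have D1n m : D1 m -> (m < n)%N by move=> /andP[].
  apply: le_trans (h3 D1 T1 r n rE T1D D1n) _.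
  rewrite mulrCA; apply: le_trans (ler_wpM2l C30 (hnl n ln)) _.
  rewrite mulrA ler_wpM2r ?(ltW Nn)// mulrCA ler_piMr ?(ltW e2)//.
  by rewrite ler_pdivrMr ?mul1r ?lerDl// ltr_wpDl.
have wpos m : wtD D2 m <= c / (N n)%:R.
  rewrite /wtD; case: ifP => [|_]; last by rewrite divr_ge0 ?ltW.
  by case/andP => _ nm; rewrite ler_pdivlMr//; exact: hna.
apply: (hc (N n) (level_weight n) (c / (N n)%:R)) => //.
- exact: (level_weight_ge1).
- by rewrite ler_pdivrMr// ler_peMr ?(ltW c0)// ler1n.
- by rewrite divfK// gt_eqF.
- exact: hnb.
- exact: presented_weaken C2C (h2 _ _ _ T2D wpos).
- exact: test_weaken C1C (weight_ge0 _ _ _) (h1 r rE n).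
Qed.

Lemma bop_id_pred (V : normedModType K) : idfun \in bop_pred V V.
Proof. by apply/asboolP; split=> //; exists 1 => x; rewrite mul1r. Qed.

Definition idbop (V : normedModType K) : bop V V := Bop (bop_id_pred V).

Lemma test_on r (D : pred nat) (T : bop X Y) n : level_vector r -> is_block D T -> D n ->
  test r T (idbop Y) (idbop X) n = 1.
Proof.
move=> rE TD Dn; have E := level_exact rE TD Dn.
rewrite /test [X in modulus X](_ : _ = (N n)%:R) ?modulus_natr ?divff//.
by rewrite pnatr_eq0 -lt0n (growth_gt0 hgrow).
Qed.

Variables (r : nat -> nat -> X) (psi : nat -> R).
Hypothesis rE : level_vector r.
Hypothesis psi_dense : forall a b n0, a < b -> exists2 n, (n0 <= n)%N & a < psi n < b.

Local Notation incl := (formal_inclusion K p1 q1 (ltW p_q)).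

Lemma test_linear_comb (a : K) (S T : bop X Y) A B n :
  test r (a *: S + T) A B n <= modulus a * test r S A B n + test r T A B n.
Proof.
have gl i := functional_linear (@level_functional_linear n i).
rewrite /test mulrA -mulrDl ler_wpM2r ?invr_ge0//.
have -> : \sum_(0 <= i < N n) level_functional n i (A ((a *: S + T) (B (r n i)))) =
    a * (\sum_(0 <= i < N n) level_functional n i (A (S (B (r n i))))) + \sum_(0 <= i < N n) level_functional n i (A (T (B (r n i)))).
  rewrite mulr_sumr -big_split/=; apply: eq_bigr => i _.
  have [_ gZ gD] := gl i; rewrite -gZ -gD -linearZ -linearD; congr (level_functional n i (A _)).
by rewrite -modulusM; exact: modulusD.
Qed.

(** For fixed [A] and [B] the tests are bounded in the operator norm uniformly in [n]; this makes
    the ideals closed. *)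
Lemma test_opnorm : exists2 C, 0 <= C & forall (S : bop X Y) A B n,
  test r S A B n <= C * opnorm A * opnorm S * opnorm B.
Proof.
have [C C1 hC] := level_test.
have C0 : 0 <= C by lra.
exists (C * C) => [|S A B n]; first exact: mulr_ge0.
have [gl rC gC _ _] := hC r rE n.
have Nn : 0 < (N n)%:R :> R by rewrite ltr0n (growth_gt0 hgrow).
rewrite /test ler_pdivrMr// mulr_natr -[X in _ *+ X]subn0 -sumr_const_nat.
apply: le_trans (modulus_sum _ _ _) _; apply: ler_sum_nat => i /andP[_ iN].
have nA : 0 <= opnorm A by exact: opnorm_ge0.
have nB : 0 <= opnorm B by exact: opnorm_ge0.
have nS : 0 <= opnorm S by exact: opnorm_ge0.
apply: le_trans (gC _ _ iN) _; rewrite -!mulrA ler_wpM2l//.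
apply: le_trans (bop_norm_le _ _) _; rewrite mulrCA ler_wpM2l//.
apply: le_trans (bop_norm_le _ _) _; rewrite mulrCA ler_wpM2l//.
by apply: le_trans (bop_norm_le _ _) _; rewrite mulrC ler_wpM2r// rC.
Qed.

Definition tested_ideal (rho : R) : set (bop X Y) := [set S : bop X Y | controlled S /\
  forall A B (e : R), 0 < e -> exists n0, forall n, (n0 <= n)%N -> rho <= psi n -> test r S A B n <= e].

Lemma tested_incl rho : tested_ideal rho incl.
Proof.
split; first exact: incl_controlled.
move=> A B e e0.
have [C C1 hC] := level_test.
have [c c0 hc] := test_presented hK p_1 p_q p'_1 q'_1 pp qq hsp A B C1 e0.
have [n0 hn0] := growth_gain hgrow c0; exists n0 => n nn _.
have Nn : 0 < (N n)%:R :> R by rewrite ltr0n (growth_gt0 hgrow).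
rewrite /test ler_pdivrMr//.
apply: (hc (N n) (level_weight n) 0) => //.
- exact: (growth_gt0 hgrow).
- exact: (level_weight_ge1).
- exact: ltW.
- by rewrite mul0r ltW.
- exact: hn0.
- exact: (presented_weaken C1 (incl_presented q1 p_q sp p'_1 pp)).
- exact: hC.
Qed.

Lemma tested_lin rho (a : K) S T : tested_ideal rho S -> tested_ideal rho T ->
  tested_ideal rho (a *: S + T).
Proof.
move=> [cS hS] [cT hT]; split; first exact: controlledD.
move=> A B e e0; have ma := modulus_ge0 a.
have e1 : 0 < e / 2 / (modulus a + 1) by rewrite !divr_gt0//; lra.
have e2 : 0 < e / 2 by rewrite divr_gt0.
have [n1 h1] := hS A B _ e1; have [n2 h2] := hT A B _ e2.
exists (maxn n1 n2) => n; rewrite geq_max => /andP[nn1 nn2] rn.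
apply: le_trans (test_linear_comb _ _ _ _ _ _) _.
rewrite [leRHS]splitr.
apply: lerD; last exact: h2.
apply: le_trans (ler_wpM2l ma (h1 n nn1 rn)) _.
by rewrite mulrCA ler_piMr ?(ltW e2)// ler_pdivrMr ?mul1r ?lerDl// ltr_wpDl.
Qed.

Lemma tested_op_ideal rho : op_ideal (tested_ideal rho).
Proof.
have hl := tested_lin; split; last 2 first.
- by move=> a S T; exact: hl.
- move=> A S B [cS hS]; split; first exact: controlled_comp.
  by move=> A' B'; exact: (hS (bcomp A' A) (bcomp B B')).
(* The zero operator is obtained as the formal inclusion minus itself. *)
have := hl rho (-1) _ _ (tested_incl rho) (tested_incl rho).
by rewrite scaleN1r addNr.
Qed.

Lemma tested_closed rho : closed (tested_ideal rho).
Proof.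
have [C C0 hC] := test_opnorm.
move=> T clT.
have hT eps : 0 < eps -> exists2 S, tested_ideal rho S & opnorm (T - S) <= eps.
  move=> e0; have e0' : 0 < (ofreal eps : K) by rewrite -(rmorph0 (@ofreal R K)) (leW_mono (ler_ofreal K)).
  have [S [JS]] := clT _ (nbhsx_ballx T _ e0').
  rewrite -ball_normE /= norm_bopE (leW_mono (ler_ofreal K)) => TS.
  by exists S => //; exact: ltW.
split.
  by apply: controlled_closed => eps /hT[S [cS _] TS]; exists S.
move=> A B e e0.
have nA : 0 <= opnorm A by exact: opnorm_ge0.
have nB : 0 <= opnorm B by exact: opnorm_ge0.
have D0 : 0 <= C * opnorm A * opnorm B by rewrite !mulr_ge0.
have e2 : 0 < e / 2 by rewrite divr_gt0.
have e1 : 0 < e / 2 / (C * opnorm A * opnorm B + 1) by rewrite !divr_gt0// ltr_wpDl.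
have [S [_ hS] TS] := hT _ e1; have [n0 hn0] := hS A B _ e2.
exists n0 => n nn rn; have -> : T = 1 *: (T - S) + S by rewrite scale1r subrK.
apply: le_trans (test_linear_comb _ _ _ _ _ _) _.
rewrite [leRHS]splitr.
rewrite (_ : modulus 1 = 1) ?mul1r; last by rewrite -(rmorph1 (@ofreal R K)) modulus_ofreal normr1.
apply: lerD; last exact: hn0.
apply: le_trans (hC _ _ _ _) _; rewrite mulrAC.
apply: le_trans (ler_wpM2l D0 TS) _.
by rewrite mulrCA ler_piMr ?(ltW e2)// ler_pdivrMr ?mul1r ?lerDl// ltr_wpDl.
Qed.

Lemma tested_gen rho : closed_ideal_gen X Y incl `<=` tested_ideal rho.
Proof.
have [J0 Jl Jc] := tested_op_ideal rho.
have /closure_id-> : closed (tested_ideal rho) by exact: tested_closed.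
apply: closure_subset => S [n [A [B ->]]].
elim/big_rec : _ => // i S' _ JS'; rewrite -[bcomp _ _]scale1r.
by apply: Jl => //; apply: Jc; exact: tested_incl.
Qed.

Lemma tested_mono rho rho' : rho <= rho' -> tested_ideal rho `<=` tested_ideal rho'.
Proof.
move=> rr S [cS hS]; split=> // A B e e0; have [n0 h] := hS A B e e0.
by exists n0 => n nn rn; apply: h => //; exact: le_trans rn.
Qed.

Lemma tested_strict rho rho' : rho < rho' ->
  exists2 S, tested_ideal rho' S & ~ tested_ideal rho S.
Proof.
move=> rr; pose D : pred nat := fun n => rho <= psi n < rho'.
have [CT CT1 hT] := block_exists.
have [T TD _] := hT D; exists T; [split|].
- exact: (block_controlled (growth_weight hgrow) TD).
- move=> A B e e0; have [n0 hn0] := test_off A B rE e0.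
  exists n0 => n nn rn; apply: (hn0 n D T) => //.
  by rewrite /D negb_and -!ltNge -leNgt rn orbT.
move=> [_ hS]; have h2 : 0 < 2^-1 :> R by rewrite invr_gt0.
have [n0 hn0] := hS (idbop Y) (idbop X) _ h2.
have [n nn /andP[rn nr]] := psi_dense n0 rr.
have Dn : D n by rewrite /D (ltW rn) nr.
have := hn0 n nn (ltW rn); rewrite (test_on rE TD Dn); lra.
Qed.

Lemma tested_inj : injective tested_ideal.
Proof.
suff h rho rho' : rho < rho' -> tested_ideal rho <> tested_ideal rho'.
  move=> rho rho' E; case: (ltgtP rho rho') => // /h; first by [].
  by rewrite E.
by move=> /tested_strict[S JS nJS] E; apply: nJS; rewrite E.
Qed.

End BlockOperators.

(** * Choice of the parameters of the levels *)

Section GrowthExists.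
Variables (R : realType) (p q p' q' : R) (sp : bool).
Hypotheses (p_1 : 1 < p) (p_q : p < q) (p'_1 : 1 < p') (q'_1 : 1 < q').
Hypotheses (pp : p^-1 + p'^-1 = 1) (qq : q^-1 + q'^-1 = 1).
Hypothesis hsp : if sp then p < 2 else 2 <= p.

Local Notation rexp := (rexp q p' sp).
Local Notation rexp' := (rexp' p q' sp).
Local Notation gain := (gain p q p' q' sp).

Lemma natr_powR_small (a e : R) : 0 < a -> 0 < e ->
  exists n0 : nat, forall n, (n0 <= n)%N -> n.+1%:R `^ (- a) <= e.
Proof.
move=> a0 e0; have [n0 hn0] := nat_above (e `^ (- a^-1)); exists n0 => n n0n.
have x0 : 0 < e `^ (- a^-1) by exact: powR_gt0.
have xn : e `^ (- a^-1) <= n.+1%:R.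
  by apply: le_trans hn0 _; rewrite ler_nat ltnW.
apply: (@le_trans _ _ ((e `^ (- a^-1)) `^ (- a))); last first.
  by rewrite -powRrM mulrNN mulVf ?gt_eqF// powRr1// ltW.
rewrite !(powRN _ a) lef_pV2 ?posrE ?powR_gt0 ?ltr0n//.
by apply: ler_pow => //; exact: ltW.
Qed.

Lemma gain_lt0 : gain < 0.
Proof.
have [r2 rr r'1 r'2 r'e] := exponents p_1 p_q p'_1 q'_1 pp qq hsp.
have m0 : rexp' < Num.min (eexp q p' sp) 2 by rewrite lt_min r'e r'2.
have mp : 0 < Num.min (eexp q p' sp) 2 by apply: lt_trans m0; lra.
rewrite /gain subr_lt0 ltr_pdivrMr ?mulr_gt0//.
by rewrite mulrA mulVf// mul1r.
Qed.

(** The pair is [(d, N)] for stage [n], and [s] is the total size of the earlier levels. First [d]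
    is taken large, for the condition involving [s + 1] that covers both [growth_weight] and
    [growth_high]; this fixes the loss [W], and [N] is then taken large against it. *)
Lemma level_choice (n s : nat) : exists t : nat * nat, let D := t.1.+1%:R^-1 : R in
  [/\ (0 < t.2)%N, D `^ (2^-1 - rexp^-1) * (s%:R + 1) <= n.+1%:R^-1,
      D `^ (2^-1 - rexp'^-1) * t.2%:R `^ gain <= n.+1%:R^-1 &
      (n * s)%:R * D `^ (2^-1 - rexp'^-1) <= n.+1%:R^-1 * t.2%:R].
Proof.
have [r2 rr r'1 r'2 r'e] := exponents p_1 p_q p'_1 q'_1 pp qq hsp.
have a0 : 0 < 2^-1 - rexp^-1 by rewrite subr_gt0 ltf_pV2 ?posrE//; lra.
have e0 : 0 < n.+1%:R^-1 :> R by rewrite invr_gt0.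
have s0 : 0 < s%:R + 1 :> R by rewrite ltr_wpDl.
have [d hd] := natr_powR_small a0 (divr_gt0 e0 s0).
set W := (d.+1%:R^-1 : R) `^ (2^-1 - rexp'^-1).
have W0 : 0 < W by rewrite powR_gt0 ?invr_gt0.
have g0 : 0 < - gain by rewrite oppr_gt0; exact: gain_lt0.
have [N1 h1] := natr_powR_small g0 (divr_gt0 e0 W0).
have [N2 h2] := nat_above ((n * s)%:R * W * n.+1%:R).
exists (d, (maxn N1 N2).+1) => /=; rewrite -/W; split=> //.
- rewrite -ler_pdivlMr//; apply: le_trans (hd d (leqnn d)).
  by rewrite -(powR_inv1 (_ : 0 <= d.+1%:R))// -powRrM mulN1r.
- have := h1 _ (leq_maxl N1 N2); rewrite opprK => h.
  by rewrite mulrC -ler_pdivlMr.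
- rewrite ler_pdivlMl// mulrC; apply: le_trans h2 _.
  by rewrite ler_nat leqW// leq_maxr.
Qed.

Lemma growth_exists : exists d N : nat -> nat, growth p q p' q' sp d N.
Proof.
have [F hF] := choice (fun t => level_choice t.1 t.2).
(* The recursion need only carry the total of the earlier [N], since nothing else about them enters
   the choice at stage [n]. *)
pose s := nat_rect (fun=> nat) 0%N (fun n sn => (sn + (F (n, sn)).2)%N).
pose d n := (F (n, s n)).1; pose N n := (F (n, s n)).2.
have sE n : width N n = s n.
  by rewrite /width; elim: n => [|n IH]; rewrite ?big_ord0// big_ord_recr/= IH.
have small e : 0 < e -> exists n0, forall n, (n0 <= n)%N -> n.+1%:R^-1 <= e :> R.
  move=> e0; have [n0 h] := nat_above e^-1; exists n0 => n nn.
  rewrite -[leRHS]invrK lef_pV2 ?posrE ?invr_gt0//; apply: le_trans h _.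
  by rewrite ler_nat ltnW.
exists d, N; split=> [n|e e0|e e0|e e0|e e0]; first by have [] := hF (n, s n).
all: have [n0 h0] := small e e0; exists n0 => n.
- move=> /h0; apply: le_trans; have [_ + _ _] := hF (n, s n); apply: le_trans.
  by rewrite ler_peMr ?powR_ge0// lerDr.
- move=> m nn nm; apply: le_trans (h0 m (leq_trans nn (ltnW nm))).
  have [_ + _ _] := hF (m, s m); apply: le_trans; rewrite ler_wpM2l ?powR_ge0//.
  apply: (@le_trans _ _ (s m)%:R); last by rewrite lerDl.
  by rewrite ler_nat -sE /width (bigD1 (Ordinal nm))//= leq_addr.
- by move=> /h0; apply: le_trans; have [] := hF (n, s n).
- move=> /h0 h; have [_ _ _] := hF (n, s n); rewrite -/(N n) sE => hh; apply: le_trans hh _.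
  by rewrite ler_wpM2r.
Qed.

End GrowthExists.

Lemma dense_sequence (R : realType) : exists psi : nat -> R,
  forall a b n0, a < b -> exists2 n, (n0 <= n)%N & a < psi n < b.
Proof.
(* The 2-adic valuation takes every value infinitely often. *)
exists (fun n => if unpickle (logn 2 n) is Some x then ratr (x : rat) else 0) => a b n0 ab.
have [x /[!in_itv]/= xab] := rat_in_itvoo ab.
have lognE2 k : logn 2 (2 ^ k * n0.*2.+1) = k.
  by rewrite lognM ?expn_gt0// pfactorK// logn_coprime ?addn0// coprime2n/= odd_double.
(* An odd cofactor leaves the valuation at the code of [x]; taking it above [n0] puts the index
   beyond [n0]. *)
exists (2 ^ pickle x * (n0.*2.+1))%N.
  by rewrite (leq_trans _ (leq_pmull _ _)) ?expn_gt0// -addnn leqW// leq_addr.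
rewrite lognE2 pickleK; exact: xab.
Qed.

Theorem theorem1 (R : realType) (K : scalarField R)
    (hK : K = real_scalars R \/ K = complex_scalars R)
    (p q : R) (hp : 1 < p) (hpq : p < q) :
  let p1 : 1 <= p := ltW hp in
  let q1 : 1 <= q := ltW (lt_trans hp hpq) in
  exists F : set (set (bop (ell K p1) (ell K q1))),
    [/\ (F #= [set: R])%card,
        forall J1 J2, F J1 -> F J2 -> J1 `<=` J2 \/ J2 `<=` J1 &
        forall J, F J ->
          [/\ closed_ideal J,
              closed_ideal_gen (ell K p1) (ell K q1) (formal_inclusion K p1 q1 (ltW hpq)) `<=` J &
              J `<=` FS (ell K p1) (ell K q1)]].
Proof.
move=> p1 q1; have hq : 1 < q := lt_trans hp hpq.
have conj1 (x : R) : 1 < x -> 1 < x / (x - 1).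
  by move=> x1; rewrite ltr_pdivlMr; lra.
have conjV (x : R) : 1 < x -> x^-1 + (x / (x - 1))^-1 = 1.
  by move=> x1; field; rewrite !gt_eqF//; lra.
have [p'1 q'1] := (conj1 p hp, conj1 q hq); have [pp qq] := (conjV p hp, conjV q hq).
pose sp := p < 2.
have hsp : if sp then p < 2 else 2 <= p by rewrite /sp; case: ltP.
have [d [N hgrow]] := growth_exists hp hpq p'1 q'1 pp qq hsp.
have [r rE] := level_vectors K d N p1 sp.
have [psi hpsi] := dense_sequence R.
pose J := tested_ideal (p1 := p1) (q1 := q1) (q / (q - 1)) sp d N r psi.
exists (range J); split=> [|_ _ [a _ <-] [b _ <-]|_ [a _ <-]].
- apply: inj_card_eq => a b _ _.
  exact: (tested_inj hK hp hpq p'1 q'1 pp qq hsp hgrow rE hpsi).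
- by have [ab|/ltW ba] := leP a b; [left|right]; exact: tested_mono.
- split; [split|exact: (@tested_gen _ _ hK _ _ _ _ p1 q1 sp hp hpq p'1 q'1 pp qq hsp d N hgrow r psi rE a)|].
  + exact: (tested_op_ideal hK q1 hp hpq p'1 q'1 pp qq hsp hgrow psi rE a).
  + exact: (tested_closed hK hp hpq p'1 q'1 pp qq hsp hgrow rE).
  + by move=> S [cS _]; exact: controlled_FS.
Qed.
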